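(* Let $\mathcal R=(\mathbb R,<,+,\dots)$ be an expansion of the ordered additive group of real numbers, and suppose $\mathcal R$ does not define an isomorphic copy of the two-sorted structure $(\mathcal P(\mathbb N),\mathbb N,\in,+,\cdot)$. Then the following are equivalent: (1) $\mathcal R$ defines a non-affine $C^1$ function $f:I\to\mathbb R$ for some nonempty bounded open interval $I$; (2) $\mathcal R$ is of field-type.
   Context: ''Definable'' means definable in $\mathcal R$ with parameters. ''Defines an isomorphic copy'' of a (two-sorted) structure means there are definable sets and definable relations/functions on them forming a structure isomorphic to it. $\mathcal P(\mathbb N)$ is the power set of $\mathbb N$. $\mathcal R$ is of field-type if there are a nonempty bounded open interval $I$ and definable $\oplus,\otimes:I^2\to I$ with $(I,<,\oplus,\otimes)$ isomorphic to $(\mathbb R,<,+,\cdot)$. *)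

(* Defs.v *)
From HB Require Import structures.
From mathcomp Require Import all_boot all_order all_algebra.
From mathcomp Require Import all_classical all_reals all_analysis.

Set Implicit Arguments.
Unset Strict Implicit.
Unset Printing Implicit Defensive.

Import Order.TTheory GRing.Theory Num.Theory.
Import numFieldNormedType.Exports.

Local Open Scope classical_set_scope.
Local Open Scope ring_scope.

(* The symbols that an expansion of (R, <, +) has besides < and +, which are
   primitive in [term] and [formula]. *)
Record signature := Signature {
  fun_symb : Type;
  fun_arity : fun_symb -> nat;
  rel_symb : Type;
  rel_arity : rel_symb -> nat }.

Record expansion (R : realType) (L : signature) := Expansion {
  fun_interp : forall s : fun_symb L, 'rV[R]_(fun_arity s) -> R;
  rel_interp : forall s : rel_symb L, set 'rV[R]_(rel_arity s) }.

Section Definability.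
Variables (R : realType) (L : signature).

(* First-order syntax with n free variables; [Par] provides a constant for
   each real number, so that definability is definability with parameters. *)
Inductive term (n : nat) : Type :=
| Var of 'I_n
| Par of R
| Add of term n & term n
| Fun (s : fun_symb L) of ('I_(fun_arity s) -> term n).

(* The variable bound by [Ex] is the last one. *)
Inductive formula (n : nat) : Type :=
| Eq of term n & term n
| Lt of term n & term n
| Rel (s : rel_symb L) of ('I_(rel_arity s) -> term n)
| Not of formula n
| And of formula n & formula n
| Ex of formula (n + 1).

Variable M : expansion R L.

Fixpoint eval n (x : 'rV[R]_n) (t : term n) : R :=
  match t with
  | Var i => x ord0 i
  | Par c => c
  | Add t1 t2 => eval x t1 + eval x t2
  | Fun s ts => fun_interp M (\row_i eval x (ts i))
  end.

Fixpoint sat n (x : 'rV[R]_n) (phi : formula n) : Prop :=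
  match phi with
  | Eq t1 t2 => eval x t1 = eval x t2
  | Lt t1 t2 => eval x t1 < eval x t2
  | Rel s ts => rel_interp M (\row_i eval x (ts i))
  | Not phi1 => ~ sat x phi1
  | And phi1 phi2 => sat x phi1 /\ sat x phi2
  | Ex phi1 => exists y : R, sat (row_mx x (const_mx y)) phi1
  end.

Definition definable n (A : set 'rV[R]_n) : Prop :=
  exists phi : formula n, A = [set x | sat x phi].

(* f : R -> R stands for its restriction to D. *)
Definition definable_fun1 (D : set R) (f : R -> R) : Prop :=
  definable [set \row_(i < 2) [:: x; f x]`_i | x in D].

Definition definable_op1 (D : set R) (op : R -> R -> R) : Prop :=
  definable [set \row_(i < 3) [:: x; y; op x y]`_i | x in D & y in D].

Definition definable_op n (D : set 'rV[R]_n)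
    (op : 'rV[R]_n -> 'rV[R]_n -> 'rV[R]_n) : Prop :=
  definable [set row_mx (row_mx x y) (op x y) | x in D & y in D].

Definition defines_copy_PN : Prop :=
  exists (p q : nat) (P : set 'rV[R]_p) (N : set 'rV[R]_q)
    (elt : set 'rV[R]_(q + p)) (add mul : 'rV[R]_q -> 'rV[R]_q -> 'rV[R]_q),
  [/\ [/\ definable P, definable N, definable elt,
          definable_op N add & definable_op N mul],
      {in N &, forall x y, N (add x y)} /\ {in N &, forall x y, N (mul x y)},
      (forall u, elt u -> N (lsubmx u) /\ P (rsubmx u))
    & exists (g : 'rV[R]_p -> set nat) (h : 'rV[R]_q -> nat),
      [/\ set_bij P [set: set nat] g, set_bij N [set: nat] h,
          {in N & P, forall x X, elt (row_mx x X) <-> g X (h x)},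
          {in N &, forall x y, h (add x y) = (h x + h y)%N}
        & {in N &, forall x y, h (mul x y) = (h x * h y)%N}]].

Definition field_type : Prop :=
  exists (a b : R) (oplus otimes : R -> R -> R),
  let I := `]a, b[%classic in
  [/\ a < b,
      {in I &, forall x y, I (oplus x y)} /\
        {in I &, forall x y, I (otimes x y)},
      definable_op1 I oplus, definable_op1 I otimes
    & exists phi : R -> R,
      [/\ set_bij I [set: R] phi,
          {in I &, forall x y, x < y <-> phi x < phi y},
          {in I &, forall x y, phi (oplus x y) = phi x + phi y}
        & {in I &, forall x y, phi (otimes x y) = phi x * phi y}]].

End Definability.

Definition C1_on (R : realType) (U : set R) (f : R -> R) : Prop :=
  {in U, forall x : R, derivable f x 1 /\ {for x, continuous (derive1 f)}}.

Definition affine_on (R : realType) (U : set R) (f : R -> R) : Prop :=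
  exists c d : R, {in U, forall x, f x = c * x + d}.

(* Main.v *)
(* From a function to a field: the germs of f at the points of I, recentred at
   the origin, are compared near 0 by the order of the slopes f' (s); the sum of
   two germs adds slopes and their composition multiplies them. As no product is
   available, f is first replaced by n f - m x, with slopes covering [-4, 4]. If
   f' is injective on some interval, that interval inherits the field structure
   of the slopes. Otherwise the values of f' at its local extrema form a dense
   set, and those at extrema of a given radius form a finite set.

   A dense set of reals exhausted by a definable family of finite sets F r, in
   the presence of a field, codes second-order arithmetic. A real x is approached
   from the left by record elements e 0 < e 1 < ..., which appear at stages
   r 0 > r 1 > ...; for a suitable x these decrease so fast that the gaps left
   between the elements of F (r k) can contain copies of the earlier e i. A second
   real y lies in one gap for each k, and its position there points at some e i,
   i <= k, or records one bit. Hence y codes a map or a subset of the natural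
   numbers, and a few such y encode addition and multiplication.

   From a field to a function: let phi : I -> R be the order isomorphism and
   h(x, t) = phi(x + t) + phi(x - t) - 2 phi(x). If phi is neither convex nor
   concave on any interval, then on every interval h(., t) takes both signs for
   all small t, so h(x0, .) oscillates for some x0, and the endpoints of the long
   components of {h(., t) > 0} and {h(., t) < 0}, with t among the lengths of the
   components of {h(x0, .) > 0}, again give a dense set exhausted by finite ones.
   Likewise the kinks of a convex phi cannot be dense. So phi is C^1 somewhere,
   and x |-> phi^-1(w0 + (phi(x) - w0)^2) is C^1 and not affine. *)

From Pilot Require Import Defs.
From mathcomp Require Import all_boot all_order all_algebra.
From mathcomp Require Import all_classical all_reals all_analysis.
From mathcomp Require Import ring lra zify.
Import Pilot.Defs.

Import Order.TTheory GRing.Theory Num.Theory.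
Import numFieldNormedType.Exports.

Local Open Scope classical_set_scope.
Local Open Scope ring_scope.

Set Implicit Arguments.
Unset Strict Implicit.
Unset Printing Implicit Defensive.

(** * Definable relations *)

Section Environments.
Variables (R : realType) (L : signature).

Fixpoint tsubst n m (s : 'I_n -> term R L m) (t : term R L n) : term R L m :=
  match t with
  | Var i => s i
  | Par c => Par L m c
  | Add t1 t2 => Add (tsubst s t1) (tsubst s t2)
  | Fun k ts => Fun (fun i => tsubst s (ts i))
  end.

Definition tlift n m (s : 'I_n -> term R L m) (i : 'I_(n + 1)) :
    term R L (m + 1) :=
  match fintype.split i with
  | inl j => tsubst (fun k => Var R L (lshift 1 k)) (s j)
  | inr j => Var R L (rshift m j)
  end.

Fixpoint fsubst n (phi : formula R L n) :
    forall m, ('I_n -> term R L m) -> formula R L m :=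
  match phi with
  | Eq t1 t2 => fun m s => Eq (tsubst s t1) (tsubst s t2)
  | Lt t1 t2 => fun m s => Lt (tsubst s t1) (tsubst s t2)
  | Rel k ts => fun m s => Rel (fun i => tsubst s (ts i))
  | Not phi1 => fun m s => Not (fsubst phi1 s)
  | And phi1 phi2 => fun m s => And (fsubst phi1 s) (fsubst phi2 s)
  | Ex phi1 => fun m s => Ex (fsubst phi1 (tlift s))
  end.

Variable M : expansion R L.

Lemma eval_tsubst n m (s : 'I_n -> term R L m) (x : 'rV[R]_m) t :
  eval M x (tsubst s t) = eval M (\row_i eval M x (s i)) t.
Proof.
elim: t => [i|c|t1 IH1 t2 IH2|k ts IH] /=; first by rewrite mxE.
- by [].
- by rewrite IH1 IH2.
- by congr fun_interp; apply/rowP => i; rewrite !mxE IH.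
Qed.

Lemma sat_fsubst n (phi : formula R L n) m (s : 'I_n -> term R L m)
    (x : 'rV[R]_m) :
  sat M x (fsubst phi s) <-> sat M (\row_i eval M x (s i)) phi.
Proof.
elim: phi m s x => {n} [n t1 t2|n t1 t2|n k ts|n phi IH|n phi1 IH1 phi2 IH2|n phi IH]
  m s x /=.
- by rewrite !eval_tsubst.
- by rewrite !eval_tsubst.
- rewrite (_ : \row_i _ = \row_i eval M (\row_i0 eval M x (s i0)) (ts i)) //.
  by apply/rowP => i; rewrite !mxE eval_tsubst.
- by split=> H1 H2; apply: H1; apply/IH.
- by split=> -[/IH1 ? /IH2 ?].
- have E y : \row_i eval M (row_mx x (const_mx y)) (tlift s i)
      = row_mx (\row_i eval M x (s i)) (const_mx y).
    apply/rowP => i; rewrite !mxE /tlift; case: (fintype.split i) => j /=.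
      rewrite eval_tsubst mxE; congr eval; apply/rowP => k.
      by rewrite !mxE /= row_mxEl.
    by rewrite row_mxEr !mxE.
  split=> -[y H]; exists y.
    by rewrite -E; apply/(IH _ (tlift s)).
  by apply/(IH _ (tlift s)); rewrite E.
Qed.

Definition env (n : nat) (v : nat -> R) : 'rV[R]_n := \row_(i < n) v i.

Definition Def (P : (nat -> R) -> Prop) : Prop :=
  exists n (phi : formula R L n), forall v, P v <-> sat M (env n v) phi.

Definition shift (v : nat -> R) : nat -> R := fun i => v i.+1.

Lemma Def_ext P Q : (forall v, P v <-> Q v) -> Def P -> Def Q.
Proof.
by move=> PQ [n [phi H]]; exists n, phi => v; rewrite -PQ; apply: H.
Qed.

Lemma Def_at (P : (nat -> R) -> Prop) (rho : nat -> nat) : Def P ->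
  exists n0, forall n, (n0 <= n)%N -> exists phi : formula R L n,
    forall v, P (v \o rho) <-> sat M (env n v) phi.
Proof.
move=> [n [phi H]]; exists (\max_(i < n) rho i).+1 => m lem.
have rm (i : 'I_n) : (rho i < m)%N.
  by apply: leq_trans lem; rewrite ltnS (leq_bigmax i).
pose s i : term R L m := Var R L (Ordinal (rm i)).
exists (fsubst phi s) => v.
rewrite H (_ : env n (v \o rho) = \row_i eval M (env m v) (s i)).
  by apply: iff_sym; apply: sat_fsubst.
by apply/rowP => i; rewrite !mxE /= mxE.
Qed.

Lemma Def_ren (P : (nat -> R) -> Prop) (rho : nat -> nat) : Def P ->
  Def (fun v => P (fun i => v (rho i))).
Proof. by move=> /(Def_at rho)[n /(_ n (leqnn n))[phi H]]; exists n, phi. Qed.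

Lemma Def_and P Q : Def P -> Def Q -> Def (fun v => P v /\ Q v).
Proof.
move=> /(Def_at id)[n1 H1] /(Def_at id)[n2 H2].
have [phi1 E1] := H1 _ (leq_maxl n1 n2); have [phi2 E2] := H2 _ (leq_maxr n1 n2).
by exists (maxn n1 n2), (And phi1 phi2) => v /=; rewrite -E1 -E2.
Qed.

Lemma Def_not P : Def P -> Def (fun v => ~ P v).
Proof. by move=> [n [phi H]]; exists n, (Not phi) => v /=; rewrite H. Qed.

Lemma Def_or P Q : Def P -> Def Q -> Def (fun v => P v \/ Q v).
Proof.
move=> /Def_not dP /Def_not dQ; apply: Def_ext (Def_not (Def_and dP dQ)) => v.
by split=> [/not_andP[/contrapT|/contrapT]|[Pv [/(_ Pv)]|Qv [_ /(_ Qv)]]]; auto.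
Qed.

Lemma Def_imp P Q : Def P -> Def Q -> Def (fun v => P v -> Q v).
Proof.
move=> dP /Def_not dQ; apply: Def_ext (Def_not (Def_and dP dQ)) => v.
by split=> [/not_andP[nP /nP//|/contrapT//]|PQ [/PQ Qv /(_ Qv)]].
Qed.

Lemma Def_iff P Q : Def P -> Def Q -> Def (fun v => P v <-> Q v).
Proof. by move=> dP dQ; apply: Def_and; apply: Def_imp. Qed.

Lemma Def_ex (P : (nat -> R) -> R -> Prop) :
  Def (fun v => P (shift v) (v 0%N)) -> Def (fun v => exists y, P v y).
Proof.
move=> [n [phi H]].
pose s (i : 'I_n) : term R L (n + 1) :=
  match i : nat with
  | 0 => Var R L (rshift n ord0)
  | j.+1 => Var R L (lshift 1 (insubd i j))
  end.
exists n, (Ex (fsubst phi s)) => v /=.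
have E y : env n (fun i => if i is j.+1 then v j else y) =
    \row_i eval M (row_mx (env n v) (const_mx y)) (s i).
  apply/rowP => i; rewrite !mxE /s; case: i => -[|j] lti /=.
    by rewrite row_mxEr mxE.
  by rewrite row_mxEl mxE val_insubd (ltnW lti).
split=> -[y Py]; exists y.
  by apply/sat_fsubst; rewrite -E -H.
by move/sat_fsubst: Py; rewrite -E -H.
Qed.

Lemma Def_all (P : (nat -> R) -> R -> Prop) :
  Def (fun v => P (shift v) (v 0%N)) -> Def (fun v => forall y, P v y).
Proof.
move=> /Def_not dP.
apply: Def_ext (Def_not (@Def_ex (fun v y => ~ P v y) dP)) => v.
by split=> [/forallNP H y|H [y /(_ (H y))]//]; apply: contrapT => /H.
Qed.

Definition DT (t : (nat -> R) -> R) := Def (fun v => v 0%N = t (shift v)).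

Lemma Def_eqvar i j : Def (fun v => v i = v j).
Proof.
have li : (i < maxn i.+1 j.+1)%N by rewrite leq_max leqnn.
have lj : (j < maxn i.+1 j.+1)%N by rewrite leq_max leqnn orbT.
exists (maxn i.+1 j.+1), (Eq (Var R L (Ordinal li)) (Var R L (Ordinal lj))) => v /=.
by rewrite !mxE.
Qed.

Lemma Def_ltvar i j : Def (fun v => v i < v j).
Proof.
have li : (i < maxn i.+1 j.+1)%N by rewrite leq_max leqnn.
have lj : (j < maxn i.+1 j.+1)%N by rewrite leq_max leqnn orbT.
exists (maxn i.+1 j.+1), (Lt (Var R L (Ordinal li)) (Var R L (Ordinal lj))) => v /=.
by rewrite !mxE.
Qed.

Lemma Def_addvar : Def (fun v => v 0%N = v 1%N + v 2%N).
Proof.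
pose x (i : nat) (lei : (i < 3)%N) := Var R L (Ordinal lei).
by exists 3%N, (Eq (@x 0%N isT) (Add (@x 1%N isT) (@x 2%N isT))) => v /=; rewrite !mxE.
Qed.

Lemma DT_var i : DT (fun v => v i).
Proof. exact: Def_eqvar. Qed.

Lemma DT_const c : DT (fun=> c).
Proof.
by exists 1%N, (Eq (Var R L ord0) (Par L 1 c)) => v /=; rewrite !mxE.
Qed.

Lemma Def_const (Q : Prop) : Def (fun=> Q).
Proof.
have [q|q] := pselect Q.
  by exists 1%N, (Eq (Var R L ord0) (Var R L ord0)) => v /=.
by exists 1%N, (Lt (Var R L ord0) (Var R L ord0)) => v /=; rewrite ltxx; split.
Qed.

Lemma Def_let (P : (nat -> R) -> R -> Prop) t :
  Def (fun v => P (shift v) (v 0%N)) -> DT t -> Def (fun v => P v (t v)).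
Proof.
move=> dP dt; have H := Def_ex (P := fun v y => y = t v /\ P v y) (Def_and dt dP).
by apply: Def_ext H => v; split=> [[y [-> ]]//|]; exists (t v).
Qed.

Lemma Def1 (Q : R -> Prop) t : Def (fun v => Q (v 0%N)) -> DT t ->
  Def (fun v => Q (t v)).
Proof. exact: (@Def_let (fun _ y => Q y)). Qed.

Lemma DT_ren t rho : DT t -> DT (fun v => t (fun i => v (rho i))).
Proof.
by move=> /(@Def_ren _ (fun i => if i is j.+1 then (rho j).+1 else 0%N)) H.
Qed.

Lemma Def2 (Q : R -> R -> Prop) t u : Def (fun v => Q (v 0%N) (v 1%N)) ->
  DT t -> DT u -> Def (fun v => Q (t v) (u v)).
Proof.
move=> dQ dt du; apply: (@Def_let (fun v y => Q (t v) y)) du.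
apply: (@Def_let (fun v y => Q y (v 0%N)) (fun v => t (shift v))).
  exact: (Def_ren (fun i => if i is 0%N then 0%N else 1%N) dQ).
exact: (DT_ren S dt).
Qed.

Lemma Def3 (Q : R -> R -> R -> Prop) t u w :
  Def (fun v => Q (v 0%N) (v 1%N) (v 2%N)) ->
  DT t -> DT u -> DT w -> Def (fun v => Q (t v) (u v) (w v)).
Proof.
move=> dQ dt du dw; apply: (@Def_let (fun v y => Q (t v) (u v) y)) dw.
apply: (@Def_let (fun v y => Q (t (shift v)) y (v 0%N)) (fun v => u (shift v)));
  last exact: (DT_ren S du).
apply: (@Def_let (fun v y => Q y (v 0%N) (v 1%N)) (fun v => t (shift (shift v))));
  last exact: (DT_ren (S \o S) dt).
by [].
Qed.

Lemma Def4 (Q : R -> R -> R -> R -> Prop) t u w z :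
  Def (fun v => Q (v 0%N) (v 1%N) (v 2%N) (v 3%N)) ->
  DT t -> DT u -> DT w -> DT z -> Def (fun v => Q (t v) (u v) (w v) (z v)).
Proof.
move=> dQ dt du dw dz; apply: (@Def_let (fun v y => Q (t v) (u v) (w v) y)) dz.
apply: (@Def_let (fun v y => Q (t (shift v)) (u (shift v)) y (v 0%N))
  (fun v => w (shift v))); last exact: (DT_ren S dw).
apply: (@Def_let (fun v y => Q (t (shift (shift v))) y (v 0%N) (v 1%N))
  (fun v => u (shift (shift v)))); last exact: (DT_ren (S \o S) du).
by apply: (@Def_let (fun v y => Q y (v 0%N) (v 1%N) (v 2%N))
  (fun v => t (shift (shift (shift v))))); last exact: (DT_ren (S \o S \o S) dt).
Qed.

Lemma Def_eq t u : DT t -> DT u -> Def (fun v => t v = u v).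
Proof. exact/(Def2 (Q := fun x y => x = y))/Def_eqvar. Qed.

Lemma Def_lt t u : DT t -> DT u -> Def (fun v => t v < u v).
Proof. exact/(Def2 (Q := fun x y => x < y))/Def_ltvar. Qed.

Lemma Def_le t u : DT t -> DT u -> Def (fun v => t v <= u v).
Proof.
move=> dt du; apply: Def_ext (Def_not (Def_lt du dt)) => v.
by rewrite leNgt; split=> [/negP|/negP].
Qed.

Lemma DT_fun (f : R -> R) t : Def (fun v => v 0%N = f (v 1%N)) -> DT t ->
  DT (fun v => f (t v)).
Proof.
move=> df dt; apply: (Def2 (Q := fun x y => x = f y)) => //.
  exact: DT_var.
exact: DT_ren S dt.
Qed.

Lemma DT_fun2 (f : R -> R -> R) t u :
  Def (fun v => v 0%N = f (v 1%N) (v 2%N)) -> DT t -> DT u ->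
  DT (fun v => f (t v) (u v)).
Proof.
move=> df dt du; apply: (Def3 (Q := fun x y z => x = f y z)) => //.
- exact: DT_var.
- exact: DT_ren S dt.
- exact: DT_ren S du.
Qed.

Lemma DT_add t u : DT t -> DT u -> DT (fun v => t v + u v).
Proof. exact/(DT_fun2 (f := fun x y => x + y))/Def_addvar. Qed.

Lemma DT_opp t : DT t -> DT (fun v => - t v).
Proof.
apply: DT_fun.
apply: Def_ext (Def_eq (DT_add (DT_var 0) (DT_var 1)) (DT_const 0)) => v.
by split=> [/eqP|->]; rewrite ?addNr// addr_eq0 => /eqP.
Qed.

Lemma DT_sub t u : DT t -> DT u -> DT (fun v => t v - u v).
Proof. by move=> dt du; apply: DT_add => //; apply: DT_opp. Qed.

Lemma DT_muln t n : DT t -> DT (fun v => t v *+ n).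
Proof.
move=> dt; elim: n => [|n IH]; first exact: (DT_const 0).
have H : (fun v => t v *+ n.+1) = (fun v => t v + t v *+ n).
  by apply/funext => v; rewrite mulrS.
by rewrite H; apply: DT_add.
Qed.

Lemma DT_if (P : (nat -> R) -> Prop) t u : Def P -> DT t -> DT u ->
  DT (fun v => if `[< P v >] then t v else u v).
Proof.
move=> dP dt du.
apply: Def_ext (Def_or
  (Def_and (Def_ren S dP) dt) (Def_and (Def_not (Def_ren S dP)) du)) => v.
case: asboolP => Pv; first by split=> [[[]|[]]//|]; left.
by split=> [[[]|[]]//|]; right.
Qed.

Lemma DT_max t u : DT t -> DT u -> DT (fun v => Num.max (t v) (u v)).
Proof.
move=> dt du; have := DT_if (Def_lt dt du) du dt.
by apply: Def_ext => v; rewrite asboolb.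
Qed.

Lemma DT_min t u : DT t -> DT u -> DT (fun v => Num.min (t v) (u v)).
Proof.
move=> dt du; have := DT_if (Def_lt dt du) dt du.
by apply: Def_ext => v; rewrite asboolb.
Qed.

Lemma Def_definable n (A : set 'rV[R]_n) :
  Def (fun v => A (env n v)) -> definable M A.
Proof.
move=> /(Def_at id)[m /(_ _ (leq_addl n m))[phi H]].
exists (fsubst phi (fun i => if fintype.split i is inl j then Var R L j else Par L n 0)).
apply/seteqP; split=> x /=; rewrite sat_fsubst;
  pose v i := (if insub i is Some j then x ord0 j else 0);
  have vE : env n v = x by apply/rowP => i; rewrite !mxE /v valK.
  all: have E : \row_(i < n + m) eval M x
      (if fintype.split i is inl j then Var R L j else Par L n 0)
    = env (n + m) v.
    1, 3: apply/rowP => i; rewrite !mxE /v -{2}(splitK i);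
      case: (fintype.split i) => j /=; first (by rewrite valK);
      by rewrite insubF// ltnNge leq_addr.
  by rewrite E => Ax; apply/(H v).1; rewrite (_ : _ \o id = v)// vE.
by rewrite E => /(H v).2; rewrite (_ : _ \o id = v)// vE.
Qed.

Lemma definable_Def n (A : set 'rV[R]_n) :
  definable M A -> Def (fun v => A (env n v)).
Proof. by move=> [phi ->]; exists n, phi. Qed.

End Environments.

Ltac def_beta := cbv beta delta [shift].

Ltac dt_step :=
  lazymatch goal with
  | |- DT _ (fun v => v _) => apply: DT_var
  | |- DT _ (fun v => @?t v + @?u v) => apply: (@DT_add _ _ _ t u)
  | |- DT _ (fun v => - @?t v) => apply: (@DT_opp _ _ _ t)
  | |- DT _ (fun v => @?t v *+ ?n) => apply: (@DT_muln _ _ _ t n)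
  | |- DT _ (fun v => Num.max (@?t v) (@?u v)) => apply: (@DT_max _ _ _ t u)
  | |- DT _ (fun v => Num.min (@?t v) (@?u v)) => apply: (@DT_min _ _ _ t u)
  | |- DT _ (fun v => ?c) => apply: DT_const
  end.

Ltac def_step :=
  lazymatch goal with
  | |- Def _ (fun v => @?P v /\ @?Q v) => apply: (@Def_and _ _ _ P Q)
  | |- Def _ (fun v => @?P v \/ @?Q v) => apply: (@Def_or _ _ _ P Q)
  | |- Def _ (fun v => @?P v <-> @?Q v) => apply: (@Def_iff _ _ _ P Q)
  | |- Def _ (fun v => ~ @?P v) => apply: (@Def_not _ _ _ P)
  | |- Def _ (fun v => exists y, @?P v y) => apply: (@Def_ex _ _ _ P)
  | |- Def _ (fun v => is_true (@?t v < @?u v)) => apply: (@Def_lt _ _ _ t u)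
  | |- Def _ (fun v => is_true (@?t v <= @?u v)) => apply: (@Def_le _ _ _ t u)
  | |- Def _ (fun v => @?t v = @?u v) => apply: (@Def_eq _ _ _ t u)
  | |- Def _ (fun v => @?P v -> @?Q v) => apply: (@Def_imp _ _ _ P Q)
  | |- Def _ (fun v => forall y, @?P v y) => apply: (@Def_all _ _ _ P)
  | |- Def _ (fun v => ?P) => apply: Def_const
  end.

Ltac def_ands := repeat
  lazymatch goal with
  | |- Def _ (fun v => @?P v /\ @?Q v) => apply: (@Def_and _ _ _ P Q)
  end.

Ltac def_tac := def_beta; repeat first [dt_step | def_step; def_beta | assumption].

Section Values.
Variables (R : realType) (L : signature) (M : expansion R L).

(* [phi] transports the order and the (partial) field operations of the set of
   values [V] to its domain. *)
Record value_system (phi : R -> R) (V : set R) : Prop := ValueSystem {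
  vs_lt : Def M (fun v => phi (v 0%N) < phi (v 1%N));
  vs_add : Def M (fun v => V (phi (v 2%N)) /\
    phi (v 0%N) + phi (v 1%N) = phi (v 2%N));
  vs_mul : Def M (fun v => V (phi (v 2%N)) /\
    phi (v 0%N) * phi (v 1%N) = phi (v 2%N));
  vs_surj : forall w, V w -> exists x, phi x = w }.

Variables (phi : R -> R) (V : set R).
Hypothesis vs : value_system phi V.

Definition DV (t : (nat -> R) -> R) :=
  (forall v, V (t v)) /\ Def M (fun v => phi (v 0%N) = t (shift v)).

Lemma Def_lev t u : DT M t -> DT M u -> Def M (fun v => phi (t v) <= phi (u v)).
Proof.
move=> dt du; apply: Def_ext (Def_not (Def2 (Q := fun x y => phi x < phi y) (vs_lt vs) du dt)) => v.
by rewrite leNgt; split=> [/negP|/negP].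
Qed.

Lemma Def_eqv t u : DT M t -> DT M u -> Def M (fun v => phi (t v) = phi (u v)).
Proof.
move=> dt du; apply: Def_ext (Def_and (Def_lev dt du) (Def_lev du dt)) => v.
by split=> [[? ?]|->//]; apply/eqP; rewrite eq_le; apply/andP.
Qed.

Lemma DV_phi t : (forall v, V (phi (t v))) -> DT M t -> DV (fun v => phi (t v)).
Proof.
move=> Vt dt; split=> //; apply: Def_eqv; first exact: DT_var.
exact: DT_ren S dt.
Qed.

Lemma DV_const c : V c -> DV (fun=> c).
Proof.
move=> Vc; have [x xc] := vs_surj vs Vc; split=> //.
by rewrite -xc; apply: Def_eqv; [exact: DT_var | exact: DT_const].
Qed.

Lemma Def_val2 (Q : R -> R -> Prop) t u : DV t -> DV u ->
  Def M (fun v => Q (phi (v 0%N)) (phi (v 1%N))) ->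
  Def M (fun v => Q (t v) (u v)).
Proof.
move=> dt du dQ.
have : Def M (fun v => exists x y, [/\ phi x = t v, phi y = u v & Q (phi x) (phi y)]).
  apply: Def_ex; apply: Def_ex.
  apply: Def_ext (Def_and (Def_and _ _) _) => [v|||].
  - by split=> [[[A B] C]|[A B C]]; [split; [exact: A|exact: B|exact: C]|].
  - exact: (Def_ren (fun i => if i is j.+1 then j.+2 else 1%N) dt.2).
  - exact: (Def_ren (fun i => if i is j.+1 then j.+2 else 0%N) du.2).
  - exact: (Def_ren (fun i => if i is j.+1 then 0%N else 1%N) dQ).
apply: Def_ext => v; split=> [[x [y [-> -> ]]]//|Qtu].
have [x xE] := vs_surj vs (dt.1 v); have [y yE] := vs_surj vs (du.1 v).
by exists x, y; rewrite xE yE.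
Qed.

Lemma Def_ltV t u : DV t -> DV u -> Def M (fun v => t v < u v).
Proof. by move=> dt du; apply: (Def_val2 (Q := fun x y => x < y)) => //; apply: (vs_lt vs). Qed.

Lemma Def_leV t u : DV t -> DV u -> Def M (fun v => t v <= u v).
Proof.
move=> dt du; apply: Def_ext (Def_not (@Def_ltV u t du dt)) => v.
by rewrite leNgt; split=> [/negP|/negP].
Qed.

Lemma Def_eqV t u : DV t -> DV u -> Def M (fun v => t v = u v).
Proof.
move=> dt du; apply: Def_ext (Def_and (Def_leV dt du) (Def_leV du dt)) => v.
by split=> [[? ?]|->//]; apply/eqP; rewrite eq_le; apply/andP.
Qed.

Lemma DV_op2 (op : R -> R -> R) t u :
  Def M (fun v => V (phi (v 2%N)) /\ op (phi (v 0%N)) (phi (v 1%N)) = phi (v 2%N)) ->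
  DV t -> DV u -> (forall v, V (op (t v) (u v))) -> DV (fun v => op (t v) (u v)).
Proof.
move=> dop dt du Vop; split=> //.
have : Def M (fun v => exists x y, [/\ phi x = t (shift v), phi y = u (shift v) &
    V (phi (v 0%N)) /\ op (phi x) (phi y) = phi (v 0%N)]).
  apply: Def_ex; apply: Def_ex.
  apply: Def_ext (Def_and (Def_and _ _) _) => [v|||].
  - by split=> [[[A B] C]|[A B C]]; [split; [exact: A|exact: B|exact: C]|].
  - exact: (Def_ren (fun i => if i is j.+1 then j.+3 else 1%N) dt.2).
  - exact: (Def_ren (fun i => if i is j.+1 then j.+3 else 0%N) du.2).
  - exact: (Def_ren (fun i => if i is j.+2 then 2%N else if i is 1%N then 0%N else 1%N) dop).
apply: Def_ext => v; split=> [[x [y [-> -> [_ ->]]]]//|E].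
have [x xE] := vs_surj vs (dt.1 (shift v)).
have [y yE] := vs_surj vs (du.1 (shift v)).
by exists x, y; rewrite xE yE E.
Qed.

Lemma DV_add t u : DV t -> DV u -> (forall v, V (t v + u v)) ->
  DV (fun v => t v + u v).
Proof. exact/DV_op2/(vs_add vs). Qed.

Lemma DV_mul t u : DV t -> DV u -> (forall v, V (t v * u v)) ->
  DV (fun v => t v * u v).
Proof. exact/DV_op2/(vs_mul vs). Qed.

Lemma DV_opp t : V (-1) -> DV t -> (forall v, V (- t v)) -> DV (fun v => - t v).
Proof.
move=> V1 dt Vt; have -> : (fun v => - t v) = (fun v => -1 * t v).
  by apply/funext => v; rewrite mulN1r.
by apply: DV_mul => // [|v]; [exact: DV_const | rewrite mulN1r].
Qed.

Lemma DV_if (P : (nat -> R) -> Prop) t u : Def M P -> DV t -> DV u ->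
  DV (fun v => if `[< P v >] then t v else u v).
Proof.
move=> dP dt du; split=> [v|]; first by case: ifP => _; [apply: dt.1|apply: du.1].
apply: Def_ext (Def_or (Def_and (Def_ren S dP) dt.2)
  (Def_and (Def_not (Def_ren S dP)) du.2)) => v.
case: asboolP => Pv; first by split=> [[[]|[]]//|]; left.
by split=> [[[]|[]]//|]; right.
Qed.

Lemma DV_max t u : DV t -> DV u -> DV (fun v => Num.max (t v) (u v)).
Proof.
move=> dt du; have := DV_if (Def_ltV dt du) du dt.
by congr DV; apply/funext => v; rewrite asboolb.
Qed.

End Values.

(** * Coding arithmetic in a dense family of finite sets *)

Section FiniteSets.
Variable R : realType.

Lemma finite_uniform (A : set R) (P : R -> R -> Prop) : finite_set A ->
  (forall v d d' : R, 0 < d' -> d' <= d -> P v d -> P v d') ->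
  (forall v, A v -> exists d : R, 0 < d /\ P v d) ->
  exists d : R, 0 < d /\ forall v, A v -> P v d.
Proof.
move=> /finite_seqP[s ->] mon; elim: s => [|a s IH] H.
  by exists 1; split.
have sub v : [set` s] v -> [set` a :: s] v by rewrite /= inE => ->; rewrite orbT.
have [d [d0 Hd]] := IH (fun v vs => H v (sub v vs)).
have [d' [d'0 Hd']] := H a (mem_head _ _).
exists (Num.min d d'); split=> [|v]; first by rewrite lt_min d0.
have m0 : 0 < Num.min d d' by rewrite lt_min d0.
rewrite /= inE => /orP[/eqP->|vs]; first by apply: mon Hd'; rewrite // ge_min lexx orbT.
by apply: mon (Hd v vs); rewrite // ge_min lexx.
Qed.

Lemma finite_maximum (A : set R) : finite_set A -> A !=set0 ->
  exists m, A m /\ forall v, A v -> v <= m.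
Proof.
move=> /finite_seqP[s ->] [a]; elim: s a => // b [|c s] IH a.
  by move=> _; exists b; split=> [|v]; rewrite /= inE// => /eqP->.
move=> _; have [m [mA mx]] := IH c (mem_head _ _).
have [bm|mb] := leP b m.
  exists m; split; first by rewrite /= inE; apply/orP; right.
  by move=> v; rewrite /= inE => /orP[/eqP->//|]; exact: mx.
exists b; split; first exact: mem_head.
move=> v; rewrite /= inE => /orP[/eqP->//|/mx vm].
exact: le_trans vm (ltW mb).
Qed.

Lemma finite_separation (A : set R) : finite_set A ->
  exists d : R, 0 < d /\ forall p q, A p -> A q -> p < q -> d <= q - p.
Proof.
move=> fA.
have [||d [d0 H]] :=
  finite_uniform (P := fun p d => forall q, A q -> p < q -> d <= q - p) fA.
- by move=> p d d' _ le H q Aq pq; apply: le_trans le (H q Aq pq).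
- move=> p Ap; apply: (finite_uniform (P := fun q d => p < q -> d <= q - p)) fA _ _.
    by move=> q d d' _ le H pq; apply: le_trans le (H pq).
  move=> q Aq; have [pq|qp] := ltP p q.
    by exists (q - p); rewrite subr_gt0.
  by exists 1; split.
by exists d; split=> // p q Ap Aq pq; apply: H.
Qed.

Lemma nested_intervals (e b : nat -> R) :
  (forall k, e k < e k.+1) -> (forall k, b k.+1 < b k) -> (forall k, e k < b k) ->
  exists x, forall k, e k < x < b k.
Proof.
move=> einc bdec eb.
have einc' j k : (j <= k)%N -> e j <= e k.
  elim: k => [|k IH]; first by rewrite leqn0 => /eqP->.
  by rewrite leq_eqVlt => /orP[/eqP->//|/IH le]; exact: le_trans le (ltW _).
have bdec' j k : (j <= k)%N -> b k <= b j.
  elim: k => [|k IH]; first by rewrite leqn0 => /eqP->.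
  by rewrite leq_eqVlt => /orP[/eqP->//|/IH le]; exact: le_trans (ltW _) le.
have ebx j k : e j <= b k.
  apply: le_trans (einc' _ _ (leq_maxl j k)) _.
  exact: le_trans (ltW (eb _)) (bdec' _ _ (leq_maxr j k)).
have sE : has_sup (range e).
  by split; [exists (e 0%N), 0%N | exists (b 0%N) => _ [k _ <-]].
exists (sup (range e)) => k; apply/andP; split.
  apply: lt_le_trans (einc k) _; apply: (sup_upper_bound sE).
  by exists k.+1.
apply: le_lt_trans (bdec k); apply: ge_sup; first by exists (e 0%N), 0%N.
by move=> _ [j _ <-].
Qed.

End FiniteSets.

Section Stages.
Variable R : realType.

Record stages (F : R -> set R) : Prop := Stages {
  stages_fin : forall r : R, 0 < r -> finite_set (F r);
  stages_anti : forall (r r' v : R), 0 < r' -> r' <= r -> F r v -> F r' v;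
  stages_closed : forall r v : R, 0 < r ->
    (forall r' : R, 0 < r' -> r' < r -> F r' v) -> F r v;
  stages0 : forall r : R, 0 < r -> F r 0;
  stages1 : forall r : R, 0 < r -> F r 1;
  stages01 : forall r v : R, 0 < r -> F r v -> 0 <= v <= 1;
  stages_dense : forall u v : R, 0 <= u -> u < v -> v <= 1 ->
    exists r w : R, [/\ 0 < r, F r w & u < w < v] }.

Variable F : R -> set R.
Hypothesis F_stages : stages F.
Let Ffin := stages_fin F_stages.
Let Fanti := stages_anti F_stages.
Let Fclosed := stages_closed F_stages.
Let F0 := stages0 F_stages.
Let F1 := stages1 F_stages.
Let F01 := stages01 F_stages.
Let Fdense := stages_dense F_stages.

Definition gap (r p q : R) :=
  [/\ F r p, F r q, p < q & forall v, F r v -> ~ (p < v < q)].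

Lemma meets_all_intervals (eta : R) : 0 < eta -> exists s : R, 0 < s /\
  forall u v : R, 0 <= u -> v <= 1 -> eta <= v - u -> exists w : R, F s w /\ u < w < v.
Proof.
move=> eta0; pose n := Num.truncn (2 / eta).
have n0 : 0 < n.+1%:R :> R by [].
have nE : 2 < eta * n.+1%:R.
  have : 2 / eta < n.+1%:R by apply: truncnS_gt.
  by rewrite ltr_pdivrMr// mulrC.
have H m : (m <= n.+1)%N -> exists s : R, 0 < s /\ forall k, (k < m)%N ->
    exists w, F s w /\ k%:R / n.+1%:R < w < k.+1%:R / n.+1%:R.
  elim: m => [_|m IH lemn]; first by exists 1; split.
  have [s [s0 Hs]] := IH (ltnW lemn).
  have [|||r [w [r0 Fw wb]]] := @Fdense (m%:R / n.+1%:R) (m.+1%:R / n.+1%:R).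
  - by rewrite divr_ge0.
  - by rewrite ltr_pM2r ?invr_gt0// ltr_nat.
  - by rewrite ler_pdivrMr// mul1r ler_nat.
  have m0 : 0 < Num.min r s by rewrite lt_min r0.
  exists (Num.min r s); split=> // k; rewrite ltnS leq_eqVlt => /orP[/eqP->|/Hs[w' [Fw' wb']]].
    by exists w; split=> //; apply: Fanti Fw; rewrite // ge_min lexx.
  by exists w'; split=> //; apply: Fanti Fw'; rewrite // ge_min lexx orbT.
have {H}[s [s0 Hs]] := H _ (leqnn _).
exists s; split=> // u v u0 v1 uv.
pose k := (Num.truncn (u * n.+1%:R)).+1.
have uk : u * n.+1%:R < k%:R by apply: truncnS_gt.
have ku : k%:R <= u * n.+1%:R + 1.
  rewrite /k -natr1 lerD2r.
  by have /truncn_itv/andP[] : 0 <= u * n.+1%:R by rewrite mulr_ge0.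
have kv : k.+1%:R < v * n.+1%:R.
  have h1 : eta * n.+1%:R <= (v - u) * n.+1%:R by rewrite ler_pM2r.
  rewrite -[k.+1%:R]natr1; lra.
have [|w [Fw /andP[wl wr]]] := Hs k.
  rewrite -(ltr_nat R); apply: lt_le_trans (_ : v * n.+1%:R <= _).
    by apply: le_lt_trans kv; rewrite ler_nat.
  by rewrite ler_piMl.
exists w; split=> //; apply/andP; split.
  by apply: lt_trans wl; rewrite ltr_pdivlMr.
by apply: lt_trans wr _; rewrite ltr_pdivrMr.
Qed.

Definition sparse (r s : R) := exists d : R, [/\ 0 < d,
  forall p q, F r p -> F r q -> p < q -> d <= q - p &
  forall u v : R, 0 <= u -> v <= 1 -> d * d <= v - u -> exists w1 w2 w3 : R,
   [/\ F s w1, F s w2 & F s w3] /\ [/\ u < w1, w1 < w2, w2 < w3 & w3 < v]].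

Lemma sparse_ex (r : R) : 0 < r ->
  exists s : R, 0 < s /\ forall s' : R, 0 < s' -> s' <= s -> sparse r s'.
Proof.
move=> r0; have [d [d0 Hd]] := finite_separation (Ffin r0).
have [|s [s0 Hs]] := @meets_all_intervals (d * d / 3).
  by rewrite divr_gt0// mulr_gt0.
exists s; split=> // s' s'0 s's; exists d; split=> // u v u0 v1 uv.
have dd : 0 < d * d by rewrite mulr_gt0.
have [|||w1 [F1' /andP[a1 b1]]] := Hs u (u + d * d / 3); try lra.
have [|||w2 [F2' /andP[a2 b2]]] := Hs (u + d * d / 3) (u + 2 * (d * d / 3)); try lra.
have [|||w3 [F3' /andP[a3 b3]]] := Hs (u + 2 * (d * d / 3)) v; try lra.
exists w1, w2, w3; split; first by split; apply: (Fanti s'0 s's).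
by split=> //; lra.
Qed.

Record state := State { st_r : R; st_e : R; st_b : R }.

Definition good (s : state) := [/\ 0 < st_r s, F (st_r s) (st_e s),
  st_e s < st_b s, st_b s <= 1 &
  forall v, F (st_r s) v -> ~ (st_e s < v < st_b s)].

Definition step (s t : state) :=
  [/\ st_r t < st_r s, sparse (st_r s) (st_r t) &
      [/\ st_e s < st_e t, st_b t < st_b s, good t &
      forall rho v : R, st_r t < rho -> F rho v -> ~ (st_e s < v < st_b t)]].

Lemma step_ex s : good s -> exists t, step s t.
Proof.
case: s => r e b [/= r0 Fe eb b1 nF].
have [s0 [s00 Hs0]] := sparse_ex r0.
pose s : R := Num.min s0 r.
have sp : 0 < s by rewrite lt_min s00.
have sr : s <= r by rewrite ge_min lexx orbT.
have Hs : forall s' : R, 0 < s' -> s' <= s -> sparse r s'.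
  by move=> s' ? le; apply: Hs0 => //; apply: le_trans le _; rewrite ge_min lexx.
have [||d [d0 Hd]] := finite_uniform (P := fun v d => e < v -> e + d <= v) (Ffin sp).
- by move=> v d d' _ le H ev; apply: le_trans (H ev); rewrite lerD2l.
- move=> v _; have [ev|_] := ltP e v.
    by exists (v - e); rewrite subr_gt0 addrC subrK.
  by exists 1; split.
pose b' : R := Num.min (e + d) ((e + b) / 2).
have eb' : e < b' by rewrite lt_min; apply/andP; split; lra.
have b'b : b' < b by rewrite gt_min; apply/orP; right; lra.
have b'd : b' <= e + d by rewrite ge_min lexx.
have nFs v : F s v -> ~ (e < v < b').
  by move=> Fv /andP[ev vb]; have := Hd v Fv ev; rewrite leNgt (lt_le_trans vb b'd).
have /andP[e0 _] := F01 r0 Fe.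
have [|||rho0 [w0 [rho00 Fw0 w0b]]] := @Fdense e b' => //.
  exact: le_trans (ltW b'b) b1.
pose T := [set rho : R | 0 < rho /\ exists v, F rho v /\ e < v < b'].
have Ts (rho : R) : T rho -> rho < s.
  move=> [rho_0 [v [Fv vb]]]; rewrite ltNge; apply/negP => srho.
  by apply: (nFs v) => //; apply: Fanti Fv.
have supT : has_sup T.
  split; first by exists rho0; split=> //; exists w0.
  by exists s => rho /Ts/ltW.
pose rp := sup T.
have rp0 : 0 < rp.
  by apply: (lt_le_trans rho00); apply: (sup_upper_bound supT); split=> //; exists w0.
have attained : exists v, F rp v /\ e < v < b'.
  apply: contrapT => /forallNP nA.
  have [||d' [d'0 Hd']] := finite_uniform
    (P := fun v d => forall rho : R, 0 < rho -> rp - d < rho -> ~ (F rho v /\ e < v < b'))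
    (Ffin rho00).
  - move=> v a a' _ le H rho rho_0 lt; apply: H => //.
    by apply: le_lt_trans lt; rewrite lerD2l lerN2.
  - move=> v Fv; have [vb|nvb] := pselect (e < v < b'); last first.
      by exists 1; split=> // ? ? ? [].
    have : ~ (forall r' : R, 0 < r' -> r' < rp -> F r' v).
      by move=> H; apply: (nA v); split=> //; apply: Fclosed.
    move=> /existsNP[r' /not_implyP[r'0 /not_implyP[r'rp nFv]]].
    exists (rp - r'); split=> [|rho rho_0 lt [Frho _]]; first by rewrite subr_gt0.
    by apply: nFv; apply: Fanti Frho => //; lra.
  have [rho [rho_0 [v [Fv vb]]] lt] := sup_adherent d'0 supT.
  have [le|ge] := leP rho0 rho.
    by apply: (Hd' v _ rho) => //; apply: Fanti Fv.
  by apply: (Hd' w0 _ rho0) => //; exact: lt_trans ge.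
have [|m [[Fm mb] mmax]] := @finite_maximum R [set v | F rp v /\ e < v < b'] _ attained.
  by apply: sub_finite_set (Ffin rp0) => v [].
have rps : rp < s.
  by apply: Ts; split=> //; exists m.
exists (State rp m b'); split=> /=.
- exact: lt_le_trans sr.
- by apply: Hs => //; apply: ltW.
- case/andP: mb => em mb; split=> //.
    split=> //=; first exact: le_trans (ltW b'b) b1.
    move=> v Fv /andP[mv vb].
    suff : v <= m by rewrite leNgt mv.
    by apply: mmax; split=> //; rewrite (lt_trans em mv).
  move=> rho v lt Fv vb.
  suff : rho <= rp by rewrite leNgt lt.
  apply: (sup_upper_bound supT); split; first exact: lt_trans lt.
  by exists v.
Qed.

Lemma good_ex : exists s, good s /\ st_e s = 0.
Proof.
have [||d [d0 Hd]] := finite_uniform (P := fun v d => 0 < v -> d <= v) (Ffin ltr01).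
- by move=> v d d' _ le H ev; apply: le_trans (H ev).
- move=> v _; have [ev|_] := ltP 0 v; first by exists v.
  by exists 1; split.
exists (State 1 0 (Num.min d 1)); split=> //; split=> //=; first exact: F0.
- by rewrite lt_min d0 ltr01.
- by rewrite ge_min lexx orbT.
move=> v Fv /andP[v0]; rewrite lt_min => /andP[vd _].
by have := Hd v Fv v0; rewrite leNgt vd.
Qed.

Lemma increasing_le (e : nat -> R) : (forall k, e k < e k.+1) ->
  forall j k, (j <= k)%N -> e j <= e k.
Proof.
move=> einc j; elim=> [|k IH]; first by rewrite leqn0 => /eqP->.
by rewrite leq_eqVlt => /orP[/eqP->//|/IH le]; exact: le_trans le (ltW _).
Qed.

(* [e k] is the [k]-th approximation of [x] from the left: it enters at stage
   [r k], and the stages in between contain nothing closer to [x]. *)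
Record ticking (x : R) (r e : nat -> R) : Prop := Ticking {
  tg_pos : forall k, 0 < r k;
  tg_dec : forall k, r k.+1 < r k;
  tg_sparse : forall k, sparse (r k) (r k.+1);
  tg_mem : forall k, F (r k) (e k);
  tg_e0 : e 0%N = 0;
  tg_inc : forall k, e k < e k.+1;
  tg_lt : forall k, e k < x;
  tg_lt1 : x < 1;
  tg_gap : forall k rho v, r k.+1 < rho -> F rho v -> ~ (e k < v < x) }.

Lemma ticking_ex : exists x r e, ticking x r e.
Proof.
have [s0 [good0 e0]] := good_ex.
have [f Hf] : {f : state -> state & forall s, good s -> step s (f s)}.
  apply: (@choice _ _ (fun s t => good s -> step s t)) => s.
  by have [/step_ex[t st]|ns] := pselect (good s); [exists t | exists s].
pose S k := iter k f s0.
have gS k : good (S k).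
  by elim: k => [//|k /Hf[_ _ []]].
have sS k : step (S k) (S k.+1) by apply: Hf.
have einc k : st_e (S k) < st_e (S k.+1) by have [_ _ []] := sS k.
have bdec k : st_b (S k.+1) < st_b (S k) by have [_ _ []] := sS k.
have eb k : st_e (S k) < st_b (S k) by have [] := gS k.
have [x Hx] := nested_intervals einc bdec eb.
exists x, (fun k => st_r (S k)), (fun k => st_e (S k)); split=> //.
- by move=> k; have [] := gS k.
- by move=> k; have [] := sS k.
- by move=> k; have [] := sS k.
- by move=> k; have [] := gS k.
- by move=> k; have /andP[] := Hx k.
- have /andP[_ xb] := Hx 0%N; apply: lt_le_trans xb _.
  by have [] := gS 0%N.
move=> k rho v lt Fv /andP[ev vx].
have [_ _ [_ _ _ H]] := sS k; apply: (H rho v lt Fv); rewrite ev /=.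
by have /andP[_] := Hx k.+1; exact: lt_trans.
Qed.

Variables (x : R) (r_ e_ : nat -> R).
Hypothesis tg : ticking x r_ e_.

Lemma r_le j k : (j <= k)%N -> r_ k <= r_ j.
Proof.
move=> jk; rewrite -lerN2; apply: (increasing_le (e := fun k => - r_ k)) jk => i.
by rewrite ltrN2; apply: tg_dec tg i.
Qed.

Lemma r_lt j k : (r_ k < r_ j) = (j < k)%N.
Proof.
apply/idP/idP => [lt|jk]; last by apply: le_lt_trans (r_le jk) (tg_dec tg j).
by rewrite ltnNge; apply/negP => /r_le; rewrite leNgt lt.
Qed.

Lemma r_inj j k : r_ j = r_ k -> j = k.
Proof.
by move=> E; case: (ltngtP j k) => //; rewrite -r_lt E ltxx.
Qed.

Lemma e_le j k : (j <= k)%N -> e_ j <= e_ k.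
Proof. exact/increasing_le/(tg_inc tg). Qed.

Lemma e_mem j k : (j <= k)%N -> F (r_ k) (e_ j).
Proof. by move=> /r_le jk; apply: Fanti (tg_mem tg j) => //; apply: tg_pos tg k. Qed.

Lemma e_ge0 k : 0 <= e_ k.
Proof. by rewrite -(tg_e0 tg) e_le. Qed.

Lemma e_le1 k : e_ k <= 1.
Proof. by apply/ltW/(lt_trans (tg_lt tg k))/(tg_lt1 tg). Qed.

Lemma r_small rho : 0 < rho -> exists k, r_ k < rho.
Proof.
move=> rho0; apply: contrapT => /forallNP H.
have Fe k : F rho (e_ k).
  by apply: Fanti (tg_mem tg k) => //; rewrite leNgt; apply/negP.
have [d [d0 Hd]] := finite_separation (Ffin rho0).
have ed k : k%:R * d <= e_ k.
  elim: k => [|k IH]; first by rewrite mul0r e_ge0.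
  have := Hd _ _ (Fe k) (Fe k.+1) (tg_inc tg k).
  rewrite -[k.+1%:R]natr1; lra.
have := ed (Num.truncn d^-1).+1; apply/negP; rewrite -ltNge.
apply: le_lt_trans (e_le1 _) _; rewrite -ltr_pdivrMr// div1r.
exact: truncnS_gt.
Qed.

Definition tick r e := [/\ 0 < r, F r e, e < x,
  forall v, F r v -> v < x -> v <= e &
  forall r' v, r < r' -> F r' v -> v < x -> v < e].

Lemma tickP r e : tick r e <-> exists k, r = r_ k.+1 /\ e = e_ k.+1.
Proof.
split=> [[r0 Fe ex emax old]|[k [-> ->]]]; last first.
  split; [exact: tg_pos tg _|exact: tg_mem tg _|exact: tg_lt tg _| |].
    move=> v Fv vx; rewrite leNgt; apply/negP => ev.
    by apply: (tg_gap tg (k := k.+1) (tg_dec tg k.+1) Fv); rewrite ev.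
  move=> r' v lt Fv vx; rewrite ltNge; apply/negP => ev.
  by apply: (tg_gap tg lt Fv); rewrite vx andbT; apply: lt_le_trans ev; apply: tg_inc tg k.
have [m rm] := r_small r0.
have {m rm}[m [rm mmin]] : exists m, r_ m < r /\ forall k, r_ k < r -> (m <= k)%N.
  have ex_m : exists m, r_ m < r by exists m.
  by case: (ex_minnP ex_m) => k ? ?; exists k.
have nolt v : F r v -> v < x -> forall j, m = j.+1 -> v <= e_ j.
  move=> Fv vx j mj; rewrite leNgt; apply/negP => ev.
  by apply: (tg_gap tg (k := j) (rho := r) (v := v)); rewrite -?mj// ev.
have old0 : 0 < e.
  have x0 : 0 < x by have := tg_lt tg 0%N; rewrite (tg_e0 tg).
  by apply: (old (r + 1)) => //; [rewrite ltrDl | apply: F0; rewrite addr_gt0].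
case: m rm mmin nolt => [|j] rm mmin nolt.
  exfalso; apply: (tg_gap tg (k := 0%N) (rho := r) (v := e)) => //.
    by apply: lt_trans rm; apply: tg_dec tg _.
  by rewrite (tg_e0 tg) old0.
have rj : r <= r_ j by rewrite leNgt; apply/negP => /mmin; rewrite ltnn.
have ej : e <= e_ j by exact: nolt.
have {}rj : r = r_ j.
  move: rj; rewrite le_eqVlt => /orP[/eqP//|lt].
  by have := old _ _ lt (tg_mem tg j) (tg_lt tg j); rewrite ltNge ej.
have {}ej : e = e_ j.
  apply/eqP; rewrite eq_le ej /=; apply: emax; last exact: tg_lt tg j.
  by rewrite rj; apply: tg_mem tg j.
case: j rm mmin nolt rj ej => [|k] _ _ _ rj ej; last by exists k.
by move: old0; rewrite ej (tg_e0 tg) ltxx.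
Qed.

(* The window number [i] of a gap is the image of [e_ i, e_ i.+1] under the
   increasing affine map from [0, 1] onto the gap. *)
Definition pointer y k i := exists p q, [/\ gap (r_ k.+1) p q, p < y < q &
  p + (q - p) * e_ i < y < p + (q - p) * e_ i.+1].

Lemma gap01 s p q : 0 < s -> gap s p q -> 0 <= p /\ q <= 1.
Proof.
by move=> s0 [Fp Fq _ _]; have /andP[] := F01 s0 Fp; have /andP[] := F01 s0 Fq.
Qed.

Lemma gap_uniq s p q p' q' y : gap s p q -> gap s p' q' ->
  p < y < q -> p' < y < q' -> p = p' /\ q = q'.
Proof.
move=> [Fp Fq pq n] [Fp' Fq' pq' n'] /andP[py yq] /andP[py' yq'].
split; apply/eqP; rewrite eq_le; apply/andP; split; rewrite leNgt; apply/negP => lt.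
- by apply: (n' p Fp); rewrite lt (lt_trans py).
- by apply: (n p' Fp'); rewrite lt (lt_trans py').
- by apply: (n q' Fq'); rewrite lt (lt_trans py yq').
- by apply: (n' q Fq); rewrite lt (lt_trans py' yq).
Qed.

Lemma next_above s w1 w2 : 0 < s -> F s w1 -> F s w2 -> w1 < w2 ->
  exists q, gap s w1 q /\ q <= w2.
Proof.
move=> s0 Fw1 Fw2 w12.
have [||m [[v [Fv wv vm] mmax]]] := @finite_maximum R [set m | exists v, [/\ F s v, w1 < v & m = - v]].
- apply: sub_finite_set (finite_image -%R (Ffin s0)) => m [v [Fv _ ->]].
  by exists v.
- by exists (- w2), w2.
have low v' : F s v' -> w1 < v' -> v <= v'.
  by move=> Fv' wv'; rewrite -lerN2 -vm; apply: mmax; exists v'.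
exists v; split; last exact: low.
by split=> // u Fu /andP[wu]; rewrite ltNge (low u Fu wu).
Qed.

Lemma next_below s w1 w2 : 0 < s -> F s w1 -> F s w2 -> w1 < w2 ->
  exists p, gap s p w2 /\ w1 <= p.
Proof.
move=> s0 Fw1 Fw2 w12.
have [||m [[Fm mw] mmax]] := @finite_maximum R [set v | F s v /\ v < w2].
- by apply: sub_finite_set (Ffin s0) => v [].
- by exists w1.
exists m; split; last exact: mmax.
by split=> // u Fu /andP[mu uw]; have := mmax u (conj Fu uw); rewrite leNgt mu.
Qed.

Lemma gap_three k p q : gap (r_ k.+1) p q -> exists w1 w2 w3 : R,
   [/\ F (r_ k.+2) w1, F (r_ k.+2) w2 & F (r_ k.+2) w3] /\
   [/\ p < w1, w1 < w2, w2 < w3 & w3 < q].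
Proof.
move=> gpq; have [p0 q1] := gap01 (tg_pos tg _) gpq.
have [Fp Fq pq _] := gpq.
have [d [d0 Hd1 Hd]] := tg_sparse tg k.+1; apply: Hd => //.
have dpq := Hd1 _ _ Fp Fq pq.
have d1 : d <= 1 by lra.
by apply: le_trans dpq; rewrite ler_piMl// ltW.
Qed.

Lemma window_gap k p q i : (i <= k)%N -> gap (r_ k.+1) p q -> exists p' q',
  [/\ gap (r_ k.+2) p' q', p < p', q' < q, p + (q - p) * e_ i < p' &
      q' < p + (q - p) * e_ i.+1].
Proof.
move=> ik gpq; have [p0 q1] := gap01 (tg_pos tg _) gpq.
have [Fp Fq pq _] := gpq.
have [d [d0 Hd1 Hd]] := tg_sparse tg k.+1.
have dpq := Hd1 _ _ Fp Fq pq.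
have de := Hd1 _ _ (e_mem (leqW ik)) (e_mem (leq_ltn_trans ik (ltnSn k))) (tg_inc tg i).
have e0 := e_ge0 i; have e1 := e_le1 i.+1.
have h0 : 0 <= (q - p) * e_ i by rewrite mulr_ge0// subr_ge0 ltW.
have h1 : (q - p) * e_ i.+1 <= q - p by rewrite ler_piMr// subr_ge0 ltW.
have h2 : d * d <= (q - p) * (e_ i.+1 - e_ i) by apply: ler_pM => //; apply: ltW.
have [|||w1 [w2 [w3 [[Fw1 Fw2 _] [a b c dd]]]]] :=
  Hd (p + (q - p) * e_ i) (p + (q - p) * e_ i.+1); try lra.
have [q' [gq' qw]] := next_above (tg_pos tg _) Fw1 Fw2 b.
by exists w1, q'; split=> //; lra.
Qed.

Lemma nested_gaps (C : nat -> R -> R -> R -> R -> Prop) p0 q0 :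
  (forall k p q, gap (r_ k.+1) p q -> exists p' q',
     [/\ gap (r_ k.+2) p' q', p < p', q' < q & C k p q p' q']) ->
  gap (r_ 1) p0 q0 ->
  exists P Q y, P 0%N = p0 /\ Q 0%N = q0 /\ forall k,
    [/\ gap (r_ k.+1) (P k) (Q k), P k < y < Q k, P k < P k.+1, Q k.+1 < Q k &
        C k (P k) (Q k) (P k.+1) (Q k.+1)].
Proof.
move=> HC g0.
have [f Hf] : {f : nat * (R * R) -> R * R & forall s, gap (r_ s.1.+1) s.2.1 s.2.2 ->
   [/\ gap (r_ s.1.+2) (f s).1 (f s).2, s.2.1 < (f s).1, (f s).2 < s.2.2 &
       C s.1 s.2.1 s.2.2 (f s).1 (f s).2]}.
  apply: (@choice _ _ (fun (s : nat * (R * R)) (t : R * R) => gap (r_ s.1.+1) s.2.1 s.2.2 ->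
   [/\ gap (r_ s.1.+2) t.1 t.2, s.2.1 < t.1, t.2 < s.2.2 & C s.1 s.2.1 s.2.2 t.1 t.2])).
  move=> [k [p q]] /=; have [/HC[p' [q' ?]]|ng] := pselect (gap (r_ k.+1) p q).
    by exists (p', q').
  by exists (p, q).
pose G := fix G k := if k is j.+1 then f (j, G j) else (p0, q0).
have gG k : gap (r_ k.+1) (G k).1 (G k).2.
  by elim: k => [//|k IH]; have [] := Hf (k, G k) IH.
have [y Hy] : exists y, forall k, (G k).1 < y < (G k).2.
  apply: (nested_intervals (e := fun k => (G k).1) (b := fun k => (G k).2)) => k.
  - by have [] := Hf (k, G k) (gG k).
  - by have [] := Hf (k, G k) (gG k).
  - by have [] := gG k.
exists (fun k => (G k).1), (fun k => (G k).2), y; split=> //; split=> // k.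
by split=> //; have [] := Hf (k, G k) (gG k).
Qed.

Lemma first_gap s : 0 < s -> exists q, gap s 0 q.
Proof.
by move=> s0; have [|q [gq _]] := next_above s0 (F0 s0) (F1 s0); [|exists q].
Qed.

Lemma pointer_ex sigma : (forall k, (sigma k <= k)%N) ->
  exists y, 0 <= y <= 1 /\ forall k, pointer y k (sigma k).
Proof.
move=> sk; have [q0 g0] := first_gap (tg_pos tg 1).
have [P [Q [y [_ [_ H]]]]] := nested_gaps
  (C := fun k p q p' q' => p + (q - p) * e_ (sigma k) < p' /\
        q' < p + (q - p) * e_ (sigma k).+1)
  (fun k p q g => let: ex_intro p' (ex_intro q' (And5 a b c d e)) :=
     window_gap (sk k) g in ex_intro _ p' (ex_intro _ q' (And4 a b c (conj d e)))) g0.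
exists y; split=> [|k].
  have [g /andP[a b] _ _ _] := H 0%N; have [? ?] := gap01 (tg_pos tg _) g.
  by apply/andP; split; lra.
have [g yk _ _ [a b]] := H k; have [_ /andP[c d] _ _ _] := H k.+1.
by exists (P k), (Q k); split=> //; apply/andP; split; lra.
Qed.

Lemma pointer_uniq y k i j : pointer y k i -> pointer y k j -> i = j.
Proof.
move=> [p [q [g ypq /andP[a b]]]] [p' [q' [g' ypq' /andP[c d]]]].
have [E1 E2] := gap_uniq g g' ypq ypq'; rewrite -{}E1 -{}E2 in c d.
have [_ _ pq _] := g; have qp0 : 0 < q - p by rewrite subr_gt0.
case: (ltngtP i j) => // /e_le; rewrite -(ler_pM2l qp0) => h; exfalso; lra.
Qed.

Definition next_tick r r' := [/\ exists e, tick r e, exists e, tick r' e, r' < r &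
  forall r'' e, tick r'' e -> r'' < r -> r'' <= r'].

Lemma next_tickP k r' : next_tick (r_ k.+1) r' <-> r' = r_ k.+2.
Proof.
split=> [[_ [e /tickP[j [-> _]]]]|->].
  rewrite r_lt ltnS => jk H; congr r_; congr S.
  have := H (r_ k.+2) (e_ k.+2); rewrite r_lt ltnSn; move=> /(_ _ isT).
  rewrite leNgt r_lt -leqNgt ltnS => /(_ _)jk'; apply/eqP; rewrite eqn_leq jk jk'//.
  by apply/tickP; exists k.+1.
split; [by exists (e_ k.+1); apply/tickP; exists k| |by rewrite r_lt|].
  by exists (e_ k.+2); apply/tickP; exists k.+1.
move=> _ _ /tickP[j [-> _]]; rewrite r_lt ltnS => kj.
by apply: r_le; rewrite ltnS.
Qed.

Definition points y r i := exists i' e e' p q,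
  [/\ next_tick i i', tick i e, tick i' e', gap r p q &
      [/\ p < y, y < q, p + (q - p) * e < y & y < p + (q - p) * e']].

Lemma tick_e k e : tick (r_ k.+1) e <-> e = e_ k.+1.
Proof.
split=> [/tickP[j [/r_inj[<-]]]//|->].
by apply/tickP; exists k.
Qed.

Lemma pointsP y k i : points y (r_ k.+1) i <->
  exists n, i = r_ n.+1 /\ pointer y k n.+1.
Proof.
split=> [[i' [e [e' [p [q [N]]]]]]|].
  move=> /tickP[n [E]]; rewrite {}E in N *; move: N => /next_tickP -> ->.
  move=> /tick_e -> g [a b c d]; exists n; split=> //.
  by exists p, q; split=> //; apply/andP.
move=> [n [-> [p [q [g /andP[a b] /andP[c d]]]]]].
exists (r_ n.+2), (e_ n.+1), (e_ n.+2), p, q; split=> //.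
- exact/next_tickP.
- exact/tick_e.
- exact/tick_e.
Qed.

Definition bit (b : bool) r r' y := exists p q p' q',
  [/\ gap r p q, gap r' p' q', p < p' /\ q' < q, p' < y < q' &
      forall v, F r' v -> ~ (if b then q' < v < q else p < v < p')].

Lemma bit_excl k y : bit true (r_ k.+1) (r_ k.+2) y ->
  ~ bit false (r_ k.+1) (r_ k.+2) y.
Proof.
move=> [p [q [p' [q' [g g' [pp qq] /andP[a b] H]]]]].
move=> [p1 [q1 [p1' [q1' [h h' [pp1 qq1] /andP[a1 b1] H1]]]]].
have [||E1 E2] := gap_uniq g h (y := y); try (by apply/andP; split; lra).
have [||E3 E4] := gap_uniq g' h' (y := y); try (by apply/andP).
move: H1; rewrite -E1 -E3 => H1.
have [w1 [w2 [w3 [[F1' F2 F3] [pw w12 w23 wq]]]]] := gap_three g.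
have [_ _ p'q' n] := g'.
have only v : F (r_ k.+2) v -> p < v -> v < q -> v = p' \/ v = q'.
  move=> Fv pv vq.
  case: (ltgtP v p') => [lt|lt|->]; [|  |by left].
    by exfalso; apply: (H1 v Fv); rewrite pv.
  case: (ltgtP v q') => [lt'|lt'|->]; [| |by right].
    by exfalso; apply: (n v Fv); rewrite lt.
  by exfalso; apply: (H v Fv); rewrite lt'.
have w13 := lt_trans w12 w23.
have := only w1 F1' pw (lt_trans w13 wq).
have := only w2 F2 (lt_trans pw w12) (lt_trans w23 wq).
have := only w3 F3 (lt_trans pw w13) wq.
by move=> [u3|u3] [u2|u2] [u1|u1]; move: w12 w23 w13; rewrite {}u1 {}u2 {}u3 ?ltxx.
Qed.

Definition code y := [/\ forall r r', next_tick r r' -> exists b, bit b r r' y &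
  forall r e, tick r e -> (forall r' e', tick r' e' -> r' <= r) ->
    exists q, gap r 0 q /\ 0 < y < q].

Lemma bit_step k b p q : gap (r_ k.+1) p q -> exists p' q',
  [/\ gap (r_ k.+2) p' q', p < p', q' < q &
      forall v, F (r_ k.+2) v -> ~ (if b then q' < v < q else p < v < p')].
Proof.
move=> g; have [w1 [w2 [w3 [[F1' F2 F3] [pw w12 w23 wq]]]]] := gap_three g.
have [Fp Fq pq _] := g; have rr := tg_pos tg k.+2.
have le := r_le (leqnSn k.+1).
have Fp' := Fanti rr le Fp; have Fq' := Fanti rr le Fq.
case: b.
  have [q' [gq wq']] := next_below rr F3 Fq' wq.
  have [Fq1 _ q'q nq'] := gq.
  have [p' [gp wp']] := next_below rr F2 Fq1 (lt_le_trans w23 wq').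
  by exists p', q'; split=> //; lra.
have [p' [gp wp']] := next_above rr Fp' F1' pw.
have [_ Fp1 pp' np'] := gp.
have [q' [gq wq']] := next_above rr Fp1 F2 (le_lt_trans wp' w12).
by exists p', q'; split=> //; lra.
Qed.

Lemma code_surj (S : set nat) : exists y, [/\ 0 <= y <= 1, code y &
  forall k, bit true (r_ k.+1) (r_ k.+2) y <-> S k].
Proof.
have [q0 g0] := first_gap (tg_pos tg 1).
have [P [Q [y [P0 [Q0 H]]]]] := nested_gaps
  (C := fun k p q p' q' =>
    forall v, F (r_ k.+2) v -> ~ (if `[< S k >] then q' < v < q else p < v < p'))
  (fun k p q g => @bit_step k `[< S k >] p q g) g0.
have yb k : bit `[< S k >] (r_ k.+1) (r_ k.+2) y.
  have [g1 _ pp qq C] := H k; have [g2 y2 _ _ _] := H k.+1.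
  by exists (P k), (Q k), (P k.+1), (Q k.+1).
exists y; split.
- have [g /andP[a b] _ _ _] := H 0%N; have [? ?] := gap01 (tg_pos tg _) g.
  by apply/andP; split; lra.
- split=> [r r' N|r e /tickP[k [-> _]] mx].
    have [[e /tickP[k [E _]]] _ _ _] := N.
    by move: N; rewrite E => /next_tickP->; exists `[< S k >].
  have k0 : k = 0%N.
    have /mx : tick (r_ 1) (e_ 1) by apply/tickP; exists 0%N.
    by rewrite leNgt r_lt -leqNgt ltnS leqn0 => /eqP.
  rewrite k0; exists q0; split=> //.
  by have [_ Hy _ _ _] := H 0%N; rewrite P0 Q0 in Hy.
- move=> k; have := yb k; case: asboolP => Sk b; first by split.
  by split=> // b'; case: (bit_excl b' b).
Qed.

Lemma gap_right s p q q' : gap s p q -> gap s p q' -> q = q'.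
Proof.
move=> [_ Fq pq n] [_ Fq' pq' n'].
case: (ltgtP q q') => // lt; exfalso; [apply: (n' q)|apply: (n q')] => //;
  exact/andP.
Qed.

Lemma gap_left s p p' q : gap s p q -> gap s p' q -> p = p'.
Proof.
move=> [Fp _ pq n] [Fp' _ pq' n'].
case: (ltgtP p p') => // lt; exfalso; [apply: (n p')|apply: (n' p)] => //;
  exact/andP.
Qed.

Lemma bit_gap_uniq (b : bool) s p q p1 q1 p2 q2 :
  gap s p1 q1 -> gap s p2 q2 -> p < p1 -> p < p2 -> q1 < q -> q2 < q ->
  (forall v, F s v -> ~ (if b then q1 < v < q else p < v < p1)) ->
  (forall v, F s v -> ~ (if b then q2 < v < q else p < v < p2)) ->
  p1 = p2 /\ q1 = q2.
Proof.
move=> g1 g2 pp1 pp2 qq1 qq2; have [Fp1 Fq1 _ _] := g1; have [Fp2 Fq2 _ _] := g2.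
case: b => n1 n2.
  have E : q1 = q2.
    by case: (ltgtP q1 q2) => // lt; exfalso; [apply: (n1 q2)|apply: (n2 q1)] => //;
      exact/andP.
  by split=> //; apply: (@gap_left s _ _ q1); rewrite // E.
have E : p1 = p2.
  by case: (ltgtP p1 p2) => // lt; exfalso; [apply: (n2 p1)|apply: (n1 p2)] => //;
    exact/andP.
by split=> //; apply: (@gap_right s p1); rewrite // E.
Qed.

Lemma code_inj y y' : code y -> code y' ->
  (forall k, bit true (r_ k.+1) (r_ k.+2) y <-> bit true (r_ k.+1) (r_ k.+2) y') ->
  y = y'.
Proof.
move=> [cy fy] [cy' fy'] H.
have tk k : tick (r_ k.+1) (e_ k.+1) by apply/tickP; exists k.
have same k : exists p q, [/\ gap (r_ k.+1) p q, p < y < q & p < y' < q].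
  elim: k => [|k [p [q [g yb y'b]]]].
    have mx r e : tick r e -> r <= r_ 1 by move=> /tickP[j [-> _]]; apply: r_le.
    have [q [g yq]] := fy _ _ (tk 0%N) mx; have [q' [g' yq']] := fy' _ _ (tk 0%N) mx.
    by exists 0, q; split=> //; rewrite (gap_right g g').
  have nt : next_tick (r_ k.+1) (r_ k.+2) by apply/next_tickP.
  have [b bk] := cy _ _ nt; have [b' bk'] := cy' _ _ nt.
  have bb : b = b'.
    case: b b' bk bk' => -[] // bk bk'.
      by have /(H k) /bit_excl := bk.
    by have /(H k) /bit_excl := bk'.
  rewrite -{}bb in bk'.
  have [p1 [q1 [p2 [q2 [g1 g2 [pp qq] y2 n1]]]]] := bk.
  have [p3 [q3 [p4 [q4 [g3 g4 [pp' qq'] y4 n2]]]]] := bk'.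
  have /andP[a2 b2] := y2; have /andP[a4 b4] := y4.
  have y1 : p1 < y < q1 by rewrite (lt_trans pp)// (lt_trans b2).
  have y3 : p3 < y' < q3 by rewrite (lt_trans pp')// (lt_trans b4).
  have [e1 e2] := gap_uniq g g1 yb y1; have [e3 e4] := gap_uniq g g3 y'b y3.
  rewrite -e1 -e2 in pp qq n1; rewrite -e3 -e4 in pp' qq' n2.
  have [e5 e6] := bit_gap_uniq g2 g4 pp pp' qq qq' n1 n2.
  by exists p2, q2; split=> //; rewrite e5 e6.
have sep u v : (forall k, exists p q, [/\ gap (r_ k.+1) p q, p < u < q & p < v < q]) ->
    ~ (u < v).
  move=> all_k uv; have [p [q [g /andP[pu _] /andP[_ vq]]]] := all_k 0%N.
  have [p0 q1] := gap01 (tg_pos tg _) g.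
  have [|||rho [w [rho0 Fw /andP[uw wv]]]] := @Fdense u v => //; try lra.
  have [k rk] := r_small rho0.
  have [p' [q' [[_ _ _ n] /andP[pu' _] /andP[_ vq']]]] := all_k k.
  apply: (n w); last by rewrite (lt_trans pu')// (lt_trans wv).
  by apply: Fanti Fw; [exact: tg_pos tg _ | exact: ltW (lt_trans (tg_dec tg k) rk)].
case: (ltgtP y y') => //; move=> lt; exfalso; apply: sep lt => // k.
by have [p [q []]] := same k; exists p, q.
Qed.

Lemma relation_coding (f : nat -> nat -> nat) : exists y1 y2 y3,
  [/\ 0 <= y1 <= 1, 0 <= y2 <= 1, 0 <= y3 <= 1 & forall i j l,
    (exists r e, [/\ tick r e, points y1 r (r_ i.+1), points y2 r (r_ j.+1) &
       points y3 r (r_ l.+1)]) <-> l = f i j].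
Proof.
pose ok k := [&& logn 2 k < k, logn 3 k < k & f (logn 2 k) (logn 3 k) < k]%N.
have [|y1 [y1b H1]] := @pointer_ex (fun k => if ok k then (logn 2 k).+1 else 0%N).
  by move=> k; case: ifP => // /and3P[].
have [|y2 [y2b H2]] := @pointer_ex (fun k => if ok k then (logn 3 k).+1 else 0%N).
  by move=> k; case: ifP => // /and3P[].
have [|y3 [y3b H3]] := @pointer_ex
    (fun k => if ok k then (f (logn 2 k) (logn 3 k)).+1 else 0%N).
  by move=> k; case: ifP => // /and3P[].
have pE (y : R) k i : points y (r_ k.+1) (r_ i.+1) <-> pointer y k i.+1.
  split=> [/pointsP[n [/r_inj[<-]]]//|p].
  by apply/pointsP; exists i.
exists y1, y2, y3; split=> // i j l; split.
  move=> [_ [_ [/tickP[k [-> _]] /pE p1 /pE p2 /pE p3]]].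
  have := pointer_uniq p1 (H1 k); have := pointer_uniq p2 (H2 k).
  have := pointer_uniq p3 (H3 k).
  by case: ifP => // _ [->] [->] [->].
move=> ->; pose k := (2 ^ i * 3 ^ j * 5 ^ (i + j + f i j))%N.
have kbig : (i + j + f i j < k)%N.
  apply: (@leq_trans (5 ^ (i + j + f i j))); first exact: ltn_expl.
  by rewrite leq_pmull// muln_gt0 !expn_gt0.
have l2 : logn 2 k = i.
  by rewrite /k !lognM ?muln_gt0 ?expn_gt0// !lognX /= !(muln0, muln1, addn0).
have l3 : logn 3 k = j.
  by rewrite /k !lognM ?muln_gt0 ?expn_gt0// !lognX /= !(muln0, muln1, addn0).
have okk : ok k by rewrite /ok l2 l3; apply/and3P; split; lia.
exists (r_ k.+1), (e_ k.+1); split; first by apply/tickP; exists k.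
- by apply/pE; have := H1 k; rewrite okk l2.
- by apply/pE; have := H2 k; rewrite okk l3.
- by apply/pE; have := H3 k; rewrite okk l2 l3.
Qed.

End Stages.

Section Coding.
Variables (R : realType) (L : signature) (M : expansion R L).
Variables (phi : R -> R) (Rep : set R) (E : R -> R -> Prop).
Hypothesis phi01 : forall s, 0 <= phi s <= 1.
Hypothesis Def_phi_lt : Def M (fun v => phi (v 0%N) < phi (v 1%N)).
Hypothesis Def_interp_lt : Def M (fun v =>
  phi (v 0%N) + (phi (v 1%N) - phi (v 0%N)) * phi (v 2%N) < phi (v 3%N)).
Hypothesis Def_lt_interp : Def M (fun v =>
  phi (v 3%N) < phi (v 0%N) + (phi (v 1%N) - phi (v 0%N)) * phi (v 2%N)).
Hypothesis Def_Rep : Def M (fun v => Rep (v 0%N)).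
Hypothesis Rep_ex : forall w, 0 <= w <= 1 -> exists s, Rep s /\ phi s = w.
Hypothesis Rep_inj : forall s t, Rep s -> Rep t -> phi s = phi t -> s = t.
Hypothesis Def_E : Def M (fun v => E (v 0%N) (v 1%N)).
Hypothesis Eanti : forall r r' s, 0 < r' -> r' <= r -> E r s -> E r' s.
Hypothesis Efin : forall r, 0 < r -> finite_set (phi @` E r).
Hypothesis Edense : forall u v, 0 <= u -> u < v -> v <= 1 ->
  exists r s, [/\ 0 < r, E r s & u < phi s < v].

Definition stage (r w : R) := 0 <= w <= 1 /\
  [\/ w = 0, w = 1 | forall r', 0 < r' -> r' < r -> exists s, E r' s /\ phi s = w].

Lemma stage01 r w : stage r w -> 0 <= w <= 1. Proof. by case. Qed.

Lemma stage_fin r : 0 < r -> finite_set (stage r).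
Proof.
move=> r0; have r20 : 0 < r / 2 by rewrite divr_gt0.
apply: (@sub_finite_set _ _ ([set 0; 1] `|` phi @` E (r / 2))).
  move=> w [_ [->|->|H]]; [by left; left | by left; right |right].
  have [|s [Es <-]] := H _ r20; first by rewrite ltr_pdivrMr// ltr_pMr// ltr1n.
  by exists s.
by rewrite finite_setU; split; [apply: finite_set2 | apply: Efin].
Qed.

Lemma stage_anti r r' w : 0 < r' -> r' <= r -> stage r w -> stage r' w.
Proof.
move=> r0 rr [w01 H]; split=> //; case: H => [->|->|H]; [by constructor 1|by constructor 2|].
by constructor 3 => t t0 tr; apply: H => //; apply: lt_le_trans rr.
Qed.

Lemma stage_closed r w : 0 < r -> (forall r', 0 < r' -> r' < r -> stage r' w) ->
  stage r w.
Proof.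
move=> r0 H; have r20 : 0 < r / 2 by rewrite divr_gt0.
have [|w01 _] := H _ r20; first by rewrite ltr_pdivrMr// ltr_pMr// ltr1n.
split=> //; have [->|w0] := pselect (w = 0); first by constructor 1.
have [->|w1] := pselect (w = 1); first by constructor 2.
constructor 3 => t t0 tr; have [||_ [//|//|]] := H ((t + r) / 2); try lra.
by apply=> //; lra.
Qed.

Lemma stage0 r : 0 < r -> stage r 0.
Proof. by move=> _; split; [rewrite lexx ler01 | constructor 1]. Qed.

Lemma stage1 r : 0 < r -> stage r 1.
Proof. by move=> _; split; [rewrite lexx ler01 | constructor 2]. Qed.

Lemma stage_dense u v : 0 <= u -> u < v -> v <= 1 ->
  exists r w, [/\ 0 < r, stage r w & u < w < v].
Proof.
move=> u0 uv v1; have [r [s [r0 Es usv]]] := Edense u0 uv v1.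
exists r, (phi s); split=> //; split=> //; constructor 3 => t t0 tr.
by exists s; split=> //; apply: Eanti Es => //; apply: ltW.
Qed.

Lemma phi_surj w : 0 <= w <= 1 -> exists s, phi s = w.
Proof. by move=> /Rep_ex[s [_ <-]]; exists s. Qed.

Lemma Def_exv (P : (nat -> R) -> R -> Prop) :
  (forall v w, P v w -> 0 <= w <= 1) ->
  Def M (fun v => P (shift v) (phi (v 0%N))) -> Def M (fun v => exists w, P v w).
Proof.
move=> P01 dP; have := @Def_ex _ _ _ (fun v s => P v (phi s)) dP.
apply: Def_ext => v; split=> [[s Ps]|[w Pw]]; first by exists (phi s).
by have [s sw] := phi_surj (P01 _ _ Pw); exists s; rewrite sw.
Qed.

Lemma Def_allv (P : (nat -> R) -> R -> Prop) :
  (forall v w, ~ P v w -> 0 <= w <= 1) ->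
  Def M (fun v => P (shift v) (phi (v 0%N))) -> Def M (fun v => forall w, P v w).
Proof.
move=> P01 /Def_not dP; have := Def_not (@Def_exv (fun v w => ~ P v w) P01 dP).
by apply: Def_ext => v; split=> [/forallNP H w|H [w]//]; apply: contrapT.
Qed.

Lemma Def_pl i j : Def M (fun v => phi (v i) < phi (v j)).
Proof. exact: (Def2 (Q := fun x y => phi x < phi y) Def_phi_lt (DT_var _ _) (DT_var _ _)). Qed.

Lemma Def_peq i w : Def M (fun v => phi (v i) = w).
Proof.
have [/phi_surj[s <-]|nw] := pselect (0 <= w <= 1); last first.
  by apply: Def_ext (Def_const M False) => v; split=> // E'; apply: nw; rewrite -E'.
have d1 : Def M (fun v => phi s < phi (v i)).
  exact: (Def2 (Q := fun x y => phi x < phi y) Def_phi_lt (DT_const _ _) (DT_var _ _)).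
have d2 : Def M (fun v => phi (v i) < phi s).
  exact: (Def2 (Q := fun x y => phi x < phi y) Def_phi_lt (DT_var _ _) (DT_const _ _)).
apply: Def_ext (Def_and (Def_not d1) (Def_not d2)) => v.
split=> [[/negP + /negP]|->]; last by rewrite ltxx.
by rewrite -!leNgt => ? ?; apply/eqP; rewrite eq_le; apply/andP.
Qed.

Lemma Def_pl_const i w : 0 <= w <= 1 -> Def M (fun v => phi (v i) < w).
Proof.
move=> /phi_surj[s <-].
exact: (Def2 (Q := fun x y => phi x < phi y) Def_phi_lt (DT_var _ _) (DT_const _ _)).
Qed.

Lemma Def_ple i j : Def M (fun v => phi (v i) <= phi (v j)).
Proof.
apply: Def_ext (Def_not (Def_pl j i)) => v.
by rewrite leNgt; split=> [/negP|/negP].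
Qed.

Lemma Def_stage i j : Def M (fun v => stage (v i) (phi (v j))).
Proof.
have H : Def M (fun v => stage (v 0%N) (phi (v 1%N))).
  have : Def M (fun v => [\/ phi (v 1%N) = 0, phi (v 1%N) = 1 |
     forall r', 0 < r' -> r' < v 0%N -> exists s, E r' s /\ phi s = phi (v 1%N)]).
    apply: (@Def_ext _ _ _ (fun v => phi (v 1%N) = 0 \/ phi (v 1%N) = 1 \/
     forall r', 0 < r' -> r' < v 0%N -> exists s, E r' s /\
       (phi s <= phi (v 1%N) /\ phi (v 1%N) <= phi s))) => [v|].
      split=> [[h|]|[h|h|H]].
      - by constructor 1.
      - case=> [h|H]; first by constructor 2.
        constructor 3 => t t0 tv; have [s [Es /andP le]] := H t t0 tv.
        by exists s; split=> //; apply/eqP; rewrite eq_le.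
      - by left.
      - by right; left.
      - by right; right => t t0 tv; have [s [Es h]] := H t t0 tv; exists s; rewrite h.
    apply: Def_or; first exact: Def_peq.
    apply: Def_or; first exact: Def_peq.
    apply: Def_all; apply: Def_imp; first by def_tac.
    apply: Def_imp; first by def_tac.
    apply: Def_ex; apply: Def_and.
      exact: (Def2 (Q := E) Def_E (DT_var _ _) (DT_var _ _)).
    by apply: Def_and; apply: Def_ple.
  by apply: Def_ext => v; split=> [|[]].
exact: (Def2 (Q := fun r s => stage r (phi s)) H (DT_var _ _) (DT_var _ _)).
Qed.

Section Point.
Variable sx : R.
Let x := phi sx.

Lemma phix01 : 0 <= x <= 1. Proof. exact: phi01. Qed.

Lemma Def_tick i j : Def M (fun v => tick stage x (v i) (phi (v j))).
Proof.
have H : Def M (fun v => tick stage x (v 0%N) (phi (v 1%N))).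
  apply: (@Def_ext _ _ _ (fun v => (0 < v 0%N /\ stage (v 0%N) (phi (v 1%N)) /\ phi (v 1%N) < x)
    /\ (forall w, stage (v 0%N) w -> w < x -> w <= phi (v 1%N)) /\
    (forall r', v 0%N < r' -> forall w, stage r' w -> w < x -> w < phi (v 1%N)))).
    move=> v; split=> [[[a [b c]] [d e]]|[a b c d e]]; split=> //.
    by move=> r' w lt; apply: e.
    by split=> // r' lt w; apply: e.
  def_ands.
  - by def_tac.
  - exact: Def_stage.
  - exact: Def_pl_const phix01.
  - apply: Def_allv => [v w /not_implyP[/stage01//]|].
    apply: Def_imp; first exact: Def_stage.
    apply: Def_imp; first exact: Def_pl_const phix01.
    exact: Def_ple.
  - apply: Def_all; apply: Def_imp; first by def_tac.
    apply: Def_allv => [v w /not_implyP[/stage01//]|].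
    apply: Def_imp; first exact: Def_stage.
    apply: Def_imp; first exact: Def_pl_const phix01.
    exact: Def_pl.
exact: (Def2 (Q := fun r s => tick stage x r (phi s)) H (DT_var _ _) (DT_var _ _)).
Qed.

Lemma tick01 r e : tick stage x r e -> 0 <= e <= 1.
Proof. by case=> _ /stage01. Qed.

Lemma Def_extick i : Def M (fun v => exists e, tick stage x (v i) e).
Proof. by apply: Def_exv => [v w /tick01//|]; apply: Def_tick. Qed.

Lemma Def_gap i j k : Def M (fun v => gap stage (v i) (phi (v j)) (phi (v k))).
Proof.
have H : Def M (fun v => gap stage (v 0%N) (phi (v 1%N)) (phi (v 2%N))).
  apply: (@Def_ext _ _ _ (fun v => (stage (v 0%N) (phi (v 1%N)) /\
     stage (v 0%N) (phi (v 2%N))) /\ phi (v 1%N) < phi (v 2%N) /\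
     forall w, stage (v 0%N) w -> ~ (phi (v 1%N) < w /\ w < phi (v 2%N)))).
    move=> v; split=> [[[a b] [c d]]|[a b c d]]; split=> //.
      by move=> w /d H /andP.
    by split=> // w /d H /andP.
  def_ands.
  - exact: Def_stage.
  - exact: Def_stage.
  - exact: Def_pl.
  - apply: Def_allv => [v w /not_implyP[/stage01//]|].
    apply: Def_imp; first exact: Def_stage.
    by apply: Def_not; apply: Def_and; apply: Def_pl.
exact: (Def3 (Q := fun r s t => gap stage r (phi s) (phi t)) H
  (DT_var _ _) (DT_var _ _) (DT_var _ _)).
Qed.

Lemma gap_bounds r p q : gap stage r p q -> 0 <= p <= 1 /\ 0 <= q <= 1.
Proof. by case=> /stage01 ? /stage01 ?. Qed.

Lemma Def_next_tick i j : Def M (fun v => next_tick stage x (v i) (v j)).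
Proof.
apply: (@Def_ext _ _ _ (fun v => ((exists e, tick stage x (v i) e) /\
  (exists e, tick stage x (v j) e)) /\ v j < v i /\
  forall r, forall e, tick stage x r e -> r < v i -> r <= v j)).
  by move=> v; split=> [[[a b] [c d]]|[a b c d]].
def_ands.
- exact: Def_extick.
- exact: Def_extick.
- by def_tac.
- apply: Def_all; apply: Def_allv => [v w /not_implyP[/tick01//]|].
  by apply: Def_imp; [exact: Def_tick | def_tac].
Qed.

Lemma Def_points sy i j : Def M (fun v => points stage x (phi sy) (v i) (v j)).
Proof.
apply: (@Def_ext _ _ _ (fun v => exists i' e e' p q,
  (next_tick stage x (v j) i' /\ tick stage x (v j) e /\ tick stage x i' e' /\
   gap stage (v i) p q) /\ p < phi sy /\ phi sy < q /\ p + (q - p) * e < phi sy /\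
   phi sy < p + (q - p) * e')).
  move=> v; split=> -[i' [e [e' [p [q]]]]].
    by move=> [[a [b [c d]]] [f [g [h k]]]]; exists i', e, e', p, q.
  by move=> [a b c d [f g h k]]; exists i', e, e', p, q.
apply: Def_ex.
apply: Def_exv => [v w [? [? [? [[_ [/tick01]]]]]]//|].
apply: Def_exv => [v w [? [? [[_ [_ [/tick01]]]]]]//|].
apply: Def_exv => [v w [? [[_ [_ [_ /gap_bounds[]]]]]]//|].
apply: Def_exv => [v w [[_ [_ [_ /gap_bounds[]]]]]//|].
def_ands.
- exact: Def_next_tick.
- exact: Def_tick.
- exact: Def_tick.
- exact: Def_gap.
- exact: Def_pl_const.
- exact: (Def2 (Q := fun x y => phi x < phi y) Def_phi_lt (DT_const _ _) (DT_var _ _)).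
- exact: (Def4 (Q := fun p q e y => phi p + (phi q - phi p) * phi e < phi y)
    Def_interp_lt (DT_var _ _) (DT_var _ _) (DT_var _ _) (DT_const _ _)).
- exact: (Def4 (Q := fun p q e y => phi y < phi p + (phi q - phi p) * phi e)
    Def_lt_interp (DT_var _ _) (DT_var _ _) (DT_var _ _) (DT_const _ _)).
Qed.

Lemma Def_bit b i j k : Def M (fun v => bit stage b (v i) (v j) (phi (v k))).
Proof.
apply: (@Def_ext _ _ _ (fun v => exists p q p' q',
  (gap stage (v i) p q /\ gap stage (v j) p' q' /\ p < p' /\ q' < q /\
   p' < phi (v k) /\ phi (v k) < q') /\
   forall w, stage (v j) w -> ~ (if b then q' < w /\ w < q else p < w /\ w < p'))).
  move=> v; split=> -[p [q [p' [q']]]].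
    move=> [[a [c [d [e [f g]]]]] H]; exists p, q, p', q'; split=> //; first exact/andP.
    by move=> w /H; case: (b) => h /andP.
  move=> [a c [d e] /andP[f g] H]; exists p, q, p', q'; split=> // w /H.
  by case: (b) => h /andP.
apply: Def_exv => [v w [? [? [? [[/gap_bounds[]]]]]]//|].
apply: Def_exv => [v w [? [? [[/gap_bounds[]]]]]//|].
apply: Def_exv => [v w [? [[_ [/gap_bounds[]]]]]//|].
apply: Def_exv => [v w [[_ [/gap_bounds[]]]]//|].
apply: Def_and.
  def_ands; [exact: Def_gap|exact: Def_gap|exact: Def_pl..].
apply: Def_allv => [v w /not_implyP[/stage01//]|].
apply: Def_imp; first exact: Def_stage.
by case: b; apply: Def_not; apply: Def_and; apply: Def_pl.
Qed.

Lemma Def_code i : Def M (fun v => code stage x (phi (v i))).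
Proof.
apply: (@Def_ext _ _ _ (fun v =>
  (forall r r', next_tick stage x r r' -> bit stage true r r' (phi (v i)) \/
     bit stage false r r' (phi (v i))) /\
  forall r e, tick stage x r e ->
    (forall r' e', tick stage x r' e' -> r' <= r) ->
    exists q, forall z, z = 0 -> gap stage r z q /\ z < phi (v i) /\ phi (v i) < q)).
  move=> v; split=> -[H1 H2]; split.
  - by move=> r r' /H1[]; [exists true | exists false].
  - move=> r e te mx; have [q /(_ 0 erefl)[g yb]] := H2 r e te mx.
    by exists q; split=> //; apply/andP.
  - by move=> r r' /H1[[]]; [left | right].
  - move=> r e te mx; have [q [g /andP[a b]]] := H2 r e te mx.
    by exists q => z ->.
apply: Def_and.
  apply: Def_all; apply: Def_all; apply: Def_imp; first exact: Def_next_tick.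
  by apply: Def_or; apply: Def_bit.
apply: Def_all; apply: Def_allv => [v w /not_implyP[/tick01//]|].
apply: Def_imp; first exact: Def_tick.
apply: Def_imp.
  apply: Def_all; apply: Def_allv => [v w /not_implyP[/tick01//]|].
  by apply: Def_imp; [exact: Def_tick | def_tac].
apply: Def_exv => [v w /(_ 0 erefl)[/gap_bounds[]]//|].
apply: Def_allv => [v w /not_implyP[-> _]|]; first by rewrite lexx ler01.
apply: Def_imp; first exact: Def_peq.
by def_ands; [exact: Def_gap | exact: Def_pl..].
Qed.

End Point.

Lemma env3 (v : nat -> R) : env (1 + 1 + 1) v =
  row_mx (row_mx (const_mx (v 0%N)) (const_mx (v 1%N))) (const_mx (v 2%N)).
Proof.
apply/rowP => i; rewrite !mxE -{1}(splitK i); case: (fintype.split i) => j /=.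
  rewrite !mxE -{1}(splitK j); case: (fintype.split j) => k /=; rewrite mxE.
    by rewrite (ord1 k).
  by rewrite (ord1 k).
by rewrite mxE (ord1 j).
Qed.

Lemma env2 (v : nat -> R) : env (1 + 1) v =
  row_mx (const_mx (v 0%N)) (const_mx (v 1%N)).
Proof.
apply/rowP => i; rewrite !mxE -{1}(splitK i); case: (fintype.split i) => j /=.
  by rewrite mxE (ord1 j).
by rewrite mxE (ord1 j).
Qed.

Lemma const_mx11 (u : 'rV[R]_1) : u = const_mx (u ord0 ord0).
Proof. by apply/rowP => i; rewrite mxE (ord1 i). Qed.

Lemma stage_stages : stages stage.
Proof.
split.
- exact: stage_fin.
- exact: stage_anti.
- exact: stage_closed.
- exact: stage0.
- exact: stage1.
- by move=> r v _ /stage01.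
- exact: stage_dense.
Qed.

Theorem coding_defines_PN : defines_copy_PN M.
Proof.
have st := stage_stages.
have [x [r_ [e_ tg]]] := ticking_ex st.
have [|sx sxE] := @phi_surj x.
  have := tg_lt tg 0%N; rewrite (tg_e0 tg) => x0.
  by apply/andP; split; apply: ltW => //; apply: tg_lt1 tg.
rewrite -{x}sxE in tg; pose x := phi sx.
have [a1 [a2 [a3 [/phi_surj[s1 <-] /phi_surj[s2 <-] /phi_surj[s3 <-] Hadd]]]] :=
  relation_coding st tg addn.
have [b1 [b2 [b3 [/phi_surj[t1 <-] /phi_surj[t2 <-] /phi_surj[t3 <-] Hmul]]]] :=
  relation_coding st tg muln.
have tkP := tickP st tg.
pose N : set 'rV[R]_1 := [set u | exists e, tick stage x (u ord0 ord0) e].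
pose P : set 'rV[R]_1 := [set u | Rep (u ord0 ord0) /\
  code stage x (phi (u ord0 ord0))].
have [h Hh] : {h : 'rV[R]_1 -> nat & forall u, N u -> u = const_mx (r_ (h u).+1)}.
  apply: (@choice _ _ (fun u k => N u -> u = const_mx (r_ k.+1))) => u.
  have [[e /tkP[k [uk _]]]|nu] := pselect (N u); last by exists 0%N.
  by exists k => _; rewrite [LHS]const_mx11 uk.
have Nr k : N (const_mx (r_ k.+1)).
  by exists (e_ k.+1); rewrite mxE; apply/tkP; exists k.
have hr k : h (const_mx (r_ k.+1)) = k.
  have /rowP/(_ ord0) := Hh _ (Nr k); rewrite !mxE => /(r_inj tg)[].
  by [].
pose op f (u v : 'rV[R]_1) : 'rV[R]_1 := const_mx (r_ (f (h u) (h v)).+1).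
pose elt : set 'rV[R]_(1 + 1) := [set w | N (lsubmx w) /\ P (rsubmx w) /\
  exists r', next_tick stage x (lsubmx w ord0 ord0) r' /\
    bit stage true (lsubmx w ord0 ord0) r' (phi (rsubmx w ord0 ord0))].
pose g (u : 'rV[R]_1) : set nat :=
  [set k | bit stage true (r_ k.+1) (r_ k.+2) (phi (u ord0 ord0))].
have dop f y1 y2 y3 : (forall i j l, (exists r e, [/\ tick stage x r e,
    points stage x (phi y1) r (r_ i.+1), points stage x (phi y2) r (r_ j.+1) &
    points stage x (phi y3) r (r_ l.+1)]) <-> l = f i j) -> definable_op M N (op f).
  move=> Hf; apply: Def_definable.
  apply: (@Def_ext _ _ _ (fun v => (exists e, tick stage x (v 0%N) e) /\
    (exists e, tick stage x (v 1%N) e) /\ (exists e, tick stage x (v 2%N) e) /\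
    exists r, (exists e, tick stage x r e) /\ points stage x (phi y1) r (v 0%N) /\
      points stage x (phi y2) r (v 1%N) /\ points stage x (phi y3) r (v 2%N))).
    move=> v; rewrite env3; split.
      move=> [[e0 /tkP[i [E0 _]]] [[e1 /tkP[j [E1 _]]] [[e2 /tkP[l [E2 _]]]]]].
      rewrite E0 E1 E2 => -[r [[e te] [p1 [p2 p3]]]].
      exists (const_mx (r_ i.+1)) => //; exists (const_mx (r_ j.+1)) => //.
      congr row_mx; rewrite /op !hr; congr const_mx; congr (r_ _.+1).
      by apply/esym/Hf; exists r, e.
    move=> [u Nu [w Nw]] /eq_row_mx[/eq_row_mx[/rowP/(_ ord0) E0 /rowP/(_ ord0) E1]].
    move=> /rowP/(_ ord0); rewrite /op !mxE => E2.
    move: E0 E1; rewrite (Hh _ Nu) (Hh _ Nw) !mxE => E0 E1.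
    rewrite -E0 -E1 -E2.
    have tk k : exists e, tick stage x (r_ k.+1) e.
      by exists (e_ k.+1); apply/tkP; exists k.
    do 3 split=> //.
    have [r [e [te p1 p2 p3]]] := (Hf (h u) (h w) _).2 erefl.
    by exists r; split; [exists e | ].
  def_ands; [exact: Def_extick..|].
  apply: Def_ex; def_ands; first exact: Def_extick.
  - exact: Def_points.
  - exact: Def_points.
  - exact: Def_points.
exists 1%N, 1%N, P, N, elt, (op addn), (op muln).
have opN f : {in N &, forall u w, N (op f u w)} by move=> u w _ _; apply: Nr.
split=> //; first split.
- apply: Def_definable.
  apply: (@Def_ext _ _ _ (fun v => Rep (v 0%N) /\ code stage x (phi (v 0%N)))).
    by move=> v; rewrite /P /= !mxE.
  by apply: Def_and; [exact: Def_Rep | exact: Def_code].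
- apply: Def_definable.
  apply: (@Def_ext _ _ _ (fun v => exists e, tick stage x (v 0%N) e)).
    by move=> v; rewrite /N /= !mxE.
  exact: Def_extick.
- apply: Def_definable.
  apply: (@Def_ext _ _ _ (fun v => ((exists e, tick stage x (v 0%N) e) /\
    Rep (v 1%N) /\ code stage x (phi (v 1%N))) /\ exists r',
    next_tick stage x (v 0%N) r' /\ bit stage true (v 0%N) r' (phi (v 1%N)))).
    move=> v; rewrite env2 /elt /= row_mxKl row_mxKr /N /P /= !mxE.
    by split=> [[[? ?] ?]|[? [? ?]]].
  def_ands; first exact: Def_extick.
  + exact: (Def1 (Q := Rep) Def_Rep (DT_var _ _)).
  + exact: Def_code.
  + by apply: Def_ex; def_ands; [exact: Def_next_tick | exact: Def_bit].
- exact: (dop _ _ _ _ Hadd).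
- exact: (dop _ _ _ _ Hmul).
- by move=> u [Nu [Pu _]].
exists g, h; split.
- split=> //.
    move=> u w /set_mem[Ru cu] /set_mem[Rw cw] E1.
    rewrite [u]const_mx11 [w]const_mx11; congr const_mx; apply: Rep_inj => //.
    apply: (code_inj st tg cu cw) => k.
    have Ek : g u k = g w k by rewrite E1.
    by move: Ek; rewrite /g /= => ->.
  move=> S _; have [y [/Rep_ex[s [Rs <-]] cs HS]] := code_surj st tg S.
  exists (const_mx s); first by rewrite /P /= mxE.
  by apply/seteqP; split=> k; rewrite /g /= mxE => /HS.
- split=> //.
    by move=> u w /set_mem/Hh Eu /set_mem/Hh Ew huw; rewrite Eu Ew huw.
  by move=> k _; exists (const_mx (r_ k.+1)).
- move=> u X /set_mem Nu /set_mem PX; rewrite /elt /= row_mxKl row_mxKr /g /=.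
  have uk : u ord0 ord0 = r_ (h u).+1 by rewrite {1}(Hh _ Nu) mxE.
  rewrite uk; split.
    by move=> [_ [_ [r' [/(next_tickP st tg)->]]]].
  move=> b; split=> //; split=> //; exists (r_ (h u).+2); split=> //.
  exact/(next_tickP st tg).
- by move=> u w _ _; rewrite /op hr.
- by move=> u w _ _; rewrite /op hr.
Qed.

End Coding.

Section ValueCoding.
Variables (R : realType) (L : signature) (M : expansion R L).
Variables (phi : R -> R) (V : set R).
Hypothesis vs : value_system M phi V.
Hypothesis V4 : forall w, -4 < w -> w < 4 -> V w.
Variables (Rep : set R) (E : R -> R -> Prop).
Hypothesis Def_Rep : Def M (fun v => Rep (v 0%N)).
Hypothesis Rep01 : forall s, Rep s -> 0 <= phi s <= 1.
Hypothesis Rep_ex : forall w, 0 <= w <= 1 -> exists s, Rep s /\ phi s = w.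
Hypothesis Rep_inj : forall s t, Rep s -> Rep t -> phi s = phi t -> s = t.
Hypothesis Def_E : Def M (fun v => E (v 0%N) (v 1%N)).
Hypothesis Eanti : forall r r' s, 0 < r' -> r' <= r -> E r s -> E r' s.
Hypothesis Efin : forall r, 0 < r -> finite_set (phi @` E r).
Hypothesis Edense : forall u v, 0 <= u -> u < v -> v <= 1 ->
  exists r s, [/\ 0 < r, E r s & u < phi s < v].

Theorem value_coding_PN : defines_copy_PN M.
Proof.
have [z0 z0E] : exists s, phi s = 0 by apply: (vs_surj vs); apply: V4; lra.
have [z1 z1E] : exists s, phi s = 1 by apply: (vs_surj vs); apply: V4; lra.
pose c s := if `[< phi s < phi z0 >] then z0 else
  if `[< phi z1 < phi s >] then z1 else s.
have dc i : DT M (fun v => c (v i)).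
  have dlt := Def2 (Q := fun x y => phi x < phi y) (vs_lt vs).
  apply: (@DT_if _ _ _ (fun v => phi (v i) < phi z0) (fun=> z0)).
  - by apply: dlt; [exact: DT_var | exact: DT_const].
  - exact: DT_const.
  apply: (@DT_if _ _ _ (fun v => phi z1 < phi (v i)) (fun=> z1)).
  - by apply: dlt; [exact: DT_const | exact: DT_var].
  - exact: DT_const.
  - exact: DT_var.
pose psi s := phi (c s).
have psi01 s : 0 <= psi s <= 1.
  rewrite /psi /c z0E z1E; case: asboolP => [_|/negP]; first by rewrite z0E lexx ler01.
  rewrite -leNgt => ge0; case: asboolP => [_|/negP]; first by rewrite z1E lexx ler01.
  by rewrite -leNgt ge0.
have psiE s : 0 <= phi s <= 1 -> psi s = phi s.
  rewrite /psi /c z0E z1E => /andP[a b]; case: asboolP => [|_]; first by rewrite ltNge a.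
  by case: asboolP => //; rewrite ltNge b.
have psiV i : DV M phi V (fun v => psi (v i)).
  apply: (DV_phi vs) => [v|]; last exact: dc.
  by have /andP[? ?] := psi01 (v i); apply: V4; rewrite -/(psi _); lra.
have bnd (p q u : R) : 0 <= p <= 1 -> 0 <= q <= 1 -> 0 <= u <= 1 ->
    -1 <= (q - p) * u <= 1.
  move=> /andP[p0 p1] /andP[q0 q1] /andP[u0 u1].
  by rewrite -ler_norml normrM (ger0_norm u0) mulr_ile1// ler_norml; apply/andP; split; lra.
have interp : DV M phi V (fun v =>
    psi (v 0%N) + (psi (v 1%N) - psi (v 0%N)) * psi (v 2%N)).
  apply: (DV_add vs) => //; last first.
    move=> v; have /andP[? ?] := bnd _ _ _ (psi01 (v 0%N)) (psi01 (v 1%N)) (psi01 (v 2%N)).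
    by have /andP[? ?] := psi01 (v 0%N); apply: V4; lra.
  apply: (DV_mul vs) => //; last first.
    move=> v; have /andP[? ?] := bnd _ _ _ (psi01 (v 0%N)) (psi01 (v 1%N)) (psi01 (v 2%N)).
    by apply: V4; lra.
  apply: (DV_add vs) => //; last first.
    move=> v; have /andP[? ?] := psi01 (v 0%N); have /andP[? ?] := psi01 (v 1%N).
    by apply: V4; lra.
  apply: (DV_opp vs) => //; first by apply: V4; lra.
  by move=> v; have /andP[? ?] := psi01 (v 0%N); apply: V4; lra.
apply: (@coding_defines_PN _ _ _ psi Rep (fun r s => E r s /\ 0 <= phi s <= 1)) => //.
- exact: (Def_ltV vs).
- exact: (Def_ltV vs).
- exact: (Def_ltV vs).
- by move=> w /Rep_ex[s [Rs <-]]; exists s; split=> //; apply: psiE; apply: Rep01.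
- by move=> s t Rs Rt; rewrite !psiE ?Rep01//; apply: Rep_inj.
- apply: Def_and => //.
  apply: (@Def_ext _ _ _ (fun v => phi z0 <= phi (v 1%N) /\ phi (v 1%N) <= phi z1)).
    by move=> v; rewrite z0E z1E; split=> [[a b]|/andP//]; apply/andP.
  by apply: Def_and; apply: (Def_lev vs); first [exact: DT_var | exact: DT_const].
- by move=> r r' s r0 rr [Es]; split=> //; apply: Eanti Es.
- move=> r r0; apply: sub_finite_set (Efin r0) => _ [s [Es b] <-].
  by exists s => //; rewrite psiE.
move=> u v u0 uv v1; have [r [s [r0 Es /andP[us sv]]]] := Edense u0 uv v1.
have b : 0 <= phi s <= 1 by apply/andP; split; lra.
by exists r, s; split=> //; rewrite psiE// us.
Qed.

End ValueCoding.

(** * Slopes of germs *)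

Section Germs.
Variable R : realType.

Definition slope (G : R -> R) (l : R) := forall eps, 0 < eps ->
  exists d : R, 0 < d /\ forall h, `|h| < d -> `|G h - l * h| <= eps * `|h|.

Lemma slope_derive (f : R -> R) (x : R) : derivable f x 1 ->
  slope (fun h => f (x + h) - f x) (derive1 f x).
Proof.
move=> df eps eps0.
have lim : (h^-1 *: ((f \o +%R^~ x) (h *: (1 : R)) - f x)) @[h --> 0^'] --> derive1 f x.
  by rewrite derive1E; exact: df.
move: lim => /cvgrPdist_le /(_ _ eps0) /nbhs_ballP[d /= d0 Hd].
exists d; split=> // h hd; have [->|h0] := eqVneq h 0.
  by rewrite addr0 subrr mulr0 subrr normr0 mulr0.
have {Hd} := Hd h; rewrite /ball /= sub0r normrN => /(_ hd h0).
rewrite /= [h *: 1]mulr1 [h^-1 *: _]/(h^-1 * _) [h + x]addrC => H.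
have -> : f (x + h) - f x - derive1 f x * h =
    - ((derive1 f x - h^-1 * (f (x + h) - f x)) * h).
  by field.
by rewrite normrN normrM ler_pM2r ?normr_gt0.
Qed.

Lemma slope_add G H l m : slope G l -> slope H m ->
  slope (fun h => G h + H h) (l + m).
Proof.
move=> sG sH eps eps0; have e2 : 0 < eps / 2 by rewrite divr_gt0.
have [d [d0 Hd]] := sG _ e2; have [d' [d'0 Hd']] := sH _ e2.
exists (Num.min d d'); split=> [|h]; rewrite lt_min; first by rewrite d0.
move=> /andP[/Hd a /Hd' b].
have -> : G h + H h - (l + m) * h = (G h - l * h) + (H h - m * h) by ring.
by apply: le_trans (ler_normD _ _) _; lra.
Qed.

Lemma slope_comp G H l m : slope G l -> slope H m ->
  slope (fun h => G (H h)) (l * m).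
Proof.
move=> sG sH eps eps0; pose K := `|l| + `|m| + 1.
have K0 : 0 < K by rewrite ltr_wpDl ?addr_ge0.
pose e := Num.min 1 (eps / K).
have e0 : 0 < e by rewrite lt_min ltr01 divr_gt0.
have e1 : e <= 1 by rewrite ge_min lexx.
have eK : e * K <= eps by rewrite -ler_pdivlMr// ge_min lexx orbT.
have [d [d0 Hd]] := sG _ e0; have [d' [d'0 Hd']] := sH _ e0.
have m1 : 0 < `|m| + 1 by rewrite ltr_wpDl.
exists (Num.min d' (d / (`|m| + 1))); split=> [|h]; rewrite lt_min.
  by rewrite d'0 divr_gt0.
move=> /andP[/Hd' b]; rewrite ltr_pdivlMr// => hd.
have Hh : `|H h| <= (`|m| + e) * `|h|.
  have -> : H h = (H h - m * h) + m * h by ring.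
  by apply: le_trans (ler_normD _ _) _; rewrite normrM; lra.
have Hh1 : `|H h| <= `|h| * (`|m| + 1).
  apply: le_trans Hh _; rewrite mulrC; apply: ler_wpM2l => //; lra.
have a := Hd _ (le_lt_trans Hh1 hd).
have -> : G (H h) - l * m * h = (G (H h) - l * H h) + l * (H h - m * h) by ring.
apply: le_trans (ler_normD _ _) _; rewrite normrM.
have h1 : `|l| * `|H h - m * h| <= `|l| * (e * `|h|) by apply: ler_wpM2l.
have h2 : e * `|H h| <= e * (`|h| * (`|m| + 1)) by apply: ler_wpM2l => //; apply: ltW.
have h3 : e * K * `|h| <= eps * `|h| by apply: ler_wpM2r.
by rewrite /K in h3; lra.
Qed.

Definition le0 (G H : R -> R) := exists e : R, 0 < e /\
  forall h, 0 < h -> h < e -> G h <= H h.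

Lemma slope_lt G H l m : slope G l -> slope H m -> l < m ->
  exists e : R, 0 < e /\ forall h, 0 < h -> h < e -> G h < H h.
Proof.
move=> sG sH lm; have e0 : 0 < (m - l) / 3 by rewrite divr_gt0// subr_gt0.
have [d [d0 Hd]] := sG _ e0; have [d' [d'0 Hd']] := sH _ e0.
exists (Num.min d d'); split=> [|h h0]; rewrite lt_min; first by rewrite d0.
move=> /andP[hd hd']; have hE : `|h| = h by rewrite gtr0_norm.
have := Hd h; have := Hd' h; rewrite hE => /(_ hd') + /(_ hd).
rewrite !ler_norml => /andP[a _] /andP[_ b].
have : 0 < (m - l) * h by rewrite mulr_gt0// subr_gt0.
by move=> c; lra.
Qed.

Lemma slope_le0 G H l m : slope G l -> slope H m -> l < m -> le0 G H.
Proof.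
move=> sG sH lm; have [e [e0 He]] := slope_lt sG sH lm.
by exists e; split=> // h h0 he; apply/ltW/He.
Qed.

Lemma le0_slope G H l m : slope G l -> slope H m -> le0 G H -> l <= m.
Proof.
move=> sG sH [e [e0 He]]; rewrite leNgt; apply/negP => ml.
have [d [d0 Hd]] := slope_lt sH sG ml.
pose h := Num.min e d / 2.
have m0 : 0 < Num.min e d by rewrite lt_min e0.
have h0 : 0 < h by rewrite divr_gt0.
have : h < Num.min e d by rewrite ltr_pdivrMr// ltr_pMr// ltr1n.
rewrite lt_min => /andP[he hd].
by have := He h h0 he; rewrite leNgt Hd.
Qed.

End Germs.

Section ContinuousReal.
Variable R : realType.

Lemma cont_eps (phi : R -> R) (x : R) : {for x, continuous phi} -> forall e, 0 < e ->
  exists d : R, 0 < d /\ forall y, `|y - x| < d -> `|phi y - phi x| < e.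
Proof.
move=> /cvgrPdist_lt H e /H /nbhs_ballP[d /= d0 Hd]; exists d; split=> // y yx.
by rewrite distrC; apply: Hd; rewrite /ball /= distrC.
Qed.

Lemma eps_cont (phi : R -> R) (x : R) : (forall e, 0 < e ->
  exists d : R, 0 < d /\ forall y, `|y - x| < d -> `|phi y - phi x| < e) ->
  {for x, continuous phi}.
Proof.
move=> H; apply/cvgrPdist_lt => e /H[d [d0 Hd]]; apply/nbhs_ballP; exists d => //= y.
by rewrite /ball /= distrC => /Hd; rewrite distrC.
Qed.

Lemma cont_itv (phi : R -> R) (x : R) : {for x, continuous phi} ->
  forall e, 0 < e -> exists d : R, 0 < d /\
    forall y, x - d < y -> y < x + d -> phi x - e < phi y /\ phi y < phi x + e.
Proof.
move=> /cont_eps H e /H[d [d0 Hd]]; exists d; split=> // y xy yx.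
have : `|y - x| < d by rewrite ltr_norml; apply/andP; split; lra.
by move/Hd; rewrite ltr_norml => /andP[? ?]; split; lra.
Qed.

Lemma continuous_congr (f g : R -> R) (p q x : R) : p < x -> x < q ->
  (forall y, p < y -> y < q -> f y = g y) -> {for x, continuous g} ->
  {for x, continuous f}.
Proof.
move=> px xq fg cg; apply: eps_cont => e e0; have [d [d0 Hd]] := cont_eps cg e0.
exists (Num.min d (Num.min (x - p) (q - x))); split=> [|y].
  by rewrite !lt_min d0 !subr_gt0 px.
rewrite !lt_min => /and3P[yd yp yq]; rewrite !fg //; first exact: Hd.
  by move: yp; rewrite ltr_norml => /andP[? _]; lra.
by move: yq; rewrite ltr_norml => /andP[_ ?]; lra.
Qed.

Lemma between_ex (u b d : R) : u < b -> 0 < d ->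
  exists w, [/\ u < w, w <= b & w < u + d].
Proof.
move=> ub d0; exists (Num.min b (u + d / 2)).
split; [rewrite lt_min ub; lra | by rewrite ge_min lexx | rewrite gt_min; apply/orP].
by right; lra.
Qed.

(* The first interval on which a continuous function rises from below [phi a]
   towards [phi b]. *)
Lemma rise (phi : R -> R) a b : (forall x, {for x, continuous phi}) ->
  a < b -> phi a < phi b -> exists u1 u2, [/\ a <= u1, u1 < u2, u2 <= b,
    forall w, u1 <= w -> w <= u2 -> phi a < phi w < phi b &
    phi u1 < phi u2].
Proof.
move=> cphi ab pab; pose m := (phi a + phi b) / 2.
have [am mb] : phi a < m /\ m < phi b by rewrite /m; split; lra.
pose S := [set w : R | a <= w <= b /\ phi w <= m].
have supS : has_sup S.
  split; first by exists a; split; [rewrite lexx ltW | apply: ltW].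
  by exists b => w [/andP[]].
pose u := sup S.
have au : a <= u by apply: (sup_upper_bound supS); split; [rewrite lexx ltW | apply: ltW].
have ub : u <= b by apply: ge_sup; [exact: supS.1 | move=> w [/andP[]]].
have above w : u < w -> w <= b -> m < phi w.
  move=> uw wb; rewrite ltNge; apply/negP => wm.
  suff : w <= u by rewrite leNgt uw.
  by apply: (sup_upper_bound supS); split=> //; rewrite wb andbT; lra.
have um : phi u = m.
  apply/eqP; rewrite eq_le; apply/andP; split; rewrite leNgt; apply/negP => lt.
    have [|d [d0 Hd]] := cont_itv (cphi u) (e := phi u - m); first by lra.
    have [w Sw] := sup_adherent d0 supS; rewrite -/u => uw; have [_ wm] := Sw.
    have wu : w <= u by apply: (sup_upper_bound supS).
    by have [||a1 a2] := Hd w; lra.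
  have [|d [d0 Hd]] := cont_itv (cphi u) (e := m - phi u); first by lra.
  have ltub : u < b.
    by rewrite lt_neqAle ub andbT; apply/negP => /eqP E; move: lt; rewrite E; lra.
  have [w [uw wb wd]] := between_ex ltub d0.
  have mw := above w uw wb.
  by have [||a1 a2] := Hd w; lra.
have ltub : u < b.
  by rewrite lt_neqAle ub andbT; apply/negP => /eqP E; move: um; rewrite E; lra.
have [|d [d0 Hd]] := cont_itv (cphi u) (e := (phi b - phi a) / 2); first by lra.
have [w [uw wb wd]] := between_ex ltub d0.
exists u, w; split=> //; last by rewrite um; apply: above.
move=> v uv vw; have [||a1 a2] := Hd v; try lra.
by apply/andP; rewrite um /m in a1 a2; split; lra.
Qed.

Lemma rise_or_fall (phi : R -> R) a b s t : (forall x, {for x, continuous phi}) ->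
  a <= s -> s <= b -> a <= t -> t <= b -> phi s < phi t ->
  exists u1 u2, [/\ a <= u1, u1 < u2, u2 <= b,
    forall w, u1 <= w -> w <= u2 -> phi s < phi w < phi t & phi u1 <> phi u2].
Proof.
move=> cphi as_ sb at_ tb pst; case: (ltgtP s t) => [st|ts|E].
- have [u1 [u2 [h1 h2 h3 h4 h5]]] := rise cphi st pst.
  by exists u1, u2; split=> //; lra.
- have cN (x : R) : {for x, continuous (fun y => phi (- y))}.
    apply: (@continuous_comp _ _ _ (fun y : R => - y)); first exact: opp_continuous.
    exact: cphi.
  have [||u1 [u2 [h1 h2 h3 h4 h5]]] := @rise (fun y => phi (- y)) (- s) (- t) cN.
  + by rewrite ltrN2.
  + by rewrite !opprK.
  exists (- u2), (- u1); split; rewrite ?ltrN2//; try lra.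
  by move=> w w1 w2; have := h4 (- w); rewrite !opprK; apply; lra.
- by move: pst; rewrite E ltxx.
Qed.

Lemma ivt (phi : R -> R) s t m : (forall x, {for x, continuous phi}) ->
  phi s <= m -> m <= phi t -> exists u, phi u = m /\
    (Num.min s t <= u <= Num.max s t).
Proof.
move=> cphi sm mt.
have cw a b : {within `[a, b], continuous phi}.
  by apply: continuous_subspaceT => x; apply: cphi.
have [st|/ltW ts] := leP s t.
  have [|u] := IVT (v := m) st (cw _ _).
    by rewrite ge_min le_max sm mt orbT.
  by rewrite in_itv /= => ? ?; exists u.
have [|u] := IVT (v := m) ts (cw _ _).
  by rewrite ge_min le_max sm mt !orbT.
by rewrite in_itv /= => ? ?; exists u.
Qed.

End ContinuousReal.

Lemma strictly_between (R : realType) (p q : R) : p <> q ->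
  exists m, m <> p /\ m <> q /\ (p <= m <= q \/ q <= m <= p).
Proof.
move=> pq; exists ((p + q) / 2); case: (ltgtP p q) pq => // lt _.
  by split; [lra|split; [lra|left; apply/andP; split; lra]].
by split; [lra|split; [lra|right; apply/andP; split; lra]].
Qed.

Section SlopeSystem.
Variables (R : realType) (L : signature) (M : expansion R L).

Lemma Def_le0 (G H : (nat -> R) -> R -> R) :
  DT M (fun v => G (shift v) (v 0%N)) -> DT M (fun v => H (shift v) (v 0%N)) ->
  Def M (fun v => le0 (G v) (H v)).
Proof.
move=> dG dH.
have dG' : DT M (fun v => G (shift (shift v)) (v 0%N)).
  exact: (DT_ren (fun i => if i is j.+1 then j.+2 else 0%N) dG).
have dH' : DT M (fun v => H (shift (shift v)) (v 0%N)).
  exact: (DT_ren (fun i => if i is j.+1 then j.+2 else 0%N) dH).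
apply: Def_ex; apply: Def_and; first by def_tac.
apply: Def_all; apply: Def_imp; first by def_tac.
apply: Def_imp; first by def_tac.
exact: Def_le.
Qed.

Variables (f : R -> R) (A al be B K : R).
Hypotheses (Aal : A < al) (albe : al < be) (beB : be < B).
Hypothesis Def_f : Def M (fun v => v 0%N = f (v 1%N)).
Hypothesis f_derivable : forall x, A < x -> x < B -> derivable f x 1.
Hypothesis f_C1 : forall x, A < x -> x < B -> {for x, continuous (derive1 f)}.
Hypothesis K0 : 0 < K.
Hypothesis slope_low : exists t, [/\ al <= t, t <= be & derive1 f t <= - K].
Hypothesis slope_high : exists t, [/\ al <= t, t <= be & K <= derive1 f t].

Definition clamp (s : R) : R := Num.max al (Num.min s be).
Definition germ s h := f (clamp s + h) - f (clamp s).
Definition gslope s := derive1 f (clamp s).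

Lemma clamp_ge s : al <= clamp s. Proof. by rewrite le_max lexx. Qed.

Lemma clamp_le s : clamp s <= be.
Proof. by rewrite ge_max ltW// ge_min lexx orbT. Qed.

Lemma clamp_id s : al <= s -> s <= be -> clamp s = s.
Proof. by rewrite /clamp => h /min_idPl ->; apply/max_idPr. Qed.

Lemma clampK s : clamp (clamp s) = clamp s.
Proof. by rewrite clamp_id ?clamp_ge ?clamp_le. Qed.

Lemma clamp_lip s t : `|clamp s - clamp t| <= `|s - t|.
Proof.
apply: (@le_trans _ _ `|Num.min s be - Num.min t be|).
  rewrite /clamp; case: (leP al (Num.min s be)) => hs; case: (leP al (Num.min t be)) => ht.
  - by [].
  - by rewrite !ger0_norm ?subr_ge0 ?(ltW (lt_le_trans ht hs))// lerB// ltW.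
  - rewrite distrC [leRHS]distrC !ger0_norm ?subr_ge0 ?(ltW (lt_le_trans hs ht))//.
    by rewrite lerB// ltW.
  - by rewrite subrr normr0.
case: (leP s be) => hs; case: (leP t be) => ht.
- by [].
- by rewrite distrC [leRHS]distrC !ger0_norm ?subr_ge0 ?(ltW (le_lt_trans hs ht))// lerB// ltW.
- by rewrite !ger0_norm ?subr_ge0 ?(ltW (le_lt_trans ht hs))// lerB// ltW.
- by rewrite subrr normr0.
Qed.

Lemma gslope_cont x : {for x, continuous gslope}.
Proof.
apply: eps_cont => e e0.
have [||d [d0 Hd]] := cont_eps (@f_C1 (clamp x) _ _) e0.
- exact: lt_le_trans (clamp_ge x).
- exact: le_lt_trans (clamp_le x) _.
by exists d; split=> // y yx; apply: Hd; apply: le_lt_trans yx; apply: clamp_lip.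
Qed.

Lemma germ_slope s : slope (germ s) (gslope s).
Proof.
apply: slope_derive; apply: f_derivable.
  exact: lt_le_trans (clamp_ge s).
exact: le_lt_trans (clamp_le s) _.
Qed.

Lemma DT_f t : DT M t -> DT M (fun v => f (t v)).
Proof. exact: DT_fun. Qed.

Lemma DT_clamp t : DT M t -> DT M (fun v => clamp (t v)).
Proof.
move=> dt; apply: (@DT_max _ _ _ (fun=> al)); first exact: DT_const.
by apply: (@DT_min _ _ _ t) => //; exact: DT_const.
Qed.

Lemma DT_germ t u : DT M t -> DT M u -> DT M (fun v => germ (t v) (u v)).
Proof.
move=> dt du; apply: (@DT_sub _ _ _ (fun v => f (clamp (t v) + u v))).
  by apply: DT_f; apply: (@DT_add _ _ _ (fun v => clamp (t v))) => //; apply: DT_clamp.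
by apply: DT_f; apply: DT_clamp.
Qed.

Lemma constant_slope u1 u2 c : al <= u1 -> u2 <= be ->
  (forall w, u1 <= w -> w <= u2 -> derive1 f w = c) ->
  forall w w', u1 <= w -> w < w' -> w' <= u2 -> f w' - f w = c * (w' - w).
Proof.
have [Aal' beB'] := (Aal, beB).
move=> au ub Hc w w' uw ww' wu.
have [|||x xw ->] := @MVT R f (derive1 f) w w'.
- exact: ww'.
- move=> x; rewrite in_itv /= => /andP[wx xw].
  rewrite derive1E; apply: DeriveDef; last by [].
  by apply: f_derivable; lra.
- apply: derivable_within_continuous => x; rewrite in_itv /= => /andP[wx xw].
  by apply: f_derivable; lra.
move: xw; rewrite in_itv /= => /andP[wx xw].
by rewrite Hc//; lra.
Qed.

Lemma gslope_lt s t : gslope s < gslope t <-> exists u1 u2,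
  (al <= u1 /\ u1 < u2 /\ u2 <= be) /\
  (forall w, u1 <= w -> w <= u2 ->
     le0 (germ s) (germ w) /\ le0 (germ w) (germ t)) /\
  exists w w', (u1 <= w /\ w < u2) /\ (u1 <= w' /\ w' < u2) /\
     ~ (le0 (germ w) (germ w') /\ le0 (germ w') (germ w)).
Proof.
split=> [st|[u1 [u2 [[au [uu ub]] [H [w [w' [[w1 w2] [[w3 w4] nw]]]]]]]]].
  have st' : gslope (clamp s) < gslope (clamp t) by rewrite /gslope !clampK.
  have [u1 [u2 [h1 h2 h3 h4 h5]]] := rise_or_fall gslope_cont (clamp_ge s)
    (clamp_le s) (clamp_ge t) (clamp_le t) st'.
  have gE x : gslope (clamp x) = gslope x by rewrite /gslope clampK.
  rewrite !gE in h4; exists u1, u2; split=> //; split.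
    move=> w a b; have /andP[p q] := h4 w a b.
    by split; [exact: slope_le0 (germ_slope _) (germ_slope _) p |
      exact: slope_le0 (germ_slope _) (germ_slope _) q].
  have [u [u1u uu2 [d1 d2]]] : exists u, [/\ u1 <= u, u < u2 & u1 < u /\ gslope u <> gslope u1].
    have [m [m1 m2]] := strictly_between h5.
    have [u [um ub]] : exists u, gslope u = m /\ u1 <= u <= u2.
      have mx : Num.max u1 u2 = u2 by apply/max_idPr/ltW.
      have mn : Num.min u1 u2 = u1 by apply/min_idPl/ltW.
      have mx' : Num.max u2 u1 = u2 by apply/max_idPl/ltW.
      have mn' : Num.min u2 u1 = u1 by apply/min_idPr/ltW.
      case: m2 => _ [/andP[a b]|/andP[a b]].
        by have [u []] := ivt gslope_cont a b; rewrite mx mn; exists u.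
      by have [u []] := ivt gslope_cont a b; rewrite mx' mn'; exists u.
    have /andP[ub1 ub2] := ub; exists u; split=> //.
      rewrite lt_neqAle ub2 andbT; apply/negP => /eqP E.
      by apply: m2.1; rewrite -um E.
    split; last by rewrite um.
    rewrite lt_neqAle ub1 andbT; apply/negP => /eqP E.
    by apply: m1; rewrite -um E.
  exists u1, u; split=> //; split=> // -[c1 c2]; apply: d2; apply/eqP.
  rewrite eq_le; apply/andP; split.
    exact: le0_slope (germ_slope _) (germ_slope _) c2.
  exact: le0_slope (germ_slope _) (germ_slope _) c1.
have le_st v : u1 <= v -> v <= u2 -> gslope s <= gslope v /\ gslope v <= gslope t.
  move=> a b; have [c1 c2] := H v a b.
  by split; [apply: le0_slope c1 | apply: le0_slope c2]; apply: germ_slope.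
rewrite lt_neqAle; apply/andP; split; last first.
  by have [||a b] := le_st u1; rewrite ?lexx//; [exact: ltW | exact: le_trans b].
apply/eqP => E; apply: nw.
have cst v : u1 <= v -> v <= u2 -> derive1 f v = gslope s.
  move=> a b; have [c1 c2] := le_st v a b.
  have : gslope v = gslope s by apply/eqP; rewrite eq_le c1 andbT E.
  by rewrite {1}/gslope clamp_id//; lra.
have gE v h : u1 <= v -> 0 < h -> v + h <= u2 -> germ v h = gslope s * h.
  move=> a h0 b; rewrite /germ clamp_id; try lra.
  by rewrite (constant_slope au ub cst); [congr (_ * _); lra|lra..].
by split; exists (Num.min (u2 - w) (u2 - w')); (split; first by rewrite lt_min; apply/andP; split; lra);
  move=> h h0; rewrite lt_min => /andP[a b]; rewrite !gE//; lra.
Qed.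

Lemma gslope_ex c : - K <= c -> c <= K -> exists s, gslope s = c.
Proof.
move=> c1 c2; have [s [s1 s2 s3]] := slope_low; have [t [t1 t2 t3]] := slope_high.
have sc : gslope s <= c by rewrite /gslope clamp_id//; exact: le_trans c1.
have ct : c <= gslope t by rewrite /gslope clamp_id//; exact: le_trans t3.
by have [u [um _]] := ivt gslope_cont sc ct; exists u.
Qed.

Lemma slope_eqP z G l : - K < gslope z -> gslope z < K -> slope G l ->
  (forall w, (gslope w < gslope z -> le0 (germ w) G) /\
     (gslope z < gslope w -> le0 G (germ w))) <-> l = gslope z.
Proof.
move=> z1 z2 sG; have K0' := K0; split=> [H|lz]; last first.
  rewrite lz in sG.
  by move=> w; split=> c; apply: slope_le0 c => //; apply: germ_slope.
case: (ltgtP l (gslope z)) => // c; exfalso.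
  pose m := (Num.max l (- K) + gslope z) / 2.
  have m1 : Num.max l (- K) < gslope z by rewrite gt_max c.
  have m2 : l <= Num.max l (- K) by rewrite le_max lexx.
  have m3 : - K <= Num.max l (- K) by rewrite le_max lexx orbT.
  have [||w wE] := @gslope_ex m; [rewrite /m; lra..|].
  have wz : gslope w < gslope z by rewrite wE /m; lra.
  have := le0_slope (germ_slope w) sG ((H w).1 wz); rewrite wE /m; lra.
pose m := (Num.min l K + gslope z) / 2.
have m1 : gslope z < Num.min l K by rewrite lt_min c.
have m2 : Num.min l K <= l by rewrite ge_min lexx.
have m3 : Num.min l K <= K by rewrite ge_min lexx orbT.
have [||w wE] := @gslope_ex m; [rewrite /m; lra..|].
have wz : gslope z < gslope w by rewrite wE /m; lra.
have := le0_slope sG (germ_slope w) ((H w).2 wz); rewrite wE /m; lra.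
Qed.

Lemma Def_gslope_lt : Def M (fun v => gslope (v 0%N) < gslope (v 1%N)).
Proof.
have dg i j : Def M (fun v => le0 (germ (v i)) (germ (v j))).
  by apply: (@Def_le0 (fun v => germ (v i)) (fun v => germ (v j)));
    apply: DT_germ; apply: DT_var.
apply: (Def_ext (fun v => iff_sym (gslope_lt (v 0%N) (v 1%N)))).
apply: Def_ex; apply: Def_ex; def_beta; apply: Def_and; first by def_tac.
apply: Def_and.
  apply: Def_all; apply: Def_imp; first by def_tac.
  apply: Def_imp; first by def_tac.
  by apply: Def_and; apply: dg.
apply: Def_ex; apply: Def_ex; def_beta; apply: Def_and; first by def_tac.
apply: Def_and; first by def_tac.
by apply: Def_not; apply: Def_and; apply: dg.
Qed.

Definition slopes : set R := [set c | - K < c < K].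

Lemma Def_slope_op (op : R -> R -> R) (G : R -> R -> R -> R) :
  (forall x y, slope (G x y) (op (gslope x) (gslope y))) ->
  DT M (fun v => G (v 1%N) (v 2%N) (v 0%N)) ->
  Def M (fun v => slopes (gslope (v 2%N)) /\
    op (gslope (v 0%N)) (gslope (v 1%N)) = gslope (v 2%N)).
Proof.
have K0' := K0; move=> sG dG.
have [||t1 t1E] := @gslope_ex (- K); [lra..|].
have [||t2 t2E] := @gslope_ex K; [lra..|].
apply: (@Def_ext _ _ _ (fun v => (gslope t1 < gslope (v 2%N) /\
    gslope (v 2%N) < gslope t2) /\
  (forall w, (gslope w < gslope (v 2%N) -> le0 (germ w) (G (v 0%N) (v 1%N))) /\
    (gslope (v 2%N) < gslope w -> le0 (G (v 0%N) (v 1%N)) (germ w))))).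
  move=> v; rewrite t1E t2E /slopes /=; split=> [[[a b] H]|[/andP[a b] H]].
    by split; [apply/andP | apply/(slope_eqP a b (sG _ _))].
  by split=> //; apply/(slope_eqP a b (sG _ _)).
have dlt := Def2 (Q := fun x y => gslope x < gslope y) Def_gslope_lt.
have dG' i j : DT M (fun v => G (shift v i) (shift v j) (v 0%N)).
  exact: (DT_ren (fun k => if k is k'.+1 then (if k' is 0%N then i else j).+1 else 0%N) dG).
have dg i : DT M (fun v => germ (shift v i) (v 0%N)).
  by apply: DT_germ; [apply: DT_var (i.+1) | apply: DT_var].
apply: Def_and.
  by apply: Def_and; apply: dlt; first [exact: DT_var | exact: DT_const].
apply: Def_all; def_beta; apply: Def_and; apply: Def_imp.
- by apply: dlt; exact: DT_var.
- by apply: (@Def_le0 (fun v => germ (v 0%N)) (fun v => G (v 1%N) (v 2%N))).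
- by apply: dlt; exact: DT_var.
- by apply: (@Def_le0 (fun v => G (v 1%N) (v 2%N)) (fun v => germ (v 0%N))).
Qed.

Theorem slope_system : value_system M gslope slopes.
Proof.
split.
- exact: Def_gslope_lt.
- apply: (@Def_slope_op +%R (fun x y h => germ x h + germ y h)).
    by move=> x y; apply: slope_add; apply: germ_slope.
  by apply: (@DT_add _ _ _ (fun v => germ (v 1%N) (v 0%N))); apply: DT_germ; apply: DT_var.
- apply: (@Def_slope_op *%R (fun x y h => germ x (germ y h))).
    by move=> x y; apply: slope_comp; apply: germ_slope.
  by apply: DT_germ; [apply: DT_var | apply: DT_germ; apply: DT_var].
- move=> w /andP[w1 w2]; exact: gslope_ex (ltW w1) (ltW w2).
Qed.

End SlopeSystem.

Section FiniteKey.
Variable R : realType.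

Lemma finite_key (A : set R) (phi : R -> R) (key : R -> nat) n :
  (forall s, A s -> (key s < n)%N) ->
  (forall s t, A s -> A t -> key s = key t -> phi s = phi t) ->
  finite_set (phi @` A).
Proof.
move=> kn kE.
have [g Hg] : {g : nat -> R & forall k s, A s -> key s = k -> phi s = g k}.
  apply: (@choice _ _ (fun k w => forall s, A s -> key s = k -> phi s = w)) => k.
  have [[s [As sk]]|ns] := pselect (exists s, A s /\ key s = k).
    by exists (phi s) => t At tk; apply: kE => //; rewrite sk.
  by exists 0 => s As sk; exfalso; apply: ns; exists s.
apply: (@sub_finite_set _ _ (g @` `I_n)); last exact/finite_image/finite_II.
by move=> _ [s As <-]; exists (key s); [exact: kn | rewrite -(Hg _ s)].
Qed.

Lemma same_cell (a r s t : R) : 0 < r -> a <= s -> a <= t ->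
  Num.truncn ((s - a) / r) = Num.truncn ((t - a) / r) -> `|s - t| < r.
Proof.
move=> r0 as_ at_ E.
have hs : 0 <= (s - a) / r by apply: divr_ge0; [rewrite subr_ge0 | apply: ltW].
have ht : 0 <= (t - a) / r by apply: divr_ge0; [rewrite subr_ge0 | apply: ltW].
have /andP[] := truncn_itv hs; have /andP[] := truncn_itv ht; rewrite E.
set k := Num.truncn _ => a1 a2 a3 a4; move: a1 a2 a3 a4.
rewrite !ler_pdivlMr// !ltr_pdivrMr// -natr1 => a1 a2 a3 a4.
by rewrite ltr_norml; apply/andP; split; lra.
Qed.

Lemma cell_bound (a b r s : R) : 0 < r -> a <= s -> s <= b ->
  (Num.truncn ((s - a) / r) < (Num.truncn ((b - a) / r)).+1)%N.
Proof.
move=> r0 as_ sb; rewrite ltnS; apply: le_truncn.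
by rewrite ler_pM2r ?invr_gt0// lerD2r.
Qed.

End FiniteKey.

Section ExtremaCoding.
Variables (R : realType) (L : signature) (M : expansion R L).
Variables (phi : R -> R) (V : set R) (al be : R).
Hypothesis vs : value_system M phi V.
Hypothesis V4 : forall w : R, -4 < w -> w < 4 -> V w.
Hypothesis albe : al < be.
Hypothesis phi_cont : forall x : R, {for x, continuous phi}.
Hypothesis phi_onto : forall w : R, 0 <= w <= 1 ->
  exists s, [/\ al <= s, s <= be & phi s = w].
Hypothesis phi_ninj : forall u v, al <= u -> u < v -> v <= be ->
  exists x y, [/\ u <= x, x < y, y <= v & phi x = phi y].

Let top_of_level s := (al <= s /\ s <= be) /\ (0 <= phi s /\ phi s <= 1) /\
  forall t, al <= t -> t <= be -> phi t = phi s -> t <= s.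

Let extremum r s := (al <= s /\ s <= be) /\
  ((forall t, al <= t -> t <= be -> s - r < t -> t < s + r -> phi t <= phi s) \/
   (forall t, al <= t -> t <= be -> s - r < t -> t < s + r -> phi s <= phi t)).

Lemma level_top w : 0 <= w <= 1 -> exists s, top_of_level s /\ phi s = w.
Proof.
move=> w01; have [s0 [as0 sb0 ws]] := phi_onto w01.
pose S := [set s : R | (al <= s /\ s <= be) /\ phi s = w].
have supS : has_sup S by split; [exists s0 | exists be => s [[]]].
pose u := sup S.
have au : al <= u by apply: (le_trans as0); apply: (sup_upper_bound supS).
have ub : u <= be by apply: ge_sup; [exact: supS.1 | move=> s [[]]].
have uw : phi u = w.
  apply: contrapT => nw; have e0 : 0 < `|w - phi u|.
    by rewrite normr_gt0 subr_eq0; apply/eqP => E; apply: nw.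
  have [d [d0 Hd]] := cont_eps (@phi_cont u) e0.
  have [s Ss] := sup_adherent d0 supS; rewrite -/u => us.
  have su : s <= u by apply: (sup_upper_bound supS).
  have := Hd s; rewrite Ss.2 ltxx; suff -> : `|s - u| < d by move=> /(_ isT).
  by rewrite ltr_norml; apply/andP; split; lra.
exists u; split=> //; split=> //; split; first by rewrite uw; apply/andP.
by move=> t at_ tb; rewrite uw => tw; apply: (sup_upper_bound supS).
Qed.

Lemma extremum_finite r : 0 < r -> finite_set (phi @` extremum r).
Proof.
move=> r0.
pose A := [set s : R | (al <= s /\ s <= be) /\
  forall t, al <= t -> t <= be -> s - r < t -> t < s + r -> phi t <= phi s].
pose B := [set s : R | (al <= s /\ s <= be) /\
  forall t, al <= t -> t <= be -> s - r < t -> t < s + r -> phi s <= phi t].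
have -> : phi @` extremum r = phi @` A `|` phi @` B.
  apply/seteqP; split=> [_ [s [sab [H|H]] <-]|_ [[s [sab H] <-]|[s [sab H] <-]]].
  - by left; exists s.
  - by right; exists s.
  - by exists s => //; split=> //; left.
  - by exists s => //; split=> //; right.
rewrite finite_setU; split.
  apply: (finite_key (key := fun s => Num.truncn ((s - al) / r))
    (n := (Num.truncn ((be - al) / r)).+1)).
    by move=> s [[a b] _]; apply: cell_bound.
  move=> s t [[a b] Hs] [[a' b'] Ht] /(same_cell r0 a a'); rewrite ltr_norml => /andP[? ?].
  by apply/eqP; rewrite eq_le; apply/andP; split; [apply: Ht | apply: Hs]; lra.
apply: (finite_key (key := fun s => Num.truncn ((s - al) / r))
  (n := (Num.truncn ((be - al) / r)).+1)).
  by move=> s [[a b] _]; apply: cell_bound.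
move=> s t [[a b] Hs] [[a' b'] Ht] /(same_cell r0 a a'); rewrite ltr_norml => /andP[? ?].
by apply/eqP; rewrite eq_le; apply/andP; split; [apply: Hs | apply: Ht]; lra.
Qed.

Lemma local_extremum x y : al <= x -> x < y -> y <= be -> phi x = phi y ->
  exists r s, [/\ 0 < r, extremum r s, x <= s & s <= y].
Proof.
move=> ax xy yb E.
have cw : {within `[x, y], continuous phi}.
  by apply: continuous_subspaceT => z; apply: phi_cont.
have [c cxy Hc] := EVT_max (ltW xy) cw.
have [d dxy Hd] := EVT_min (ltW xy) cw.
have inI t : x <= t -> t <= y -> t \in `[x, y] by move=> ? ?; rewrite in_itv /=; apply/andP.
move: cxy dxy; rewrite !in_itv /= => /andP[xc cy] /andP[xd dy].
have [cE|cN] := eqVneq (phi c) (phi x); last first.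
  have xc' : x < c by rewrite lt_neqAle xc andbT; apply/eqP => e; move: cN; rewrite e eqxx.
  have cy' : c < y by rewrite lt_neqAle cy andbT; apply/eqP => e; move: cN; rewrite E e eqxx.
  exists (Num.min (c - x) (y - c)), c; split=> //; first by rewrite lt_min !subr_gt0 xc'.
  split; first by split; lra.
  left=> t _ _ l1 l2; apply: Hc; apply: inI.
    have : Num.min (c - x) (y - c) <= c - x by rewrite ge_min lexx.
    lra.
  have : Num.min (c - x) (y - c) <= y - c by rewrite ge_min lexx orbT.
  lra.
have [dE|dN] := eqVneq (phi d) (phi x); last first.
  have xd' : x < d by rewrite lt_neqAle xd andbT; apply/eqP => e; move: dN; rewrite e eqxx.
  have dy' : d < y by rewrite lt_neqAle dy andbT; apply/eqP => e; move: dN; rewrite E e eqxx.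
  exists (Num.min (d - x) (y - d)), d; split=> //; first by rewrite lt_min !subr_gt0 xd'.
  split; first by split; lra.
  right=> t _ _ l1 l2; apply: Hd; apply: inI.
    have : Num.min (d - x) (y - d) <= d - x by rewrite ge_min lexx.
    lra.
  have : Num.min (d - x) (y - d) <= y - d by rewrite ge_min lexx orbT.
  lra.
exists ((y - x) / 2), ((x + y) / 2); split; try lra.
split; first by split; lra.
left=> t _ _ l1 l2.
have h1 : phi t <= phi x by rewrite -cE; apply: Hc; apply: inI; lra.
have h2 : phi x <= phi ((x + y) / 2) by rewrite -dE; apply: Hd; apply: inI; lra.
exact: le_trans h1 h2.
Qed.

Theorem extrema_coding_PN : defines_copy_PN M.
Proof.
have dle i j : Def M (fun v => phi (v i) <= phi (v j)).
  by apply: (Def_lev vs); exact: DT_var.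
have [z0 [_ _ z0E]] : exists s, [/\ al <= s, s <= be & phi s = 0].
  by apply: phi_onto; rewrite lexx ler01.
have [z1 [_ _ z1E]] : exists s, [/\ al <= s, s <= be & phi s = 1].
  by apply: phi_onto; rewrite ler01 lexx.
apply: (@value_coding_PN _ _ _ phi V vs V4 top_of_level extremum) => //.
- rewrite /top_of_level; apply: Def_and; first by def_tac.
  apply: Def_and.
    rewrite -z0E -z1E.
    by apply: Def_and; apply: (Def_lev vs); first [exact: DT_var | exact: DT_const].
  apply: Def_all; def_beta.
  apply: Def_imp; first by def_tac.
  apply: Def_imp; first by def_tac.
  by apply: Def_imp; [apply: (Def_eqv vs); exact: DT_var | def_tac].
- by move=> s [_ [[a b] _]]; apply/andP.
- exact: level_top.
- move=> s t [[a b] [_ Hs]] [[a' b'] [_ Ht]] E.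
  by apply/eqP; rewrite eq_le; apply/andP; split; [apply: Ht | apply: Hs].
- rewrite /extremum; apply: Def_and; first by def_tac.
  apply: Def_or; apply: Def_all; def_beta.
    do 4 (apply: Def_imp; first by def_tac).
    exact: dle.
  do 4 (apply: Def_imp; first by def_tac).
  exact: dle.
- move=> r r' s r0 rr [sab H]; split=> //.
  case: H => H; [left|right]; move=> t a b c d; apply: H => //; lra.
- exact: extremum_finite.
move=> u v u0 uv v1.
have [|s [s1 s2 sE]] := @phi_onto u; first by apply/andP; split; lra.
have [|t [t1 t2 tE]] := @phi_onto v; first by apply/andP; split; lra.
have [|u1 [u2 [h1 h2 h3 h4 _]]] := rise_or_fall phi_cont s1 s2 t1 t2; first by rewrite sE tE.
have [x [y [x1 xy y2 xyE]]] := phi_ninj h1 h2 h3.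
have [||r [w [r0 Ew xw wy]]] := local_extremum _ xy _ xyE; try lra.
exists r, w; split=> //; rewrite -sE -tE; apply: h4; lra.
Qed.

End ExtremaCoding.

Lemma Def_op1 (R : realType) (L : signature) (M : expansion R L)
    (I : set R) (op : R -> R -> R) :
  Def M (fun v => (I (v 0%N) /\ I (v 1%N)) /\ v 2%N = op (v 0%N) (v 1%N)) <->
  definable_op1 M I op.
Proof.
have E v : [set \row_(i < 3) [:: x; y; op x y]`_i | x in I & y in I] (env 3 v) <->
    (I (v 0%N) /\ I (v 1%N)) /\ v 2%N = op (v 0%N) (v 1%N).
  split=> [[x Ix [y Iy /rowP H]]|[[I0 I1] v2]].
    have := H (inord 0); have := H (inord 1); have := H (inord 2).
    by rewrite !mxE !inordK//= => <- <- <-.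
  exists (v 0%N) => //; exists (v 1%N) => //; rewrite -v2.
  by apply/rowP => -[[|[|[|i]]] lti] //; rewrite !mxE.
split=> [H|/definable_Def]; last by apply: Def_ext.
by apply: Def_definable; apply: Def_ext H => v; apply: iff_sym.
Qed.

Lemma Def_fun1 (R : realType) (L : signature) (M : expansion R L)
    (I : set R) (f : R -> R) :
  Def M (fun v => I (v 0%N) /\ v 1%N = f (v 0%N)) <-> definable_fun1 M I f.
Proof.
have E v : [set \row_(i < 2) [:: x; f x]`_i | x in I] (env 2 v) <->
    I (v 0%N) /\ v 1%N = f (v 0%N).
  split=> [[x Ix /rowP H]|[I0 v1]].
    have := H (inord 0); have := H (inord 1).
    by rewrite !mxE !inordK//= => <- <-.
  exists (v 0%N) => //; rewrite -v1.
  by apply/rowP => -[[|[|i]] lti] //; rewrite !mxE.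
split=> [H|/definable_Def]; last by apply: Def_ext.
by apply: Def_definable; apply: Def_ext H => v; apply: iff_sym.
Qed.

(** * From a function to a field *)

Section MonotoneField.
Variables (R : realType) (L : signature) (M : expansion R L).
Variables (phi : R -> R) (V : set R) (al be : R).
Hypothesis vs : value_system M phi V.
Hypothesis V4 : forall w : R, -4 < w -> w < 4 -> V w.
Hypothesis phi_inc : forall x y, al <= x -> x < y -> y <= be -> phi x < phi y.
Hypothesis phi_onto : forall w : R, -1 <= w <= 1 ->
  exists s, [/\ al <= s, s <= be & phi s = w].

Let stretch (c : R) := c / (1 - `|c|).
Let shrink (w : R) := w / (1 + `|w|).

Lemma shrink_bounds w : -1 < shrink w < 1.
Proof.
rewrite -ltr_norml /shrink normrM normfV.
have w0 : 0 < 1 + `|w| by rewrite ltr_pwDl.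
by rewrite (gtr0_norm w0) ltr_pdivrMr// mul1r ltrDr.
Qed.

Lemma shrinkK w : stretch (shrink w) = w.
Proof.
have w0 : 0 < 1 + `|w| by rewrite ltr_pwDl.
rewrite /stretch /shrink normrM normfV (gtr0_norm w0).
have -> : 1 - `|w| / (1 + `|w|) = (1 + `|w|)^-1 by field; rewrite gt_eqF.
by rewrite invrK divfK// gt_eqF.
Qed.

Lemma stretch_lt c d : -1 < c < 1 -> -1 < d < 1 -> c < d -> stretch c < stretch d.
Proof.
rewrite -!ltr_norml => c1 d1 cd.
rewrite /stretch ltr_pdivrMr ?subr_gt0// mulrAC ltr_pdivlMr ?subr_gt0//.
have [c0|c0] := ger0P c; have [d0|d0] := ger0P d.
- by lra.
- by lra.
- move: c1 d1; rewrite !ltr_norml => /andP[c1 _] /andP[_ d1].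
  have : 0 < - c * (1 - d) by rewrite mulr_gt0// ?oppr_gt0// subr_gt0.
  have : 0 <= d * (1 - - c) by rewrite mulr_ge0// opprK; lra.
  by lra.
- by lra.
Qed.

Theorem monotone_field : field_type M.
Proof.
have [|a [ala abe aE]] := @phi_onto (-1); first by rewrite lexx; lra.
have [|b [alb bbe bE]] := @phi_onto 1; first by rewrite lexx andbT; lra.
have inc x y : al <= x -> x < y -> y <= be -> phi x < phi y := @phi_inc x y.
have incW x y : al <= x -> x <= y -> y <= be -> phi x <= phi y.
  by move=> h; rewrite le_eqVlt => /orP[/eqP->//|lt] h'; apply/ltW/inc.
have refl_lt x y : al <= x -> x <= be -> al <= y -> y <= be -> phi x < phi y -> x < y.
  move=> x1 x2 y1 y2 xy; rewrite ltNge; apply/negP => yx.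
  by move: xy; rewrite ltNge (incW y x).
have ab : a < b by apply: refl_lt => //; rewrite aE bE; lra.
pose I := [set x : R | a < x < b].
have Ib x : I x -> al <= x /\ x <= be by move=> /andP[? ?]; split; lra.
have I1 x : I x -> -1 < phi x < 1.
  move=> Ix; have [? ?] := Ib x Ix; move: Ix => /andP[ax xb].
  by rewrite -aE -bE; apply/andP; split; apply: inc.
have [g Hg] : {g : R -> R & forall c, -1 < c < 1 -> I (g c) /\ phi (g c) = c}.
  apply: (@choice _ _ (fun c s => -1 < c < 1 -> I s /\ phi s = c)) => c.
  have [c1|nc] := pselect (-1 < c < 1); last by exists 0.
  have /andP[c0 c2] := c1; have [|s [s1 s2 sE]] := @phi_onto c.
    by apply/andP; split; lra.
  exists s => _; split=> //; apply/andP; split; apply: refl_lt => //.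
    by rewrite aE sE.
  by rewrite bE sE.
pose theta x := stretch (phi x).
pose op (h : R -> R -> R) x y := g (shrink (h (theta x) (theta y))).
have gphi c : I (g (shrink c)) /\ theta (g (shrink c)) = c.
  by have [Ig E] := Hg _ (shrink_bounds c); rewrite /theta E shrinkK.
have theta_lt x y : I x -> I y -> (x < y <-> theta x < theta y).
  move=> Ix Iy; have [x1 x2] := Ib x Ix; have [y1 y2] := Ib y Iy.
  have mono u w : I u -> I w -> al <= u -> w <= be -> u < w -> theta u < theta w.
    by move=> Iu Iw u1 w2 uw; apply: stretch_lt; [exact: I1|exact: I1|exact: inc].
  split; first by apply: mono.
  move=> lt; rewrite ltNge; apply/negP; rewrite le_eqVlt => /orP[/eqP E|yx].
    by move: lt; rewrite E ltxx.
  by have := mono _ _ Iy Ix y1 x2 yx; rewrite ltNge ltW.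
have theta_inj x y : I x -> I y -> theta x = theta y -> x = y.
  move=> Ix Iy E; case: (ltgtP x y) => // /theta_lt.
    by move=> /(_ Ix Iy); rewrite E ltxx.
  by move=> /(_ Iy Ix); rewrite E ltxx.
have opI h x y : I (op h x y) by exact: (gphi _).1.
have opE h x y : theta (op h x y) = h (theta x) (theta y) by exact: (gphi _).2.
pose c (v : nat -> R) i := phi (Num.max a (Num.min (v i) b)).
have cE v i : I (v i) -> c v i = phi (v i).
  by move=> /andP[/ltW h1 /ltW h2]; rewrite /c (min_idPl h2) (max_idPr h1).
have c1 v i : -1 <= c v i /\ c v i <= 1.
  have h1 : a <= Num.max a (Num.min (v i) b) by rewrite le_max lexx.
  have h2 : Num.max a (Num.min (v i) b) <= b by rewrite ge_max ltW// ge_min lexx orbT.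
  by rewrite -aE -bE; split; apply: incW => //; [exact: le_trans h2 bbe|exact: le_trans h1].
have dc i : DV M phi V (fun v => c v i).
  apply: (DV_phi vs) => [v|].
    by have [? ?] := c1 v i; apply: V4; rewrite -/(c v i); lra.
  by def_tac.
pose d (v : nat -> R) i := 1 - Num.max (c v i) (- c v i).
have d1 v i : 0 <= d v i /\ d v i <= 1.
  have [h1 h2] := c1 v i; rewrite /d /Num.max; case: ifP; first by move=> ?; split; lra.
  by move=> /negbT; rewrite -leNgt => ?; split; lra.
have dd i : DV M phi V (fun v => d v i).
  have m1 : V (-1) by apply: V4; lra.
  have dN : DV M phi V (fun v => - c v i).
    by apply: (DV_opp vs) => // v; have [? ?] := c1 v i; apply: V4; lra.
  apply: (DV_add vs (t := fun=> 1)); first by apply: (DV_const vs); apply: V4; lra.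
    apply: (DV_opp vs) => //; first exact: (DV_max vs).
    by move=> v; have := d1 v i; rewrite /d => -[? ?]; apply: V4; lra.
  by move=> v; have [? ?] := d1 v i; apply: V4; rewrite -/(d v i); lra.
have dE v i : I (v i) -> d v i = 1 - `|phi (v i)|.
  move=> Ii; rewrite /d cE//; congr (1 - _).
  by have [h|h] := ger0P (phi (v i)); [apply/max_idPl | apply/max_idPr]; lra.
have dpos v i : I (v i) -> 0 < d v i.
  by move=> Ii; rewrite dE// subr_gt0 ltr_norml; apply: I1.
have dn0 v i : I (v i) -> d v i != 0 by move=> /dpos h; rewrite gt_eqF.
have tE v i : I (v i) -> theta (v i) = c v i / d v i.
  by move=> Ii; rewrite cE// dE.
have mul1 (x y : R) : -1 <= x /\ x <= 1 -> -1 <= y /\ y <= 1 -> -1 <= x * y /\ x * y <= 1.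
  move=> [x1 x2] [y1 y2]; have : `|x * y| <= 1.
    by rewrite normrM mulr_ile1// ler_norml; apply/andP.
  by rewrite ler_norml => /andP.
have d11 v i : -1 <= d v i /\ d v i <= 1 by have [? ?] := d1 v i; split; lra.
have dvm t u : (forall v, -1 <= t v /\ t v <= 1) -> (forall v, -1 <= u v /\ u v <= 1) ->
    DV M phi V t -> DV M phi V u -> DV M phi V (fun v => t v * u v).
  move=> t1 u1 dt du; apply: (DV_mul vs) => // v.
  by have [? ?] := mul1 _ _ (t1 v) (u1 v); apply: V4; lra.
have dI i : Def M (fun v => I (v i)).
  apply: (@Def_ext _ _ _ (fun v => a < v i /\ v i < b)); last by def_tac.
  by move=> v; split=> [[? ?]|/andP//]; apply/andP.
have dop h : Def M (fun v => I (v 0%N) /\ I (v 1%N) /\ I (v 2%N) /\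
    theta (v 2%N) = h (theta (v 0%N)) (theta (v 1%N))) -> definable_op1 M I (op h).
  move=> dh; apply/Def_op1; apply: Def_ext dh => v; split.
    move=> [I0 [I1' [I2 E]]]; split=> //; apply: theta_inj => //.
    by rewrite opE.
  by move=> [[I0 I1'] ->]; rewrite opE; do !split=> //.
exists a, b, (op +%R), (op *%R); rewrite /= set_itvoo -/I; split=> //.
- by split=> x y _ _; apply: opI.
- apply: dop; apply: (@Def_ext _ _ _ (fun v => I (v 0%N) /\ I (v 1%N) /\ I (v 2%N) /\
    c v 2%N * (d v 0%N * d v 1%N) =
    c v 0%N * (d v 1%N * d v 2%N) + c v 1%N * (d v 0%N * d v 2%N))).
    move=> v; split=> -[I0 [I1' [I2 E]]]; do 3 split=> //.
      have n01 := mulf_neq0 (dn0 _ _ I0) (dn0 _ _ I1').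
      rewrite !tE// (addf_div _ _ (dn0 _ _ I0) (dn0 _ _ I1')).
      by apply/eqP; rewrite (eqr_div _ _ (dn0 _ _ I2) n01) E; apply/eqP; ring.
    have n01 := mulf_neq0 (dn0 _ _ I0) (dn0 _ _ I1').
    move/eqP: E; rewrite !tE// (addf_div _ _ (dn0 _ _ I0) (dn0 _ _ I1')).
    by rewrite (eqr_div _ _ (dn0 _ _ I2) n01) => /eqP ->; ring.
  def_ands; [exact: dI..|].
  apply: (Def_eqV vs).
    by apply: (dvm _ _) => //; [move=> v; apply: mul1|apply: (dvm _ _)].
  have m2 i j k : DV M phi V (fun v => c v i * (d v j * d v k)).
    by apply: (dvm _ _) => //; [move=> v; apply: mul1|apply: (dvm _ _)].
  apply: (DV_add vs) => // v.
  have [? ?] := mul1 _ _ (c1 v 0%N) (mul1 _ _ (d11 v 1%N) (d11 v 2%N)).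
  have [? ?] := mul1 _ _ (c1 v 1%N) (mul1 _ _ (d11 v 0%N) (d11 v 2%N)).
  by apply: V4; lra.
- apply: dop; apply: (@Def_ext _ _ _ (fun v => I (v 0%N) /\ I (v 1%N) /\ I (v 2%N) /\
    c v 2%N * (d v 0%N * d v 1%N) = (c v 0%N * c v 1%N) * d v 2%N)).
    move=> v; split=> -[I0 [I1' [I2 E]]]; do 3 split=> //.
      have n01 := mulf_neq0 (dn0 _ _ I0) (dn0 _ _ I1').
      by rewrite !tE// mulf_div; apply/eqP; rewrite (eqr_div _ _ (dn0 _ _ I2) n01) E.
    have n01 := mulf_neq0 (dn0 _ _ I0) (dn0 _ _ I1').
    move/eqP: E; rewrite !tE// mulf_div.
    by rewrite (eqr_div _ _ (dn0 _ _ I2) n01) => /eqP ->.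
  def_ands; [exact: dI..|].
  apply: (Def_eqV vs).
    by apply: (dvm _ _) => //; [move=> v; apply: mul1|apply: (dvm _ _)].
  by apply: (dvm _ _) => //; [move=> v; apply: mul1|apply: (dvm _ _)].
exists theta; split.
- split=> //.
    by move=> x y /set_mem Ix /set_mem Iy; apply: theta_inj.
  by move=> w _; exists (g (shrink w)); have [] := gphi w.
- by move=> x y /set_mem Ix /set_mem Iy; apply: theta_lt.
- by move=> x y _ _; rewrite opE.
- by move=> x y _ _; rewrite opE.
Qed.

End MonotoneField.

Lemma integer_rescaling (R : realType) (g1 g2 : R) : g1 < g2 ->
  exists (n : nat) (m : int), [/\ (0 < n)%N, n%:R * g1 - m%:~R <= - 4 &
    4 <= n%:R * g2 - m%:~R].
Proof.
rewrite -subr_gt0 => d0; pose n := (Num.truncn (10 / (g2 - g1))).+1.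
have nd : 10 < n%:R * (g2 - g1) by rewrite -ltr_pdivrMr//; apply: truncnS_gt.
pose m := (Num.floor (n%:R * g1 + 4) + 1)%R.
have c1 : n%:R * g1 + 4 < m%:~R by apply: floorD1_gt.
have c2 : m%:~R <= n%:R * g1 + 4 + 1 by rewrite /m intrD lerD2r; apply: floor_le.
by exists n, m; rewrite mulrBr in nd; split=> //; lra.
Qed.

Lemma unit_slope (R : realType) (w : R) : -1 <= w <= 1 -> -4 <= w <= 4.
Proof. by move=> /andP[? ?]; apply/andP; split; lra. Qed.

Section FieldFromFunction.
Variables (R : realType) (L : signature) (M : expansion R L).
Variables (f : R -> R) (a b : R).
Hypothesis Def_f : definable_fun1 M `]a, b[%classic f.
Hypothesis f_C1 : C1_on `]a, b[%classic f.

Lemma C1_derivable x : a < x -> x < b -> derivable f x 1.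
Proof.
move=> ax xb; have [|//] := f_C1 (x := x).
by apply/mem_set; rewrite /= in_itv /= ax.
Qed.

Lemma C1_continuous (x : R) : a < x -> x < b -> {for x, continuous (derive1 f)}.
Proof.
move=> ax xb; have [|//] := f_C1 (x := x).
by apply/mem_set; rewrite /= in_itv /= ax.
Qed.

Lemma affine_of_constant_slope :
  (forall x y, a < x -> x < y -> y < b -> derive1 f x = derive1 f y) ->
  affine_on `]a, b[%classic f.
Proof.
move=> cst.
have same x y : a < x -> x < b -> a < y -> y < b -> derive1 f x = derive1 f y.
  move=> ax xb ay yb; case: (ltgtP x y) => [xy|yx|->//]; first exact: cst.
  exact/esym/cst.
have lin x y : a < x -> x < y -> y < b -> f y - f x = derive1 f x * (y - x).
  move=> ax xy yb.
  have [|||z zxy ->] := @MVT R f (derive1 f) x y.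
  - exact: xy.
  - move=> z; rewrite in_itv /= => /andP[xz zy].
    by rewrite derive1E; apply: DeriveDef; last by []; apply: C1_derivable; lra.
  - apply: derivable_within_continuous => z; rewrite in_itv /= => /andP[xz zy].
    by apply: C1_derivable; lra.
  move: zxy; rewrite in_itv /= => /andP[xz zy].
  by congr (_ * _); apply: same; lra.
pose m := (a + b) / 2; pose k := derive1 f m.
exists k, (f m - k * m) => x /set_mem; rewrite /= in_itv /= => /andP[ax xb].
have am : a < m by rewrite /m; lra.
have mb : m < b by rewrite /m; lra.
case: (ltgtP x m) => [xm|mx|->]; last by ring.
  by have := lin _ _ ax xm mb; rewrite (same x m)// -/k; lra.
by have := lin _ _ am mx xb; rewrite -/k; lra.
Qed.

(* Slopes are only comparable within a bounded range, and the only available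
   rescalings are by integers: [n f - m x] has slopes covering [-4, 4]. *)
Lemma slope_normalization al be t1 t2 : a < al -> al < be -> be < b ->
  al <= t1 -> t1 <= be -> al <= t2 -> t2 <= be -> derive1 f t1 < derive1 f t2 ->
  exists F (n : nat) (c : R), (0 < n)%N /\
    value_system M (gslope F al be) (slopes 4) /\
    (forall x : R, {for x, continuous (gslope F al be)}) /\
    (forall x, al <= x -> x <= be -> gslope F al be x = n%:R * derive1 f x - c) /\
    forall w, -4 <= w <= 4 ->
      exists s, [/\ al <= s, s <= be & gslope F al be s = w].
Proof.
move=> aal albe beb at1 t1b at2 t2b g12.
pose A := (a + al) / 2; pose B := (be + b) / 2.
have [aA Aal beB Bb] : [/\ a < A, A < al, be < B & B < b].
  by rewrite /A /B; split; lra.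
have [n [m [n0 low_slope high_slope]]] := integer_rescaling g12.
pose c : R := m%:~R.
pose F x := f (Num.max A (Num.min x B)) *+ n - x *~ m.
have AB : A < B by lra.
have clE x : A < x -> x < B -> Num.max A (Num.min x B) = x.
  by move=> h1 h2; rewrite (min_idPl (ltW h2)) (max_idPr (ltW h1)).
have isd x : A < x -> x < B -> is_derive x (1 : R) F (n%:R * derive1 f x - c).
  move=> Ax xB.
  have df : is_derive x (1 : R) f (derive1 f x).
    by rewrite derive1E; apply: DeriveDef; last by []; apply: C1_derivable; lra.
  have dh : is_derive x (1 : R) (fun y => n%:R * f y - c * y) (n%:R * derive1 f x - c).
    have := is_deriveB (is_deriveZ n%:R df) (is_deriveZ c (is_derive_id x (1 : R))).
    by move=> /is_derive_eq; apply; rewrite /GRing.scale /= mulr1.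
  have near_F : \forall y \near x, n%:R * f y - c * y = F y.
    near=> y; rewrite /F clE; last 2 first.
    - by near: y; apply: lt_nbhsr.
    - by near: y; apply: lt_nbhsl.
    by rewrite mulr_natl -mulrzl.
  apply: DeriveDef; first by apply: near_eq_derivable near_F _; case: dh.
  by rewrite -(@near_eq_derive _ _ _ _ _ _ (1 : R) near_F); case: dh.
have dF x : A < x -> x < B -> derive1 F x = n%:R * derive1 f x - c.
  by move=> h1 h2; rewrite derive1E; case: (isd x h1 h2).
have Fd x : A < x -> x < B -> derivable F x 1.
  by move=> h1 h2; case: (isd x h1 h2).
have Fc (x : R) : A < x -> x < B -> {for x, continuous (derive1 F)}.
  move=> Ax xB; apply: (continuous_congr Ax xB dF); apply: cvgB; last exact: cvg_cst.
  apply: cvgM; first exact: cvg_cst.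
  by apply: C1_continuous; [exact: lt_trans Ax | exact: lt_trans Bb].
have DF : Def M (fun v => v 0%N = F (v 1%N)).
  have H := (Def_fun1 M `]a, b[%classic f).2 Def_f.
  have dcl : DT M (fun v => f (Num.max A (Num.min (v 0%N) B))).
    apply: Def_ext (Def2 (Q := fun x y => `]a, b[%classic x /\ y = f x) H
      (t := fun v => Num.max A (Num.min (v 1%N) B)) (u := fun v => v 0%N) _ _);
      [|by def_tac|by def_tac].
    move=> v; split=> [[]//|E]; split=> //=; rewrite in_itv /=.
    rewrite lt_max aA /= gt_max gt_min Bb orbT andbT; lra.
  have dm : DT M (fun v => v 0%N *~ m).
    by case: m {c low_slope high_slope F isd dF Fd Fc} => k; rewrite /intmul; def_tac.
  apply: (@DT_add _ _ _ (fun v => f (Num.max A (Num.min (v 0%N) B)) *+ n)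
    (fun v => - (v 0%N *~ m))); last exact: DT_opp.
  exact: DT_muln.
have inAB x : al <= x -> x <= be -> A < x /\ x < B.
  by move=> h1 h2; split; [exact: lt_le_trans h1 | exact: le_lt_trans beB].
have gF x : al <= x -> x <= be -> derive1 F x = n%:R * derive1 f x - c.
  by move=> h1 h2; have [? ?] := inAB x h1 h2; apply: dF.
have low : exists t, [/\ al <= t, t <= be & derive1 F t <= - 4].
  by exists t1; rewrite gF.
have high : exists t, [/\ al <= t, t <= be & 4 <= derive1 F t].
  by exists t2; rewrite gF.
have K0 : 0 < 4 :> R by [].
exists F, n, c; split=> //; split.
  exact: (slope_system Aal albe beB DF Fd Fc K0 low high).
have gc := gslope_cont Aal albe beB Fc.
have gE x : al <= x -> x <= be -> gslope F al be x = n%:R * derive1 f x - c.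
  by move=> h1 h2; rewrite /gslope clamp_id// gF.
split=> //; split=> // w /andP[w1 w2].
have [s sE] := gslope_ex Aal albe beB Fc low high w1 w2.
exists (clamp al be s); split; [exact: clamp_ge|exact: clamp_le|].
by rewrite /gslope clampK.
Unshelve. all: by end_near. Qed.

Lemma slope_order u v : a < u -> u < v -> v < b -> derive1 f u <> derive1 f v ->
  exists t1 t2, [/\ u <= t1, t1 <= v, u <= t2, t2 <= v & derive1 f t1 < derive1 f t2].
Proof.
move=> au uv vb; case: (ltgtP (derive1 f u) (derive1 f v)) => // lt _.
  by exists u, v; split=> //; exact: ltW.
by exists v, u; split=> //; exact: ltW.
Qed.

Lemma nowhere_injective_PN : a < b -> ~ affine_on `]a, b[%classic f ->
  (forall u v, a < u -> u < v -> v < b ->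
     exists x y, [/\ u <= x, x < y, y <= v & derive1 f x = derive1 f y]) ->
  defines_copy_PN M.
Proof.
move=> ab naff ninj.
have [c [d [ac cd db gcd]]] : exists c d, [/\ a < c, c < d, d < b &
    derive1 f c <> derive1 f d].
  apply: contrapT => H; apply: naff; apply: affine_of_constant_slope => x y ax xy yb.
  by apply: contrapT => E; apply: H; exists x, y.
have [t1 [t2 [h1 h2 h3 h4 h5]]] := slope_order ac cd db gcd.
have [F [n [k [n0 [vs [gc [gE onto]]]]]]] := slope_normalization ac cd db h1 h2 h3 h4 h5.
apply: (@extrema_coding_PN _ _ _ _ _ c d vs) => //.
- by move=> w w1 w2; apply/andP.
- move=> w /andP[w1 w2]; apply/onto/unit_slope; rewrite w2 andbT.
  by apply: le_trans w1; rewrite oppr_le0.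
move=> u v cu uv vd.
have [x [y [ux xy yv E]]] := ninj u v (lt_le_trans ac cu) uv (le_lt_trans vd db).
have [cx yd] := (le_trans cu ux, le_trans yv vd).
exists x, y; split=> //; rewrite !gE ?E//; first exact: le_trans cx (ltW xy).
exact: le_trans (ltW xy) yd.
Qed.

Lemma increasing_slope_field u v : a < u -> u < v -> v < b ->
  (forall x y, u <= x -> x < y -> y <= v -> derive1 f x < derive1 f y) ->
  field_type M.
Proof.
move=> au uv vb inc.
have guv : derive1 f u < derive1 f v by apply: inc.
have [F [n [k [n0 [vs [gc [gE onto]]]]]]] :=
  slope_normalization au uv vb (lexx u) (ltW uv) (ltW uv) (lexx v) guv.
apply: (@monotone_field _ _ _ _ _ u v vs) => //.
- by move=> w w1 w2; apply/andP.
- move=> x y ux xy yv; have xv := le_trans (ltW xy) yv.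
  rewrite !gE// ?(le_trans ux (ltW xy))//.
  by rewrite ltrD2r ltr_pM2l ?ltr0n//; apply: inc.
- by move=> w w1; apply/onto/unit_slope.
Qed.

End FieldFromFunction.

Theorem field_of_function (R : realType) (L : signature) (M : expansion R L)
    (f : R -> R) (a b : R) :
  ~ defines_copy_PN M -> a < b -> definable_fun1 M `]a, b[%classic f ->
  C1_on `]a, b[%classic f -> ~ affine_on `]a, b[%classic f -> field_type M.
Proof.
move=> noPN ab Df Cf naff.
have [[u [v [au uv vb inj]]]|ninj] := pselect (exists u v, [/\ a < u, u < v, v < b &
    forall x y, u <= x -> x < y -> y <= v -> derive1 f x <> derive1 f y]); last first.
  exfalso; apply: noPN; apply: (nowhere_injective_PN Df Cf) => // u v au uv vb.
  apply: contrapT => H; apply: ninj; exists u, v; split=> // x y ux xy yv E.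
  by apply: H; exists x, y.
have cont : {within [set` `[u, v]], continuous (derive1 f)}.
  apply: continuous_in_subspaceT => x /set_mem; rewrite /= in_itv /= => /andP[ux xv].
  by apply: (C1_continuous Cf); lra.
have injI : {in `[u, v] &, injective (derive1 f)}.
  move=> x y; rewrite !in_itv /= => /andP[ux xv] /andP[uy yv] E.
  by case: (ltgtP x y) => // lt; exfalso; [apply: (inj x y)|apply: (inj y x)].
have inI x : u <= x -> x <= v -> x \in `[u, v] by move=> ? ?; rewrite in_itv /=; apply/andP.
have [mono|mono] := itv_continuous_inj_mono cont injI.
  apply: (increasing_slope_field Df Cf au uv vb) => x y ux xy yv.
  by apply: mono => //; apply: inI => //; [exact: le_trans (ltW xy) yv | exact: le_trans ux (ltW xy)].
have Cd x : a < x -> x < b -> derivable f x 1 by apply: (C1_derivable Cf).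
have dN x : a < x -> x < b -> derive1 (fun y => - f y) x = - derive1 f x.
  by move=> ax xb; rewrite !derive1E deriveN//; apply: Cd.
apply: (@increasing_slope_field _ _ M (fun y => - f y) a b _ _ u v _ uv) => [||//|//|].
- apply/Def_fun1; move/Def_fun1: Df => Df.
  apply: (@Def_ext _ _ _ (fun v => exists y, (`]a, b[%classic (v 0%N) /\ y = f (v 0%N)) /\
    v 1%N = - y)).
    move=> w; split=> [[y [[Iw ->] ->]]//|[Iw ->]].
    by exists (f (w 0%N)).
  apply: Def_ex; def_beta; apply: Def_and; last by def_tac.
  exact: (Def2 (Q := fun x y => `]a, b[%classic x /\ y = f x) Df (DT_var _ _) (DT_var _ _)).
- move=> x /set_mem; rewrite /= in_itv /= => /andP[ax xb]; split.
    by apply: derivableN; apply: Cd.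
  apply: (continuous_congr ax xb dN); apply: cvgN.
  exact: (C1_continuous Cf ax xb).
- move=> x y ux xy yv; have [uy xv] := (le_trans ux (ltW xy), le_trans (ltW xy) yv).
  have [ax yb] := (lt_le_trans au ux, le_lt_trans yv vb).
  rewrite !dN ?(lt_trans ax xy) ?(lt_trans xy yb)//.
  by rewrite ltrN2; apply: mono => //; apply: inI.
Qed.

(** * From a field to a function *)

Section Convexity.
Variable R : realType.

Definition second_diff (phi : R -> R) x t := phi (x + t) + phi (x - t) - 2 * phi x.

Definition convex_on (phi : R -> R) u v := forall x y z,
  u <= x -> x < y -> y < z -> z <= v ->
  phi y * (z - x) <= phi x * (z - y) + phi z * (y - x).

(* Where [phi] exceeds a chord, [phi] minus the chord plus a small convex
   quadratic still has an interior maximum. *)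
Lemma not_convex (phi : R -> R) u v :
  (forall x : R, u <= x -> x <= v -> {for x, continuous phi}) ->
  ~ convex_on phi u v -> exists m d, [/\ 0 < d, u <= m - d, m + d <= v &
    forall t, 0 < t -> t < d -> second_diff phi m t < 0].
Proof.
move=> cphi /existsNP[x /existsNP[y /existsNP[z]]].
move=> /not_implyP[ux /not_implyP[xy /not_implyP[yz /not_implyP[zv /negP]]]].
rewrite -ltNge => lt; have xz : x < z by exact: lt_trans yz.
have zx0 : 0 < z - x by rewrite subr_gt0.
pose k := (phi z - phi x) / (z - x); pose G := phi y - phi x - k * (y - x).
have kE : k * (z - x) = phi z - phi x by rewrite divfK// gt_eqF.
have G0 : 0 < G.
  rewrite -(pmulr_rgt0 _ zx0) /G.
  have -> : (z - x) * (phi y - phi x - k * (y - x)) =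
    phi y * (z - x) - phi x * (z - x) - k * (z - x) * (y - x) by ring.
  by rewrite kE; lra.
have q0 : 0 < (y - x) * (z - y) by rewrite mulr_gt0// subr_gt0.
pose e := G / (2 * ((y - x) * (z - y))).
have e0 : 0 < e by rewrite divr_gt0// mulr_gt0.
have eE : e * ((y - x) * (z - y)) = G / 2.
  by rewrite /e; field; apply/andP; split; rewrite gt_eqF// subr_gt0.
pose psi w := phi w + (e * ((w - x) * (w - z)) - phi x - k * (w - x)).
have cpsi : {within `[x, z], continuous psi}.
  apply: continuous_in_subspaceT => w /set_mem; rewrite /= in_itv /= => /andP[xw wz].
  apply: cvgD; first by apply: cphi; lra.
  apply: cvgB; first apply: cvgB; last 1 first.
  - by apply: cvgM; [exact: cvg_cst|apply: cvgB; [exact: cvg_id|exact: cvg_cst]].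
  - apply: cvgM; first exact: cvg_cst.
    by apply: cvgM; (apply: cvgB; [exact: cvg_id|exact: cvg_cst]).
  - exact: cvg_cst.
have [m mxz Hm] := EVT_max (ltW xz) cpsi.
have inI t : x <= t -> t <= z -> t \in `[x, z] by move=> ? ?; rewrite in_itv /=; apply/andP.
have psix : psi x = 0 by rewrite /psi; ring.
have psiz : psi z = 0.
  by rewrite /psi; have := kE; rewrite subrr mulr0 mulr0 => ->; ring.
have psiy : 0 < psi y.
  have -> : psi y = G - e * ((y - x) * (z - y)) by rewrite /psi /G; ring.
  by rewrite eE; lra.
have m0 : 0 < psi m by apply: (lt_le_trans psiy); apply: Hm; apply: inI; lra.
move: mxz; rewrite in_itv /= => /andP[xm mz].
have {}xm : x < m.
  by rewrite lt_neqAle xm andbT; apply/eqP => E; move: m0; rewrite -E psix ltxx.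
have {}mz : m < z.
  by rewrite lt_neqAle mz andbT; apply/eqP => E; move: m0; rewrite E psiz ltxx.
have d1 : Num.min (m - x) (z - m) <= m - x by rewrite ge_min lexx.
have d2 : Num.min (m - x) (z - m) <= z - m by rewrite ge_min lexx orbT.
exists m, (Num.min (m - x) (z - m)); split; try lra.
  by rewrite lt_min !subr_gt0 xm.
move=> t t0 td.
have h1 : psi (m + t) <= psi m by apply: Hm; apply: inI; lra.
have h2 : psi (m - t) <= psi m by apply: Hm; apply: inI; lra.
have E : psi (m + t) + psi (m - t) - 2 * psi m = second_diff phi m t + 2 * (e * t ^+ 2).
  by rewrite /psi /second_diff; ring.
have : 0 < e * t ^+ 2 by rewrite mulr_gt0// exprn_gt0.
by move=> h3; lra.
Qed.

Lemma derive_slope (f : R -> R) (x l : R) : slope (fun h => f (x + h) - f x) l ->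
  is_derive x (1 : R) f l.
Proof.
move=> sf.
have lim : (h^-1 *: ((f \o +%R^~ x) (h *: (1 : R)) - f x)) @[h --> 0^'] --> l.
  apply/cvgrPdist_le => eps eps0; have [d [d0 Hd]] := sf _ eps0.
  apply/nbhs_ballP; exists d => //= h; rewrite /ball /= sub0r normrN => hd h0.
  rewrite /= [h *: 1]mulr1 [h^-1 *: _]/(h^-1 * _) [h + x]addrC.
  have := Hd h hd; have nh : 0 < `|h| by rewrite normr_gt0.
  have -> : f (x + h) - f x - l * h = - ((l - h^-1 * (f (x + h) - f x)) * h) by field.
  by rewrite normrN normrM ler_pM2r.
apply: DeriveDef; first by apply/cvg_ex; exists l.
exact: (cvg_lim _ lim).
Qed.

Variables (phi : R -> R) (u v : R).
Hypothesis phi_cont : forall x : R, u <= x -> x <= v -> {for x, continuous phi}.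
Hypothesis phi_conv : convex_on phi u v.
Hypothesis phi_inc : forall x y, u <= x -> x < y -> y <= v -> phi x < phi y.

Definition chord x y := (phi y - phi x) / (y - x).

Lemma chord3 x y z : u <= x -> x < y -> y < z -> z <= v ->
  [/\ chord x y <= chord x z, chord x z <= chord y z & chord x y <= chord y z].
Proof.
move=> ux xy yz zv; have H := phi_conv ux xy yz zv; rewrite /chord.
have xz := lt_trans xy yz.
rewrite !ler_pdivrMr ?subr_gt0// ![_ / _ * _]mulrAC !ler_pdivlMr ?subr_gt0//.
by split; lra.
Qed.

Lemma chord_le x y z w : u <= x -> x < y -> z < w -> w <= v -> x <= z -> y <= w ->
  chord x y <= chord z w.
Proof.
move=> ux xy zw wv xz yw.
have h1 : chord x y <= chord x w.
  move: yw; rewrite le_eqVlt => /orP[/eqP->//|yw].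
  by have [] := chord3 ux xy yw wv.
apply: le_trans h1 _; move: xz; rewrite le_eqVlt => /orP[/eqP->//|xz].
by have [] := chord3 ux xz zw wv.
Qed.

Lemma chord_gt0 x y : u <= x -> x < y -> y <= v -> 0 < chord x y.
Proof. by move=> ux xy yv; rewrite divr_gt0// subr_gt0//; apply: phi_inc. Qed.

Definition kink (f : R -> R) (s0 rho x : R) := forall s, 0 < s -> s < s0 ->
  (1 + rho) * (f x - f (x - s)) <= f (x + s) - f x.

Variables (u' v' s0 : R).
Hypotheses (s00 : 0 < s0) (us : u <= u' - s0) (sv : v' + s0 <= v).

Definition rslope x := inf [set c | exists s, [/\ 0 < s, s < s0 & c = chord x (x + s)]].

Lemma rslope_has_inf x : u' <= x -> x <= v' ->
  has_inf [set c | exists s, [/\ 0 < s, s < s0 & c = chord x (x + s)]].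
Proof.
have [s1 [h1 h2]] := (s00, (us, sv)).
move=> ux xv; split.
  by exists (chord x (x + s0 / 2)), (s0 / 2); split=> //; lra.
exists 0 => c [s [a b ->]]; apply/ltW/chord_gt0; lra.
Qed.

Lemma rslope_right x z : u' <= x -> x <= v' -> x < z -> z <= v ->
  rslope x <= chord x z.
Proof.
have [s1 [h1 h2]] := (s00, (us, sv)).
move=> ux xv xz zv; have hi := rslope_has_inf ux xv.
pose s := Num.min (s0 / 2) (z - x).
have [sl sr] : s <= s0 / 2 /\ s <= z - x by rewrite !ge_min !lexx orbT.
have sp : 0 < s by rewrite lt_min subr_gt0 xz andbT; lra.
clearbody s.
have : rslope x <= chord x (x + s).
  by apply: ge_inf; [exact: hi.2 | exists s; split=> //; lra].
by move=> le; apply: le_trans le _; apply: chord_le; lra.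
Qed.

Lemma rslope_ge x m : u' <= x -> x <= v' ->
  (forall s, 0 < s -> s < s0 -> m <= chord x (x + s)) -> m <= rslope x.
Proof.
move=> ux xv H; apply: lb_le_inf; first by have [] := rslope_has_inf ux xv.
by move=> c [s [a b ->]]; apply: H.
Qed.

Lemma rslope_left x y : u' <= x -> x <= v' -> u <= y -> y < x -> chord y x <= rslope x.
Proof.
have [s1 [h1 h2]] := (s00, (us, sv)).
by move=> ux xv uy yx; apply: rslope_ge => // s a b; apply: chord_le; lra.
Qed.

Lemma rslope_gt0 x : u' <= x -> x <= v' -> 0 < rslope x.
Proof.
have [s1 [h1 h2]] := (s00, (us, sv)).
move=> ux xv; apply: lt_le_trans (@rslope_left x u _ _ _ _); try lra.
by apply: chord_gt0; lra.
Qed.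

Lemma kinks_finite rho : 0 < rho ->
  finite_set [set x | (u' <= x /\ x <= v') /\ kink phi s0 rho x].
Proof.
have [s1 [h1 h2]] := (s00, (us, sv)).
move=> rho0; have [uv|vu] := leP u' v'; last first.
  by rewrite (_ : [set x | _] = set0)//; apply/seteqP; split=> x // [[a b] _]; lra.
have uu' : u < u' by lra.
have c0 : 0 < chord u u' by apply: chord_gt0; lra.
pose k := rho * chord u u'; have k0 : 0 < k by rewrite mulr_gt0.
rewrite -[X in finite_set X]image_id.
apply: (@finite_key _ _ id (fun x => Num.truncn ((rslope x - 0) / k))
  (Num.truncn ((chord v' v - 0) / k)).+1).
  move=> x [[ux xv] _]; apply: cell_bound => //; first by apply/ltW/rslope_gt0.
  by apply: le_trans (@rslope_right x v _ _ _ _) _ => //; [lra..|apply: chord_le; lra].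
have gap x x' : u' <= x -> x' <= v' -> x < x' -> kink phi s0 rho x' ->
    rslope x + k <= rslope x'.
  move=> ux xv xx' K.
  have P0 : chord u u' <= rslope x.
    by apply: le_trans (@rslope_left x u _ _ _ _); try lra; apply: chord_le; lra.
  have : (1 + rho) * rslope x <= rslope x'.
    apply: rslope_ge => // [|s a b]; first by lra.
    pose t := Num.min s (x' - x).
    have [ts tx] : t <= s /\ t <= x' - x by rewrite !ge_min !lexx orbT.
    have t0 : 0 < t by rewrite lt_min a subr_gt0.
    clearbody t.
    have ts0 : t < s0 by lra.
    apply: (@le_trans _ _ (chord x' (x' + t))); last by apply: chord_le; lra.
    apply: (@le_trans _ _ ((1 + rho) * chord (x' - t) x')).
      rewrite ler_pM2l; last by lra.
      apply: (@le_trans _ _ (chord x x')); first by apply: rslope_right; lra.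
      by apply: chord_le; lra.
    have := K t t0 ts0; rewrite /chord.
    have -> : x' - (x' - t) = t by ring.
    have -> : x' + t - x' = t by ring.
    by move=> le; rewrite mulrA ler_pM2r ?invr_gt0.
  have : k <= rho * rslope x by rewrite ler_pM2l.
  by move=> ? ?; lra.
move=> x x' [[ux xv] K] [[ux' xv'] K'] E.
have P1 : 0 <= rslope x by apply/ltW/rslope_gt0.
have P2 : 0 <= rslope x' by apply/ltW/rslope_gt0.
have := same_cell k0 P1 P2 E; rewrite ltr_norml => /andP[l1 l2].
case: (ltgtP x x') => // lt.
  by have := gap x x' ux xv' lt K'; lra.
by have := gap x' x ux' xv lt K; lra.
Qed.

Lemma rslope_right_approx x e : u' <= x -> x <= v' -> 0 < e ->
  exists s, [/\ 0 < s, s < s0 & chord x (x + s) < rslope x + e].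
Proof.
move=> ux xv e0; have hi := rslope_has_inf ux xv.
by have [c [s [a b ->]] lt] := inf_adherent e0 hi; exists s.
Qed.

Lemma rslope_left_approx x e : u' <= x -> x <= v' ->
  (forall rho, 0 < rho -> ~ kink phi s0 rho x) -> 0 < e ->
  exists s, [/\ 0 < s, s < s0 & rslope x - e < chord (x - s) x].
Proof.
have [s1 [h1 h2]] := (s00, (us, sv)).
move=> ux xv nk e0; have P0 := rslope_gt0 ux xv.
have r0 : 0 < e / rslope x by rewrite divr_gt0.
have /existsNP[s /not_implyP[s0' /not_implyP[ss /negP]]] := nk _ r0.
rewrite -ltNge => lt; exists s; split=> //.
have a1 : rslope x <= chord x (x + s) by apply: rslope_right; lra.
have a2 : chord (x - s) x <= rslope x by apply: rslope_left; lra.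
have : chord x (x + s) < (1 + e / rslope x) * chord (x - s) x.
  rewrite /chord; have -> : x - (x - s) = s by ring.
  have -> : x + s - x = s by ring.
  by rewrite mulrA ltr_pM2r ?invr_gt0.
have : e / rslope x * chord (x - s) x <= e.
  by rewrite mulrAC ler_pdivrMr// ler_pM2l.
by move=> ? ?; lra.
Qed.

Lemma no_kink_slope x : u' <= x -> x <= v' ->
  (forall rho, 0 < rho -> ~ kink phi s0 rho x) ->
  slope (fun h => phi (x + h) - phi x) (rslope x).
Proof.
have [s1 [h1 h2]] := (s00, (us, sv)).
move=> ux xv nk e e0.
have [s [s_0 ss sr]] := rslope_right_approx ux xv e0.
have [t [t_0 tt tl]] := rslope_left_approx ux xv nk e0.
exists (Num.min s t); split=> [|h]; first by rewrite lt_min s_0.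
rewrite lt_min => /andP[hs ht].
case: (ltgtP h 0) => [hn|hp|->]; last by rewrite addr0 subrr mulr0 subrr normr0 mulr0.
  move: ht hs; rewrite (ltr0_norm hn) => ht hs.
  have a1 : chord (x - t) x <= chord (x + h) x by apply: chord_le; lra.
  have a2 : chord (x + h) x <= rslope x by apply: rslope_left; lra.
  have E : phi (x + h) - phi x = chord (x + h) x * h.
    by rewrite /chord; field; lra.
  rewrite E -mulrBl normrM (ltr0_norm hn) ler_pM2r ?oppr_gt0// ler_norml.
  by apply/andP; split; lra.
move: ht hs; rewrite (gtr0_norm hp) => ht hs.
have a1 : chord x (x + h) <= chord x (x + s) by apply: chord_le; lra.
have a2 : rslope x <= chord x (x + h) by apply: rslope_right; lra.
have E : phi (x + h) - phi x = chord x (x + h) * h.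
  by rewrite /chord; field; lra.
rewrite E -mulrBl normrM (gtr0_norm hp) ler_pM2r// ler_norml.
by apply/andP; split; lra.
Qed.

Lemma linear_margin (x k c m : R) : u <= x -> x <= v -> 0 < m ->
  exists d, 0 < d /\ forall y, `|y - x| < d -> `|phi y - phi x| < m / 2 /\ `|c * (y - x)| < m / 2.
Proof.
move=> ux xv m0; have m2 : 0 < m / 2 by rewrite divr_gt0.
have [d [d0 Hd]] := cont_eps (phi_cont ux xv) m2.
have c1 : 0 < `|c| + 1 by rewrite ltr_wpDl.
exists (Num.min d (m / 2 / (`|c| + 1))); split=> [|y].
  by rewrite lt_min d0 divr_gt0.
rewrite lt_min => /andP[/Hd h1]; rewrite ltr_pdivlMr// => h2; split=> //.
rewrite normrM; apply: le_lt_trans h2; rewrite mulrC ler_wpM2l//; lra.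
Qed.

Lemma no_kink_continuous (x : R) : u' < x -> x < v' ->
  (forall rho, 0 < rho -> ~ kink phi s0 rho x) -> {for x, continuous rslope}.
Proof.
have [s1 [h1 h2]] := (s00, (us, sv)).
move=> ux xv nk; apply: eps_cont => e e0.
have [s [s_0 ss sr]] := rslope_right_approx (ltW ux) (ltW xv) e0.
have [t [t_0 tt tl]] := rslope_left_approx (ltW ux) (ltW xv) nk e0.
have uxu : u <= x by lra.
have xvv : x <= v by lra.
have m1 : 0 < (rslope x + e) * s - (phi (x + s) - phi x).
  by move: sr; rewrite /chord addrAC subrr add0r ltr_pdivrMr// subr_gt0.
have m2 : 0 < (phi x - phi (x - t)) - (rslope x - e) * t.
  by move: tl; rewrite /chord opprB addrCA subrr addr0 ltr_pdivlMr// subr_gt0.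
have [d1 [d10 H1]] := linear_margin 0 (rslope x + e) uxu xvv m1.
have [d2 [d20 H2]] := linear_margin 0 (rslope x - e) uxu xvv m2.
exists (Num.min (Num.min d1 d2) (Num.min (Num.min s t) (Num.min (x - u') (v' - x)))).
split=> [|y]; first by rewrite !lt_min d10 d20 s_0 t_0 !subr_gt0 ux xv.
rewrite !lt_min => /andP[/andP[/H1[p1 q1] /H2[p2 q2]] /andP[/andP[ys yt] /andP[yu yv]]].
have [a1 a2 b1 b2] : [/\ rslope y <= chord y (x + s), chord (x - t) y <= rslope y,
    y < x + s & x - t < y].
  move: ys yt yu yv {p1 q1 p2 q2 m1 m2 H1 H2 sr tl}; rewrite !ltr_norml.
  move=> /andP[? ?] /andP[? ?] /andP[? ?] /andP[? ?].
  have [? ? ? ?] : [/\ u' <= y, y <= v', y < x + s & x - t < y] by split; lra.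
  by split=> //; [apply: rslope_right|apply: rslope_left] => //; lra.
have a3 : chord y (x + s) < rslope x + e.
  move: p1 q1; rewrite /chord ltr_pdivrMr ?subr_gt0// !ltr_norml.
  move=> /andP[? ?] /andP[? ?] {p2 q2 m2 ys yt yu yv a1 a2 h1 h2}.
  by rewrite (_ : x + s - y = s - (y - x)) ?mulrBr; [lra|ring].
have a4 : rslope x - e < chord (x - t) y.
  rewrite /chord ltr_pdivlMr ?subr_gt0//; move: p2 q2; rewrite !ltr_norml.
  move=> /andP[? ?] /andP[? ?] {p1 q1 m1 ys yt yu yv a1 a2 a3 h1 h2}.
  by rewrite (_ : y - (x - t) = t + (y - x)) ?mulrDr; [lra|ring].
rewrite ltr_norml; apply/andP; split.
  by rewrite ltrBrDl; exact: lt_le_trans a4 a2.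
by rewrite ltrBlDl; exact: le_lt_trans a1 a3.
Qed.

End Convexity.

Section Components.
Variable R : realType.

Lemma left_end (k : R -> R) p m :
  (forall x : R, p <= x -> x <= m -> {for x, continuous k}) ->
  p < m -> k p <= 0 -> 0 < k m -> exists c, [/\ p <= c, c < m, k c <= 0 &
    forall s, c < s -> s <= m -> 0 < k s].
Proof.
move=> ck pm kp km.
pose S := [set s : R | p <= s <= m /\ k s <= 0].
have Sp : S p by split; [rewrite lexx ltW|].
have supS : has_sup S by split; [exists p | exists m => s [/andP[]]].
pose c := sup S.
have pc : p <= c by apply: (sup_upper_bound supS).
have cm : c <= m by apply: ge_sup; [exact: supS.1 | move=> s [/andP[]]].
have pos s : c < s -> s <= m -> 0 < k s.
  move=> cs sm; rewrite ltNge; apply/negP => ks.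
  suff : s <= c by rewrite leNgt cs.
  by apply: (sup_upper_bound supS); split=> //; rewrite sm andbT; lra.
have kc : k c <= 0.
  rewrite leNgt; apply/negP => kc.
  have [d [d0 Hd]] := cont_itv (ck c pc cm) kc.
  have [s Ss] := sup_adherent d0 supS; rewrite -/c => cs.
  have sc : s <= c by apply: (sup_upper_bound supS).
  by have := Ss.2; have [||h1 h2] := Hd s; lra.
exists c; split=> //; rewrite lt_neqAle cm andbT; apply/eqP => E.
by move: km; rewrite -E ltNge kc.
Qed.

Lemma right_end (k : R -> R) m q :
  (forall x : R, m <= x -> x <= q -> {for x, continuous k}) ->
  m < q -> 0 < k m -> k q <= 0 -> exists d, [/\ m < d, d <= q, k d <= 0 &
    forall s, m <= s -> s < d -> 0 < k s].
Proof.
move=> ck mq km kq.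
have [||||c [h1 h2 h3 h4]] := @left_end (fun x => k (- x)) (- q) (- m).
- move=> x h1 h2; apply: (@continuous_comp _ _ _ (fun y : R => - y)).
    exact: opp_continuous.
  by apply: ck; lra.
- by rewrite ltrN2.
- by rewrite opprK.
- by rewrite opprK.
exists (- c); split=> //; try lra.
by move=> s ms sc; have := h4 (- s); rewrite opprK; apply; lra.
Qed.

End Components.

Section FieldInterval.
Variables (R : realType) (L : signature) (M : expansion R L).
Variables (phi : R -> R) (a b : R).
Hypothesis phi_inc : forall x y, a < x -> x < y -> y < b -> phi x < phi y.
Hypothesis phi_onto : forall w, exists x, [/\ a < x, x < b & phi x = w].
Hypothesis vs : value_system M phi setT.

Lemma phi_lt x y : a < x -> x < b -> a < y -> y < b -> (phi x < phi y) = (x < y).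
Proof.
move=> ax xb ay yb; apply/idP/idP => [|xy]; last exact: phi_inc.
by case: (ltgtP x y) => [//|yx|->]; rewrite ?ltxx// ltNge (ltW (phi_inc ay yx xb)).
Qed.

Lemma phi_le x y : a < x -> x < b -> a < y -> y < b -> (phi x <= phi y) = (x <= y).
Proof. by move=> *; rewrite leNgt phi_lt// -leNgt. Qed.

Lemma phi_inj x y : a < x -> x < b -> a < y -> y < b -> phi x = phi y -> x = y.
Proof.
move=> ax xb ay yb E; case: (ltgtP x y) => // [xy|yx].
  by have := phi_inc ax xy yb; rewrite E ltxx.
by have := phi_inc ay yx xb; rewrite E ltxx.
Qed.

Lemma phi_continuous (x : R) : a < x -> x < b -> {for x, continuous phi}.
Proof.
move=> ax xb; apply: eps_cont => e e0.
have [x1 [a1 b1 E1]] := phi_onto (phi x - e).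
have [x2 [a2 b2 E2]] := phi_onto (phi x + e).
have x1x : x1 < x by rewrite -phi_lt// E1; lra.
have xx2 : x < x2 by rewrite -phi_lt// E2; lra.
exists (Num.min (x - x1) (x2 - x)); split=> [|y]; first by rewrite lt_min !subr_gt0 x1x.
rewrite lt_min !ltr_norml => /andP[/andP[h1 h2] /andP[h3 h4]].
have [y1 y2] : x1 < y /\ y < x2 by split; lra.
have := phi_inc a1 y1 (lt_trans y2 b2); have := phi_inc (lt_trans a1 y1) y2 b2.
by rewrite E1 E2 => ? ?; apply/andP; split; lra.
Qed.

Lemma fDV_const c : DV M phi setT (fun=> c).
Proof. exact: (DV_const vs). Qed.

Lemma fDV_phi t : DT M t -> DV M phi setT (fun v => phi (t v)).
Proof. by move=> dt; apply: (DV_phi vs). Qed.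

Lemma fDV_add t u : DV M phi setT t -> DV M phi setT u ->
  DV M phi setT (fun v => t v + u v).
Proof. by move=> dt du; apply: (DV_add vs). Qed.

Lemma fDV_mul t u : DV M phi setT t -> DV M phi setT u ->
  DV M phi setT (fun v => t v * u v).
Proof. by move=> dt du; apply: (DV_mul vs). Qed.

Lemma fDV_opp t : DV M phi setT t -> DV M phi setT (fun v => - t v).
Proof. by move=> dt; apply: (DV_opp vs). Qed.

Ltac dv_tac := repeat
  lazymatch goal with
  | |- DV _ _ _ (fun v => phi (@?t v)) => apply: (@fDV_phi t); def_tac
  | |- DV _ _ _ (fun v => @?t v + @?u v) => apply: (@fDV_add t u)
  | |- DV _ _ _ (fun v => @?t v * @?u v) => apply: (@fDV_mul t u)
  | |- DV _ _ _ (fun v => - @?t v) => apply: (@fDV_opp t)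
  | |- DV _ _ _ (fun v => _) => apply: fDV_const
  end.

Lemma rescaled_system u v : a < u -> u < v -> v < b ->
  value_system M (fun s => (phi s - phi u) / (phi v - phi u)) setT.
Proof.
move=> au uv vb; have k0 : 0 < phi v - phi u by rewrite subr_gt0 phi_inc.
have kn0 : phi v - phi u != 0 by rewrite gt_eqF.
split.
- apply: (@Def_ext _ _ _ (fun v => phi (v 0%N) < phi (v 1%N))); last exact: (vs_lt vs).
  by move=> w; rewrite ltr_pM2r ?invr_gt0// ltrD2r.
- apply: (@Def_ext _ _ _ (fun w => phi (w 0%N) + phi (w 1%N) = phi (w 2%N) + phi u)).
    move=> w; split=> [E|[_ E]].
      by split=> //; rewrite -mulrDl; congr (_ / _); lra.
    by move: E; rewrite -mulrDl => /(mulIf (invr_neq0 kn0)); lra.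
  by apply: (Def_eqV vs); dv_tac.
- apply: (@Def_ext _ _ _ (fun w => (phi (w 0%N) - phi u) * (phi (w 1%N) - phi u) =
     (phi (w 2%N) - phi u) * (phi v - phi u))).
    move=> w; split=> [E|[_ E]].
      by split=> //; rewrite mulf_div E -mulf_div divff// mulr1.
    move: E; rewrite mulf_div => /eqP.
    by rewrite eqr_div ?mulf_neq0// mulrA => /eqP/(mulIf kn0).
  by apply: (Def_eqV vs); dv_tac.
move=> w _; have [x [_ _ xE]] := phi_onto (w * (phi v - phi u) + phi u).
by exists x; rewrite xE addrK mulfK.
Qed.

Lemma field_coding_PN u v (E : R -> R -> Prop) : a < u -> u < v -> v < b ->
  Def M (fun v => E (v 0%N) (v 1%N)) ->
  (forall r r' s, 0 < r' -> r' <= r -> E r s -> E r' s) ->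
  (forall r, 0 < r -> finite_set (E r)) ->
  (forall x y, u <= x -> x < y -> y <= v -> exists r s, [/\ 0 < r, E r s & x < s < y]) ->
  defines_copy_PN M.
Proof.
move=> au uv vb dE Eanti Efin Edense.
have k0 : 0 < phi v - phi u by rewrite subr_gt0 phi_inc.
have solve w : 0 <= w <= 1 -> exists s, [/\ u <= s, s <= v & (phi s - phi u) / (phi v - phi u) = w].
  move=> /andP[w0 w1]; have [s [as_ sb sE]] := phi_onto (w * (phi v - phi u) + phi u).
  have [ub av] := (lt_trans uv vb, lt_trans au uv).
  exists s; rewrite -(phi_le au ub as_ sb) -(phi_le as_ sb av vb) sE; split.
  - by rewrite lerDr mulr_ge0// ltW.
  - by rewrite -lerBrDr ler_piMl// ltW.
  - by rewrite addrK mulfK ?gt_eqF.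
apply: (@value_coding_PN _ _ _ _ _ (rescaled_system au uv vb) _
  [set s | u <= s /\ s <= v] E) => //.
- by rewrite /=; def_tac.
- move=> s [us sv]; rewrite divr_ge0 ?(ltW k0)//= ?ler_pdivrMr//.
    by rewrite mul1r lerD2r phi_le//; lra.
  by rewrite subr_ge0 phi_le//; lra.
- by move=> w /solve[s [us sv sE]]; exists s.
- move=> s t [us sv] [ut tv] /divIf; rewrite gt_eqF// => /(_ isT) E1.
  by apply: phi_inj; lra.
- by move=> r r0; apply: finite_image; apply: Efin.
move=> w1 w2 w10 w12 w21.
have [|x [ux xv xE]] := solve w1; first by apply/andP; split; lra.
have [|y [uy yv yE]] := solve w2; first by apply/andP; split; lra.
have xy : x < y.
  move: w12; rewrite -xE -yE ltr_pM2r ?invr_gt0// ltrD2r phi_lt//; lra.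
have [r [s [r0 Es /andP[xs sy]]]] := Edense x y ux xy yv.
exists r, s; split=> //; rewrite -xE -yE !ltr_pM2r ?invr_gt0// !ltrD2r.
by rewrite !phi_lt ?xs//; lra.
Qed.


Section Oscillation.
Variables (al be t0 : R).
Hypotheses (albe : al < be) (t00 : 0 < t0) (at0 : a < al - 2 * t0) (bt0 : be + 2 * t0 < b).
Let h x t := second_diff phi x t.
Hypothesis both_signs : forall (sg : bool) u v, al <= u -> u < v -> v <= be ->
  exists m d, [/\ 0 < d, u <= m - d, m + d <= v &
    forall t, 0 < t -> t < d -> 0 < (-1) ^+ sg * h m t].

Lemma h_cont_x (t x : R) : 0 <= t -> t <= t0 -> al - t0 <= x -> x <= be + t0 ->
  {for x, continuous (fun y => h y t)}.
Proof.
have [g1 [g2 g3]] := (t00, (at0, bt0)); move=> t1 t2 x1 x2.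
apply: cvgB; first apply: cvgD.
- apply: (@continuous_comp _ _ _ (fun y : R => y + t)).
    by apply: cvgD; [exact: cvg_id|exact: cvg_cst].
  by apply: phi_continuous; lra.
- apply: (@continuous_comp _ _ _ (fun y : R => y - t)).
    by apply: cvgB; [exact: cvg_id|exact: cvg_cst].
  by apply: phi_continuous; lra.
- by apply: cvgM; [exact: cvg_cst|apply: phi_continuous; lra].
Qed.

Lemma h_cont_t (x t : R) : 0 <= t -> t <= t0 -> al <= x -> x <= be ->
  {for t, continuous (fun s => h x s)}.
Proof.
have [g1 [g2 g3]] := (t00, (at0, bt0)); move=> t1 t2 x1 x2.
apply: cvgB; first apply: cvgD.
- apply: (@continuous_comp _ _ _ (fun s : R => x + s)).
    by apply: cvgD; [exact: cvg_cst|exact: cvg_id].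
  by apply: phi_continuous; lra.
- apply: (@continuous_comp _ _ _ (fun s : R => x - s)).
    by apply: cvgB; [exact: cvg_cst|exact: cvg_id].
  by apply: phi_continuous; lra.
- exact: cvg_cst.
Qed.

Lemma sign_neighborhood (sg : bool) u v e : al <= u -> u < v -> v <= be -> 0 < e ->
  exists u' v' t, [/\ u < u', u' < v', v' < v, 0 < t < e & forall x, u' <= x -> x <= v' ->
    0 < (-1) ^+ sg * h x t].
Proof.
have [g1 [g2 g3]] := (t00, (at0, bt0)).
move=> au uv vb e0; have [m [d [d0 um mv Hd]]] := both_signs sg au uv vb.
pose t := Num.min (Num.min d e) t0 / 2.
have [td te tt] : [/\ t < d, t < e & t < t0].
  have : 0 < Num.min (Num.min d e) t0 by rewrite !lt_min d0 e0 t00.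
  have : Num.min (Num.min d e) t0 <= d by rewrite !ge_min lexx.
  have : Num.min (Num.min d e) t0 <= e by rewrite !ge_min lexx orbT.
  have : Num.min (Num.min d e) t0 <= t0 by rewrite !ge_min lexx orbT.
  by rewrite /t => *; split; lra.
have tp : 0 < t by rewrite divr_gt0// !lt_min d0 e0 t00.
clearbody t.
have ch : {for m, continuous (fun y => (-1) ^+ sg * h y t)}.
  by apply: cvgM; [exact: cvg_cst|apply: h_cont_x; lra].
have [d1 [d10 H1]] := cont_itv ch (Hd t tp td).
pose d2 := Num.min d d1 / 2.
have [d2d d2d1 d20] : [/\ d2 < d, d2 < d1 & 0 < d2].
  have : 0 < Num.min d d1 by rewrite !lt_min d0 d10.
  have : Num.min d d1 <= d by rewrite !ge_min lexx.
  have : Num.min d d1 <= d1 by rewrite !ge_min lexx orbT.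
  by rewrite /d2 => *; split; lra.
clearbody d2.
exists (m - d2), (m + d2), t; split; try lra.
by move=> x x1 x2; have [||] := H1 x; lra.
Qed.

Lemma oscillating_point : exists x0, al <= x0 <= be /\ forall (sg : bool) e, 0 < e ->
  exists t, 0 < t < e /\ 0 < (-1) ^+ sg * h x0 t.
Proof.
pose good k (p q : R * R) := al <= p.1 -> p.1 < p.2 -> p.2 <= be ->
  [/\ p.1 < q.1, q.1 < q.2, q.2 < p.2 & forall sg : bool, exists t,
    0 < t < k.+1%:R^-1 /\ forall x, q.1 <= x -> x <= q.2 -> 0 < (-1) ^+ sg * h x t].
have [f Hf] : {f : nat * (R * R) -> R * R & forall s, good s.1 s.2 (f s)}.
  apply: (@choice _ _ (fun (s : nat * (R * R)) q => good s.1 s.2 q)) => -[k [u v]].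
  have [[au uv vb]|ng] := pselect ([/\ al <= u, u < v & v <= be]); last first.
    by exists (u, v) => au uv vb; case: ng.
  have k0 : 0 < k.+1%:R^-1 :> R by rewrite invr_gt0.
  have [u1 [v1 [t1 [a1 a2 a3 a4 a5]]]] := sign_neighborhood false au uv vb k0.
  have [||u2 [v2 [t2 [b1 b2 b3 b4 b5]]]] := sign_neighborhood true _ a2 _ k0.
  - by apply: le_trans au (ltW a1).
  - by apply: le_trans (ltW a3) vb.
  exists (u2, v2) => /= _ _ _; split=> //; [exact: lt_trans b1|exact: lt_trans a3|].
  case; first by exists t2.
  by exists t1; split=> // x x1 x2; apply: a5; [exact: le_trans (ltW b1) x1|exact: le_trans x2 (ltW b3)].
pose G := fix G k := if k is j.+1 then f (j, G j) else (al, be).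
have gG k : [/\ al <= (G k).1, (G k).1 < (G k).2 & (G k).2 <= be].
  elim: k => [|k [i1 i2 i3]] /=; first by split; rewrite ?lexx//.
  have [j1 j2 j3 _] := Hf (k, G k) i1 i2 i3.
  by split=> //; [apply: le_trans i1 (ltW j1) | apply: le_trans (ltW j3) i3].
have sG k : [/\ (G k).1 < (G k.+1).1, (G k.+1).1 < (G k.+1).2, (G k.+1).2 < (G k).2 &
    forall sg : bool, exists t, 0 < t < k.+1%:R^-1 /\
      forall x, (G k.+1).1 <= x -> x <= (G k.+1).2 -> 0 < (-1) ^+ sg * h x t].
  by have [i1 i2 i3] := gG k; exact: Hf (k, G k) i1 i2 i3.
have [x0 Hx] : exists x, forall k, (G k).1 < x < (G k).2.
  apply: (nested_intervals (e := fun k => (G k).1) (b := fun k => (G k).2)) => k.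
  - by have [] := sG k.
  - by have [] := sG k.
  - by have [] := gG k.
exists x0; split; first by have /andP[h1 h2] := Hx 0%N; apply/andP; split; apply: ltW.
move=> sg e e0; pose k := Num.truncn e^-1.
have ke : k.+1%:R^-1 < e by rewrite invf_plt ?posrE//; apply: truncnS_gt.
have [_ _ _ /(_ sg)[t [/andP[tp tk] Ht]]] := sG k.
have /andP[x1 x2] := Hx k.+1.
exists t; split; first by rewrite tp (lt_trans tk).
by apply: Ht; apply: ltW.
Qed.

Variable x0 : R.
Hypothesis x0_in : al <= x0 <= be.
Hypothesis x0_osc : forall (sg : bool) e, 0 < e ->
  exists t, 0 < t < e /\ 0 < (-1) ^+ sg * h x0 t.

(* The lengths of the components of [t : 0 < h x0 t]: a definable sequence
   converging to 0. *)
Let comp c l := [/\ 0 < c, 0 < l, c + l < t0 & [/\ h x0 c <= 0, h x0 (c + l) <= 0 &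
  forall s, c < s -> s < c + l -> 0 < h x0 s]].

Lemma comp_small e : 0 < e -> exists c l, comp c l /\ l < e.
Proof.
move=> e0; have m0 : 0 < Num.min e t0 by rewrite lt_min e0 t00.
have [t1 [/andP[t1p t1e]]] := x0_osc true m0; rewrite expr1 mulN1r oppr_gt0 => n1.
have [t2 [/andP[t2p t21]]] := x0_osc false t1p; rewrite expr0 mul1r => p2.
have [t3 [/andP[t3p t32]]] := x0_osc true t2p; rewrite expr1 mulN1r oppr_gt0 => n3.
move: t1e; rewrite lt_min => /andP[t1e t1t].
have /andP[x01 x02] := x0_in.
have [|c [c1 c2 c3 c4]] := left_end (k := h x0) _ t32 (ltW n3) p2.
  by move=> s s1 s2; apply: h_cont_t; lra.
have [|d [d1 d2 d3 d4]] := right_end (k := h x0) _ t21 p2 (ltW n1).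
  by move=> s s1 s2; apply: h_cont_t; lra.
exists c, (d - c); split; last by lra.
have E : c + (d - c) = d by ring.
split; rewrite ?E; try lra.
split=> // s cs sd; have [st|ts] := leP s t2; first exact: c4.
by apply: d4 => //; apply: ltW.
Qed.

Lemma comp_finite r : 0 < r -> finite_set [set l | r <= l /\ exists c, comp c l].
Proof.
move=> r0; set A := [set l | _].
have [g Hg] : {g : R -> R & forall l, A l -> comp (g l) l}.
  apply: (@choice _ _ (fun l c => A l -> comp c l)) => l.
  have [[rl [c cl]]|nA] := pselect (A l); first by exists c.
  by exists 0 => Al; case: nA.
rewrite -[A]image_id.
apply: (@finite_key _ _ id (fun l => Num.truncn ((g l - 0) / r))
  (Num.truncn ((t0 - 0) / r)).+1).
  move=> l Al; have [c0 l0 lt _] := Hg l Al.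
  by apply: cell_bound => //; [exact: ltW|lra].
move=> l l' Al Al' E.
have [c0 l0 lt [h1 h2 h3]] := Hg l Al; have [c0' l0' lt' [h1' h2' h3']] := Hg l' Al'.
have [rl _] := Al; have [rl' _] := Al'.
have := same_cell r0 (ltW c0) (ltW c0') E; rewrite ltr_norml => /andP[l1 l2].
case: (ltgtP (g l) (g l')) => cc.
- have P : 0 < h x0 (g l') by apply: h3 => //; lra.
  by move: P; rewrite ltNge h1'.
- have P : 0 < h x0 (g l) by apply: h3' => //; lra.
  by move: P; rewrite ltNge h1.
case: (ltgtP l l') => // ll.
- have P : 0 < h x0 (g l + l) by apply: h3'; lra.
  by move: P; rewrite ltNge h2.
- have P : 0 < h x0 (g l' + l') by apply: h3; lra.
  by move: P; rewrite ltNge h2'.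
Qed.

Let ends r x := (al <= x /\ x <= be) /\ exists t, (exists c, comp c t) /\ r <= t /\
  ((h x t <= 0 /\ forall s, 0 < s -> s < r -> 0 < h (x + s) t) \/
   (0 <= h x t /\ forall s, 0 < s -> s < r -> h (x + s) t < 0)).

Lemma ends_finite r : 0 < r -> finite_set (ends r).
Proof.
move=> r0.
pose X (sg : bool) t := [set x | (al <= x /\ x <= be) /\ (-1) ^+ sg * h x t <= 0 /\
  forall s, 0 < s -> s < r -> 0 < (-1) ^+ sg * h (x + s) t].
have finX sg t : finite_set (X sg t).
  rewrite -[X sg t]image_id.
  apply: (@finite_key _ _ id (fun x => Num.truncn ((x - al) / r))
    (Num.truncn ((be - al) / r)).+1).
    by move=> x [[x1 x2] _]; apply: cell_bound.
  move=> x y [[x1 x2] [x3 x4]] [[y1 y2] [y3 y4]] /(same_cell r0 x1 y1).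
  rewrite ltr_norml => /andP[l1 l2].
  case: (ltgtP x y) => // xy.
    have P : 0 < (-1) ^+ sg * h (x + (y - x)) t by apply: x4; lra.
    by move: P; rewrite addrC subrK ltNge y3.
  have P : 0 < (-1) ^+ sg * h (y + (x - y)) t by apply: y4; lra.
  by move: P; rewrite addrC subrK ltNge x3.
apply: (@sub_finite_set _ _ (\bigcup_(t in [set l | r <= l /\ exists c, comp c l])
    (X false t `|` X true t))).
  move=> x [xab [t [ct [rt H]]]]; exists t => //; case: H => -[p q]; [left|right].
    by split=> //; rewrite expr0 mul1r; split=> // s s1 s2; rewrite mul1r; apply: q.
  split=> //; rewrite expr1 mulN1r oppr_le0; split=> // s s1 s2.
  by rewrite mulN1r oppr_gt0; apply: q.
apply: bigcup_finite; first exact: comp_finite.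
by move=> t _; rewrite finite_setU; split; apply: finX.
Qed.

Lemma ends_dense x y : al <= x -> x < y -> y <= be ->
  exists r s, [/\ 0 < r, ends r s & x < s < y].
Proof.
have [g1 [g2 g3]] := (t00, (at0, bt0)).
move=> ax xy yb.
have [m [d [d0 xm my Hd]]] := both_signs false ax xy yb.
have [m' [d' [d'0 xm' my' Hd']]] := both_signs true ax xy yb.
have e0 : 0 < Num.min d d' by rewrite lt_min d0.
have [c [t [ct te]]] := comp_small e0.
have [c0 tp ct0 _] := ct.
move: te; rewrite lt_min => /andP[td td'].
have pm : 0 < h m t by have := Hd t tp td; rewrite expr0 mul1r.
have nm : h m' t < 0 by have := Hd' t tp td'; rewrite expr1 mulN1r oppr_gt0.
have hc (z : R) : al <= z -> z <= be -> {for z, continuous (fun y => h y t)}.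
  by move=> z1 z2; apply: h_cont_x; lra.
have hcN (z : R) : al <= z -> z <= be -> {for z, continuous (fun y => - h y t)}.
  by move=> z1 z2; apply: cvgN; apply: hc.
case: (ltgtP m m') => [mm|mm|E]; last by move: pm nm; rewrite E => h1 h2; lra.
  have [|||e [e1 e2 e3 e4]] := left_end (k := fun y => - h y t) _ mm.
  - by move=> z z1 z2; apply: hcN; lra.
  - lra.
  - lra.
  have r1 : Num.min t (m' - e) <= t by rewrite ge_min lexx.
  have r2 : Num.min t (m' - e) <= m' - e by rewrite ge_min lexx orbT.
  exists (Num.min t (m' - e)), e; split; [by rewrite lt_min tp subr_gt0| |lra].
  split; first by split; lra.
  exists t; split; first by exists c.
  split=> //; right; split; first by lra.
  by move=> s s1 s2; have := e4 (e + s); rewrite oppr_gt0; apply; lra.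
have [|||e [e1 e2 e3 e4]] := left_end (k := fun y => h y t) _ mm.
- by move=> z z1 z2; apply: hc; lra.
- lra.
- lra.
have r1 : Num.min t (m - e) <= t by rewrite ge_min lexx.
have r2 : Num.min t (m - e) <= m - e by rewrite ge_min lexx orbT.
exists (Num.min t (m - e)), e; split; [by rewrite lt_min tp subr_gt0| |lra].
split; first by split; lra.
exists t; split; first by exists c.
split=> //; left; split; first by lra.
by move=> s s1 s2; apply: e4; lra.
Qed.

Lemma Def_ends : Def M (fun v => ends (v 0%N) (v 1%N)).
Proof.
apply: (@Def_ext _ _ _ (fun v => (al <= v 1%N /\ v 1%N <= be) /\
  exists t, (exists c, (0 < c /\ 0 < t /\ c + t < t0) /\
    h x0 c <= 0 /\ h x0 (c + t) <= 0 /\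
    forall s, c < s -> s < c + t -> 0 < h x0 s) /\ v 0%N <= t /\
  ((h (v 1%N) t <= 0 /\ forall s, 0 < s -> s < v 0%N -> 0 < h (v 1%N + s) t) \/
   (0 <= h (v 1%N) t /\ forall s, 0 < s -> s < v 0%N -> h (v 1%N + s) t < 0)))).
  move=> v; split=> -[xab [t [[c H1] H2]]]; split=> //; exists t; split=> //; exists c.
    by case: H1 => -[p1 [p2 p3]] [p4 [p5 p6]].
  by case: H1 => p1 p2 p3 [p4 p5 p6].
have dle t u : DV M phi setT t -> DV M phi setT u -> Def M (fun v => t v <= u v).
  exact: (Def_leV vs).
have dlt t u : DV M phi setT t -> DV M phi setT u -> Def M (fun v => t v < u v).
  exact: (Def_ltV vs).
rewrite /h /second_diff.
apply: Def_and; first by def_tac.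
apply: Def_ex; def_beta; apply: Def_and.
  apply: Def_ex; def_beta; apply: Def_and; first by def_tac.
  apply: Def_and; first by apply: (dle _ _); dv_tac.
  apply: Def_and; first by apply: (dle _ _); dv_tac.
  apply: Def_all; def_beta; apply: Def_imp; first by def_tac.
  apply: Def_imp; first by def_tac.
  by apply: (dlt _ _); dv_tac.
apply: Def_and; first by def_tac.
apply: Def_or; apply: Def_and.
- by apply: (dle _ _); dv_tac.
- apply: Def_all; def_beta; apply: Def_imp; first by def_tac.
  apply: Def_imp; first by def_tac.
  by apply: (dlt _ _); dv_tac.
- by apply: (dle _ _); dv_tac.
- apply: Def_all; def_beta; apply: Def_imp; first by def_tac.
  apply: Def_imp; first by def_tac.
  by apply: (dlt _ _); dv_tac.
Qed.

Lemma oscillation_PN : defines_copy_PN M.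
Proof.
have [g1 [g2 g3]] := (t00, (at0, bt0)).
apply: (@field_coding_PN al be ends) => //; try lra.
- exact: Def_ends.
- move=> r r' s r'0 rr [sab [t [ct [rt H]]]]; split=> //; exists t; split=> //.
  split; first exact: le_trans rt.
  by case: H => -[p q]; [left|right]; split=> // w w0 wr; apply: q => //;
    exact: lt_le_trans rr.
- exact: ends_finite.
- exact: ends_dense.
Qed.

End Oscillation.

Lemma convex_or_concave : ~ defines_copy_PN M -> a < b ->
  exists u v, [/\ a < u, u < v, v < b &
    convex_on phi u v \/ convex_on (fun x => - phi x) u v].
Proof.
move=> noPN ab; apply: contrapT => H; apply: noPN.
pose k := (b - a) / 9; have k0 : 0 < k by rewrite divr_gt0// subr_gt0.
pose al := a + 3 * k; pose be := b - 3 * k.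
have kE : b - a = 9 * k by rewrite /k mulrC divfK.
have [h1 h2 h3] : [/\ al < be, a < al - 2 * k & be + 2 * k < b].
  by rewrite /al /be; split; lra.
have both (sg : bool) u v : al <= u -> u < v -> v <= be -> exists m d,
    [/\ 0 < d, u <= m - d, m + d <= v &
      forall t, 0 < t -> t < d -> 0 < (-1) ^+ sg * second_diff phi m t].
  move=> au uv vb; have [a_u v_b] : a < u /\ v < b by lra.
  have nc g : g = phi \/ g = (fun x => - phi x) -> ~ convex_on g u v.
    by move=> gE cg; apply: H; exists u, v; split=> //; case: gE cg => ->; [left|right].
  have cp (x : R) : u <= x -> x <= v -> {for x, continuous phi}.
    by move=> ux xv; apply: phi_continuous; lra.
  case: sg.
    have [m [d [d0 um mv Hd]]] := not_convex cp (nc _ (or_introl erefl)).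
    exists m, d; split=> // t t0 td.
    by rewrite expr1 mulN1r oppr_gt0; apply: Hd.
  have cN (x : R) : u <= x -> x <= v -> {for x, continuous (fun y => - phi y)}.
    by move=> ux xv; apply: cvgN; apply: cp.
  have [m [d [d0 um mv Hd]]] := not_convex cN (nc _ (or_intror erefl)).
  exists m, d; split=> // t t0 td; rewrite expr0 mul1r -oppr_lt0.
  by have := Hd t t0 td; rewrite /second_diff; lra.
have [x0 [x0in x0osc]] := oscillating_point h1 k0 h2 h3 both.
exact: (oscillation_PN h1 k0 h2 h3 both x0in x0osc).
Qed.

Section Kinks.
Variables (u v s0 : R) (sg : bool).
Hypotheses (au : a < u - s0) (s00 : 0 < s0) (uv : u < v) (vb : v + s0 < b).

Let signed_kink rho x := forall s, 0 < s -> s < s0 ->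
  if sg then (1 + rho) * (phi (x + s) - phi x) <= phi x - phi (x - s)
  else (1 + rho) * (phi x - phi (x - s)) <= phi (x + s) - phi x.

Lemma signed_kink_le rho rho' x : u <= x -> x <= v -> rho' <= rho ->
  signed_kink rho x -> signed_kink rho' x.
Proof.
have [g1 g2] := (au, vb).
move=> ux xv rr H s s_0 ss; have := H s s_0 ss.
have i1 : 0 < phi (x + s) - phi x by rewrite subr_gt0; apply: phi_inc; lra.
have i2 : 0 < phi x - phi (x - s) by rewrite subr_gt0; apply: phi_inc; lra.
by case: sg; apply: le_trans; rewrite ler_pM2r//; lra.
Qed.

Lemma kink_free : ~ defines_copy_PN M ->
  (forall rho, 0 < rho -> finite_set [set x | (u <= x /\ x <= v) /\ signed_kink rho x]) ->
  exists x1 x2, [/\ u <= x1, x1 < x2, x2 <= v & forall x, x1 < x -> x < x2 ->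
    forall rho, 0 < rho -> ~ signed_kink rho x].
Proof.
have [g1 [g2 [g3 g4]]] := (au, (vb, (s00, uv))).
move=> noPN fin.
pose rk r := phi (Num.min (u + r) v) - phi u.
have rk_gt0 r : 0 < r -> 0 < rk r.
  move=> r0; rewrite subr_gt0; apply: phi_inc; first by lra.
    by rewrite lt_min ltrDl r0.
  by rewrite gt_min; apply/orP; right; lra.
have rk_le r r' : 0 < r' -> r' <= r -> rk r' <= rk r.
  move=> r'0; rewrite le_eqVlt => /orP[/eqP->//|rr]; rewrite lerD2r.
  have m1 : u < Num.min (u + r') v by rewrite lt_min ltrDl r'0.
  have m2 : Num.min (u + r) v <= v by rewrite ge_min lexx orbT.
  have m3 : Num.min (u + r') v <= Num.min (u + r) v.
    by rewrite le_min !ge_min lexx orbT andbT lerD2l (ltW rr).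
  by move: m1 m2 m3; set x := Num.min _ _; set y := Num.min _ _ => *; rewrite phi_le; lra.
pose E r x := (u <= x /\ x <= v) /\ signed_kink (rk r) x.
apply: contrapT => H; apply: noPN; apply: (@field_coding_PN u v E) => //; try lra.
- apply: Def_and; first by def_tac.
  have dle t w : DV M phi setT t -> DV M phi setT w -> Def M (fun v => t v <= w v).
    exact: (Def_leV vs).
  rewrite /signed_kink /rk; case: sg.
    apply: Def_all; def_beta; apply: Def_imp; first by def_tac.
    apply: Def_imp; first by def_tac.
    by apply: (dle _ _); dv_tac.
  apply: Def_all; def_beta; apply: Def_imp; first by def_tac.
  apply: Def_imp; first by def_tac.
  by apply: (dle _ _); dv_tac.
- move=> r r' x r'0 rr [[ux xv] K]; split=> //.
  by apply: signed_kink_le K => //; apply: rk_le.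
- by move=> r r0; apply: fin; apply: rk_gt0.
move=> x y ux xy yv; apply: contrapT => nE; apply: H; exists x, y; split=> // z xz zy rho rho0 K.
apply: nE.
have cu : {for u, continuous phi} by apply: phi_continuous; lra.
have [d [d0 Hd]] := cont_itv cu rho0.
pose r := d / 2; have r0 : 0 < r by rewrite divr_gt0.
have rd : rk r <= rho.
  have m1 : u < Num.min (u + r) v by rewrite lt_min ltrDl r0.
  have m2 : Num.min (u + r) v <= u + r by rewrite ge_min lexx.
  have [||_] := Hd (Num.min (u + r) v); rewrite /r in m1 m2 *; try lra.
  by rewrite /rk -/r; lra.
exists r, z; split=> //; last by rewrite xz.
by split; [split; lra | apply: signed_kink_le K => //; lra].
Qed.

End Kinks.

Definition smooth_on (P : R -> R) x1 x2 := forall x : R, x1 < x -> x < x2 ->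
  [/\ is_derive x (1 : R) phi (P x), {for x, continuous P} & 0 < P x].

Lemma smooth_interval : ~ defines_copy_PN M -> a < b ->
  exists P x1 x2, [/\ a < x1, x1 < x2, x2 < b & smooth_on P x1 x2].
Proof.
move=> noPN ab; have [u [v [au uv vb cvx]]] := convex_or_concave noPN ab.
pose s0 := (v - u) / 4.
have s00 : 0 < s0 by rewrite divr_gt0// subr_gt0.
have sE : v - u = 4 * s0 by rewrite /s0 mulrC divfK.
pose u' := u + s0; pose v' := v - s0.
have [h1 h2 h3 h4] : [/\ a < u' - s0, u' < v', v' + s0 < b & u' = u + s0 /\ v' = v - s0].
  by rewrite /u' /v'; split=> //; lra.
clearbody u' v' s0; case: h4 => u'E v'E.
case: cvx => cvx.
  have cp (x : R) : u <= x -> x <= v -> {for x, continuous phi}.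
    by move=> ux xv; apply: phi_continuous; lra.
  have ip x y : u <= x -> x < y -> y <= v -> phi x < phi y.
    by move=> *; apply: phi_inc; lra.
  have us : u <= u' - s0 by lra.
  have sv : v' + s0 <= v by lra.
  have [|x1 [x2 [ux1 x12 x2v nk]]] := @kink_free u' v' s0 false h1 s00 h2 h3 noPN.
    by move=> rho; apply: (kinks_finite cvx ip s00 us sv).
  exists (rslope phi s0), x1, x2; split; try lra.
  move=> x xx1 xx2; have {}nk := nk x xx1 xx2; split.
  - by apply: derive_slope; apply: (no_kink_slope cvx ip s00 us sv) => //; lra.
  - by apply: (no_kink_continuous cp cvx ip s00 us sv) => //; lra.
  - by apply: (rslope_gt0 cvx ip s00 us sv); lra.
pose psi x := - phi (- x).
have cp (x : R) : - v <= x -> x <= - u -> {for x, continuous psi}.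
  move=> ux xv; apply: cvgN; apply: (@continuous_comp _ _ _ (fun y : R => - y)).
    exact: opp_continuous.
  by apply: phi_continuous; lra.
have ip x y : - v <= x -> x < y -> y <= - u -> psi x < psi y.
  by move=> *; rewrite ltrN2; apply: phi_inc; lra.
have cvxN : convex_on psi (- v) (- u).
  move=> x y z vx xy yz zu.
  have [c1 c2 c3 c4] : [/\ u <= - z, - z < - y, - y < - x & - x <= v] by split; lra.
  by have := cvx _ _ _ c1 c2 c3 c4; rewrite /psi; lra.
have us : - v <= - v' - s0 by lra.
have sv : - u' + s0 <= - u by lra.
have kE rho x : kink psi s0 rho (- x) <-> forall s, 0 < s -> s < s0 ->
    (1 + rho) * (phi (x + s) - phi x) <= phi x - phi (x - s).
  have e1 s : psi (- x) - psi (- x - s) = phi (x + s) - phi x.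
    by rewrite /psi opprK opprD !opprK; ring.
  have e2 s : psi (- x + s) - psi (- x) = phi x - phi (x - s).
    by rewrite /psi opprK opprD !opprK; ring.
  by split=> H s h5 h6; have := H s h5 h6; rewrite e1 e2.
have [|x1 [x2 [ux1 x12 x2v nk]]] := @kink_free u' v' s0 true h1 s00 h2 h3 noPN.
  move=> rho rho0; have := kinks_finite cvxN ip s00 us sv rho0.
  move=> /(finite_image -%R); apply: sub_finite_set => x [[ux xv] K].
  exists (- x); last by rewrite opprK.
  by split; [split; lra | apply/kE].
exists (fun x => rslope psi s0 (- x)), x1, x2; split; try lra.
move=> x xx1 xx2; have nkx rho : 0 < rho -> ~ kink psi s0 rho (- x).
  by move=> rho0 /kE; apply: (nk x xx1 xx2 rho rho0).
split.
- apply: derive_slope => e e0.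
  have [||d [d0 Hd]] := no_kink_slope cvxN ip s00 us sv _ _ nkx e0; try lra.
  exists d; split=> // h hd; have := Hd (- h); rewrite !normrN => /(_ hd).
  congr (_ <= _); rewrite -normrN; congr (`|_|).
  by rewrite /psi (_ : - x + - h = - (x + h)) ?opprK; ring.
- apply: (@continuous_comp _ _ _ (fun y : R => - y)); first exact: opp_continuous.
  by apply: (no_kink_continuous cp cvxN ip s00 us sv) => //; lra.
- by apply: (rslope_gt0 cvxN ip s00 us sv); lra.
Qed.

End FieldInterval.

Section FunctionOfField.
Variables (R : realType) (L : signature) (M : expansion R L).
Variables (phi : R -> R) (a b : R).
Hypothesis phi_inc : forall x y, a < x -> x < y -> y < b -> phi x < phi y.
Hypothesis phi_onto : forall w, exists x, [/\ a < x, x < b & phi x = w].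
Hypothesis vs : value_system M phi setT.
Variables (P : R -> R) (x1 x2 : R).
Hypotheses (ax1 : a < x1) (x12 : x1 < x2) (x2b : x2 < b).
Hypothesis smooth : smooth_on phi P x1 x2.

(* Seen through [phi] the function is [w |-> w0 + (w - w0)^2], which has a strict
   minimum at an interior point. *)
Lemma square_function : exists y1 y2 (f : R -> R), [/\ y1 < y2,
  definable_fun1 M `]y1, y2[%classic f, C1_on `]y1, y2[%classic f &
  ~ affine_on `]y1, y2[%classic f].
Proof.
have [g1 [g2 g3]] := (ax1, (x12, x2b)).
have [psi Hpsi] : {psi : R -> R & forall w, [/\ a < psi w, psi w < b & phi (psi w) = w]}.
  by apply: (@choice _ _ (fun w x => [/\ a < x, x < b & phi x = w])) => w; exact: phi_onto.
have inab x : x1 < x -> x < x2 -> a < x /\ x < b.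
  by move=> l1 l2; split; [exact: lt_trans l1 | exact: lt_trans x2b].
have phiK x : a < x -> x < b -> psi (phi x) = x.
  by move=> ax xb; have [h1 h2 h3] := Hpsi (phi x); apply: (phi_inj phi_inc).
pose x0 := (x1 + x2) / 2; pose w0 := phi x0.
have [x10 x02] : x1 < x0 /\ x0 < x2 by rewrite /x0; split; lra.
clearbody x0.
pose W x := w0 + (phi x - w0) * (phi x - w0); pose f x := psi (W x).
have w02 : 0 < Num.min 1 (phi x2 - w0).
  by rewrite lt_min ltr01 subr_gt0; apply: phi_inc; lra.
have c0 : {for x0, continuous phi} by apply: (phi_continuous phi_inc phi_onto); lra.
have [d [d0 Hd]] := cont_eps c0 w02.
pose eta := Num.min d (Num.min (x0 - x1) (x2 - x0)).
have eta0 : 0 < eta by rewrite !lt_min d0 !subr_gt0 x10.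
have [e1 e2 e3] : [/\ eta <= d, eta <= x0 - x1 & eta <= x2 - x0].
  by rewrite !ge_min !lexx !orbT.
clearbody eta.
pose y1 := x0 - eta; pose y2 := x0 + eta.
have [h1 h2 h3 h4] : [/\ x1 <= y1, y1 < x0, x0 < y2 & y2 <= x2].
  by rewrite /y1 /y2; split; lra.
have in12 x : y1 < x -> x < y2 -> x1 < x /\ x < x2.
  by move=> l1 l2; split; [exact: le_lt_trans l1 | exact: lt_le_trans h4].
have W2 x : y1 < x -> x < y2 -> w0 <= W x /\ W x < phi x2.
  move=> l1 l2; have : `|phi x - w0| < Num.min 1 (phi x2 - w0).
    by apply: Hd; rewrite ltr_norml; apply/andP; rewrite /y1 /y2 in l1 l2; split; lra.
  rewrite lt_min => /andP[l3 l4].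
  have sq : (phi x - w0) * (phi x - w0) = `|phi x - w0| * `|phi x - w0|.
    by rewrite -normrM ger0_norm// -expr2 sqr_ge0.
  have s0 : 0 <= `|phi x - w0| by [].
  have s1 : `|phi x - w0| * `|phi x - w0| <= `|phi x - w0| by rewrite ler_piMl// ltW.
  have s2 : 0 <= `|phi x - w0| * `|phi x - w0| by rewrite mulr_ge0.
  by rewrite /W sq; split; lra.
have fx x : y1 < x -> x < y2 -> x0 <= f x /\ f x < x2.
  move=> l1 l2; have [Wl Wr] := W2 x l1 l2; have [p1 p2 p3] := Hpsi (W x).
  split; first by rewrite -(phi_le phi_inc) ?p3//; lra.
  by rewrite -(phi_lt phi_inc) ?p3//; lra.
pose D x := (P (f x))^-1 * (2 * (phi x - w0) * P x).
have fD x : y1 < x -> x < y2 -> is_derive x (1 : R) f (D x).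
  move=> l1 l2; have [f1 f2] := fx x l1 l2.
  have [i1 i2] := in12 x l1 l2; have f3 := lt_le_trans x10 f1.
  have [dx _ _] := smooth i1 i2; have [df _ Pf] := smooth f3 f2.
  have dW : is_derive x (1 : R) W (2 * (phi x - w0) * P x).
    have d1 : is_derive x (1 : R) (fun y => phi y - w0) (P x).
      have := is_deriveB dx (is_derive_cst w0 x (1 : R)).
      by move=> /is_derive_eq; apply; rewrite subr0.
    have := is_deriveD (is_derive_cst w0 x (1 : R)) (is_deriveM d1 d1).
    by move=> /is_derive_eq; apply; rewrite /GRing.scale /=; ring.
  apply: (@is_derive1_comp _ psi W) => //.
  have [p1 p2 p3] := Hpsi (W x); rewrite -[W x]p3 -/(f x).
  apply: is_derive_inverse => //; last by rewrite gt_eqF.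
    near=> y; apply: phiK.
      by near: y; apply: lt_nbhsr.
    by near: y; apply: lt_nbhsl.
  near=> y; apply: (phi_continuous phi_inc phi_onto).
    by near: y; apply: lt_nbhsr.
  by near: y; apply: lt_nbhsl.
have fE x : y1 < x -> x < y2 -> derive1 f x = D x.
  by move=> l1 l2; rewrite derive1E; case: (fD x l1 l2).
have y1x0 : f x0 = x0.
  by have [a2 b2] := inab x0 x10 x02; rewrite /f /W subrr mulr0 addr0 phiK.
exists y1, y2, f; split; first by lra.
- apply/Def_fun1.
  apply: (@Def_ext _ _ _ (fun v => (y1 < v 0%N /\ v 0%N < y2) /\
    (a < v 1%N /\ v 1%N < b) /\ phi (v 1%N) = W (v 0%N))).
    move=> v; split=> [[[l1 l2] [[l3 l4] E]]|[]].
      split; first by rewrite /= in_itv /= l1.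
      by rewrite -[v 1%N]phiK// E.
    rewrite /= in_itv /= => /andP[l1 l2] ->; split=> //.
    by have [p1 p2 p3] := Hpsi (W (v 0%N)).
  apply: Def_and; first by def_tac.
  apply: Def_and; first by def_tac.
  apply: (Def_eqV vs); first by apply: (fDV_phi vs); def_tac.
  have dB : DV M phi setT (fun v => phi (v 0%N) - w0).
    by apply: (fDV_add vs); [apply: (fDV_phi vs); def_tac | exact: (fDV_const vs)].
  apply: (fDV_add vs); first exact: (fDV_const vs).
  by apply: (fDV_mul vs).
- move=> x /set_mem; rewrite /= in_itv /= => /andP[l1 l2].
  split; first by case: (fD x l1 l2).
  apply: (continuous_congr l1 l2 fE).
  have [f1 f2] := fx x l1 l2.
  have [i1 i2] := in12 x l1 l2; have f3 := lt_le_trans x10 f1.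
  have [_ cPx _] := smooth i1 i2; have [_ cPf Pf] := smooth f3 f2.
  apply: cvgM.
    apply: cvgV; first by rewrite gt_eqF.
    apply: (@continuous_comp _ _ _ f P) => //.
    by apply/differentiable_continuous/derivable1_diffP; case: (fD x l1 l2).
  apply: cvgM => //; apply: cvgM; first exact: cvg_cst.
  apply: cvgB; last exact: cvg_cst.
  by have [a1 b1] := inab x i1 i2; apply: (phi_continuous phi_inc phi_onto).
move=> [c [k Hck]].
have above x : y1 < x -> x < y2 -> x != x0 -> x0 < f x.
  move=> l1 l2 nx; have [f1 f2] := fx x l1 l2; rewrite lt_neqAle f1 andbT.
  apply/eqP => E; have [p1 p2 p3] := Hpsi (W x).
  have Ew : phi x0 = W x by rewrite E /f p3.
  have /eqP : (phi x - w0) * (phi x - w0) = 0 by move: Ew; rewrite /W -/w0; lra.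
  rewrite mulf_eq0 orbb subr_eq0 => /eqP E2.
  have [a1 b1] := inab x (in12 x l1 l2).1 (in12 x l1 l2).2.
  have [a2 b2] := inab x0 x10 x02.
  by move/eqP: nx; apply; apply: (phi_inj phi_inc).
have aff x : y1 < x -> x < y2 -> f x = c * x + k.
  by move=> l1 l2; apply: Hck; apply/mem_set; rewrite /= in_itv /= l1.
have e20 : 0 < eta / 2 by rewrite divr_gt0.
have e2e : eta / 2 < eta by rewrite ltr_pdivrMr// ltr_pMr// ltr1n.
have [l1 l2] : y1 < x0 - eta / 2 /\ x0 - eta / 2 < y2.
  by split; [rewrite ltrD2l ltrN2 | apply: lt_trans h3; rewrite gtrBl].
have [r1 r2] : y1 < x0 + eta / 2 /\ x0 + eta / 2 < y2.
  by split; [apply: lt_trans h2 _; rewrite ltrDl | rewrite ltrD2l].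
have n1 : x0 - eta / 2 != x0 by rewrite lt_eqF// gtrBl.
have n2 : x0 + eta / 2 != x0 by rewrite gt_eqF// ltrDl.
have := above _ l1 l2 n1; have := above _ r1 r2 n2.
have := aff x0 h2 h3; rewrite y1x0 !aff// => {Hck above aff W2 fx fD fE} *; lra.
Unshelve. all: by end_near. Qed.

End FunctionOfField.

Lemma function_of_field (R : realType) (L : signature) (M : expansion R L) :
  ~ defines_copy_PN M -> field_type M ->
  exists (a b : R) (f : R -> R), [/\ a < b, definable_fun1 M `]a, b[%classic f,
    C1_on `]a, b[%classic f & ~ affine_on `]a, b[%classic f].
Proof.
move=> noPN [a [b [oplus [otimes /= [ab [cadd cmul] dadd dmul [phi [bij lt add mul]]]]]]].
have inI x : (`]a, b[%classic x) <-> a < x /\ x < b.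
  by rewrite /= in_itv /=; split=> [/andP//|[? ?]]; apply/andP.
have mI x : a < x -> x < b -> x \in `]a, b[%classic.
  by move=> h1 h2; apply/mem_set/inI.
pose z0 := (a + b) / 2.
have [az0 z0b] : a < z0 /\ z0 < b by rewrite /z0; split; lra.
pose c x := if `[< a < x /\ x < b >] then x else z0.
have cI x : a < c x /\ c x < b by rewrite /c; case: asboolP.
have cE x : a < x -> x < b -> c x = x by move=> h1 h2; rewrite /c asboolT.
have dc i : DT M (fun v => c (v i)).
  apply: (@DT_if _ _ _ (fun v => a < v i /\ v i < b) (fun v => v i)); by def_tac.
pose phi' x := phi (c x).
have inj x y : a < x -> x < b -> a < y -> y < b -> phi x = phi y -> x = y.
  by move=> *; case: bij => _ + _; apply => //; exact: mI.
have inc x y : a < x -> x < y -> y < b -> phi' x < phi' y.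
  move=> ax xy yb; have [xb ay] := (lt_trans xy yb, lt_trans ax xy).
  by rewrite /phi' !cE//; apply/(lt _ _ (mI _ ax xb) (mI _ ay yb)).
have onto w : exists x, [/\ a < x, x < b & phi' x = w].
  have [_ _ /(_ w Logic.I)[x /inI[ax xb] xw]] := bij.
  by exists x; rewrite /phi' cE.
have dop op : definable_op1 M `]a, b[%classic op ->
    Def M (fun v => c (v 2%N) = op (c (v 0%N)) (c (v 1%N))).
  move=> /Def_op1 H.
  apply: Def_ext (Def3 (Q := fun x y z => (`]a, b[%classic x /\ `]a, b[%classic y) /\
    z = op x y) H (dc 0%N) (dc 1%N) (dc 2%N)) => v.
  by split=> [[]//|E]; split=> //; split; apply/inI; apply: cI.
have vs : value_system M phi' setT.
  split.
  - apply: (@Def_ext _ _ _ (fun v => c (v 0%N) < c (v 1%N))).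
      move=> v; have [p1 p2] := cI (v 0%N); have [p3 p4] := cI (v 1%N).
      exact: (lt _ _ (mI _ p1 p2) (mI _ p3 p4)).
    by apply: Def_lt; apply: dc.
  - apply: Def_ext (dop _ dadd) => v.
    have [p1 p2] := cI (v 0%N); have [p3 p4] := cI (v 1%N); have [p5 p6] := cI (v 2%N).
    rewrite /phi' -(add _ _ (mI _ p1 p2) (mI _ p3 p4)).
    have /inI[p7 p8] := cadd _ _ (mI _ p1 p2) (mI _ p3 p4).
    by split=> [->//|[_ /inj]->//].
  - apply: Def_ext (dop _ dmul) => v.
    have [p1 p2] := cI (v 0%N); have [p3 p4] := cI (v 1%N); have [p5 p6] := cI (v 2%N).
    rewrite /phi' -(mul _ _ (mI _ p1 p2) (mI _ p3 p4)).
    have /inI[p7 p8] := cmul _ _ (mI _ p1 p2) (mI _ p3 p4).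
    by split=> [->//|[_ /inj]->//].
  - by move=> w _; have [x [_ _ xw]] := onto w; exists x.
have [P [x1 [x2 [ax1 x12 x2b smooth]]]] := smooth_interval inc onto vs noPN ab.
have [y1 [y2 [f [y12 df cf nf]]]] := square_function inc onto vs ax1 x12 x2b smooth.
by exists y1, y2, f.
Qed.

Theorem theoremE (R : realType) (L : signature) (M : expansion R L)
    (noPN : ~ defines_copy_PN M) :
  (exists (a b : R) (f : R -> R),
     [/\ a < b, definable_fun1 M `]a, b[%classic f, C1_on `]a, b[%classic f
       & ~ affine_on `]a, b[%classic f])
  <-> field_type M.
Proof.
split=> [[a [b [f [ab df cf nf]]]]|]; last exact: function_of_field.
exact: field_of_function ab df cf nf.
Qed.
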